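(* Let $B=T_S(M)/(R)$ be a Koszul algebra with $B_0=S$, $B_1=M$ and $R\subseteq M\otimes_S M$ a sub-$S$-bimodule, such that the projective dimension of the graded right $B$-module $S_B$ is $2$. Let $(P^\bullet,\delta^\bullet)$ be the complex of graded $B$-bimodules (constructed from any choice of the liftings $\vartheta$ and homotopy $h$ described in the context) with $$P^0=B\otimes B,\quad P^{-1}=(B\otimes M\otimes_S B)\oplus (B\otimes S\otimes B),$$ $$P^{-n}=(B\otimes S^{\otimes n-2}\otimes R\otimes_S B)\oplus (B\otimes S^{\otimes n-1}\otimes M\otimes_S B)\oplus (B\otimes S^{\otimes n}\otimes B)\quad(n\ge2),$$ and $$\delta^{-n}(x)=\partial^{-n+2}(x)+\vartheta^{-2,-n+2}(x)-h^{-n+2}(x)\ \ (n\ge3,\ x\in B\otimes S^{\otimes n-2}\otimes R\otimes_S B),$$ $$\delta^{-2}(x)=\vartheta^{-2,0}(x)-h^0(x)\ \ (x\in B\otimes R\otimes_S B),$$ $$\delta^{-n}(y)=-\partial^{-n+1}(y)+\vartheta^{-1,-n+1}(y)\ \ (n\ge2,\ y\in B\otimes S^{\otimes n-1}\otimes M\otimes_S B),$$ $$\delta^{-1}(y)=\vartheta^{-1,0}(y)\ \ (y\in B\otimes M\otimes_S B),\qquad \delta^{-n}(z)=\partial^{-n}(z)\ \ (n\ge1,\ z\in B\otimes S^{\otimes n}\otimes B).$$ Then $(P^\bullet,\delta^\bullet)$ is a graded projective resolution of the $B$-bimodule $B$ (with augmentation the multiplication $B\otimes B\to B$).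
   Context: $\Bbbk$ is a fixed field, $\otimes=\otimes_\Bbbk$; $T_S(M)$ is the tensor algebra over $S$ and $(R)$ the two-sided ideal generated by $R$. Koszul algebra: a positively graded algebra $B=\bigoplus_{i\ge0}B_i$ with $\dim_\Bbbk B_i<\infty$ such that, with $S=B_0$, every $B_i$ ($i\ge1$) is projective as a left and as a right $S$-module, and $B_0$ as graded right $B$-module has a graded projective resolution whose $n$-th term is generated in degree $n$ for all $n\ge0$. Then $R$ and $M$ are projective as left and as right $S$-modules. There is an exact sequence of graded $B$-bimodules $$0\to B\otimes_S R\otimes_S B\xrightarrow{d^{-2}}B\otimes_S M\otimes_S B\xrightarrow{d^{-1}}B\otimes_S B\xrightarrow{\mu}B\to0,$$ where $\mu$ is multiplication, $d^{-1}(b_1\otimes_S x\otimes_S b_2)=b_1x\otimes_S b_2-b_1\otimes_S xb_2$, and $d^{-2}$ is the restriction of $b_1\otimes_S x_1\otimes_S x_2\otimes_S b_2\mapsto b_1x_1\otimes_S x_2\otimes_S b_2+b_1\otimes_S x_1\otimes_S x_2b_2$ ($x,x_1,x_2\in M$). For $N\in\{R,M,S\}$, the $B$-bimodule $B\otimes_S N\otimes_S B$ has the projective resolution with terms $B\otimes S^{\otimes i}\otimes N\otimes_S B$ ($i\ge0$), augmentation $\partial^0:B\otimes N\otimes_S B\to B\otimes_S N\otimes_S B$ the canonical projection, and differential ($i\ge1$) $$\partial^{-i}(b\otimes s_1\otimes\cdots\otimes s_i\otimes x\otimes_S b')=bs_1\otimes s_2\otimes\cdots\otimes x\otimes_S b'+\sum_{j=1}^{i-1}(-1)^jb\otimes\cdots\otimes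 s_js_{j+1}\otimes\cdots\otimes x\otimes_S b'+(-1)^ib\otimes s_1\otimes\cdots\otimes s_{i-1}\otimes s_ix\otimes_S b'.$$ For $N=S$, $B\otimes S^{\otimes i}\otimes S\otimes_S B$ is identified with $B\otimes S^{\otimes i}\otimes B$. Liftings: $\vartheta^{-2,-i}:B\otimes S^{\otimes i}\otimes R\otimes_S B\to B\otimes S^{\otimes i}\otimes M\otimes_S B$ and $\vartheta^{-1,-i}:B\otimes S^{\otimes i}\otimes M\otimes_S B\to B\otimes S^{\otimes i}\otimes B$ ($i\ge0$) are graded $B$-bimodule morphisms forming morphisms of these resolutions that lift $d^{-2}$ and $d^{-1}$ respectively (i.e. commuting with $\partial$, with $\partial^0\vartheta^{-2,0}=d^{-2}\partial^0$ and $\partial^0\vartheta^{-1,0}=d^{-1}\partial^0$). Since $d^{-1}d^{-2}=0$, there are graded $B$-bimodule morphisms $h^{-i}:B\otimes S^{\otimes i}\otimes R\otimes_S B\to B\otimes S^{\otimes i+1}\otimes B$ ($i\ge0$) with $\vartheta^{-1,-i}\vartheta^{-2,-i}=\partial^{-i-1}h^{-i}+h^{-i+1}\partial^{-i}$ for $i\ge1$ and $\vartheta^{-1,0}\vartheta^{-2,0}=\partial^{-1}h^0$. *)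

(* Defs.v *)
From HB Require Import structures.
From mathcomp Require Import all_boot all_order all_algebra.
From mathcomp Require Import boolp classical_sets.
Set Implicit Arguments.
Unset Strict Implicit.
Unset Printing Implicit Defensive.
Import Order.TTheory GRing.Theory Num.Theory.
Local Open Scope classical_set_scope.
Local Open Scope quotient_scope.
Local Open Scope ring_scope.

(* Everything is linear over a field k, which acts centrally. A bimod A C is  *)
(* an A-C-bimodule; left A-modules are the case C = k^o, right C-modules the  *)
(* case A = k^o.                                                              *)
Record bimod (k : fieldType) (A C : algType k) := Bimod {
  bcar :> lmodType k;
  lact : A -> bcar -> bcar;
  ract : bcar -> C -> bcar;
  lactP : forall (c : k) a b x, lact (c *: a + b) x = c *: lact a x + lact b x;
  lactD : forall (c : k) a x y, lact a (c *: x + y) = c *: lact a x + lact a y;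
  lact1 : forall x, lact 1 x = x;
  lactA : forall a b x, lact a (lact b x) = lact (a * b) x;
  ractP : forall (c : k) a b x, ract x (c *: a + b) = c *: ract x a + ract x b;
  ractD : forall (c : k) a x y, ract (c *: x + y) a = c *: ract x a + ract y a;
  ract1 : forall x, ract x 1 = x;
  ractA : forall a b x, ract (ract x a) b = ract x (a * b);
  lractA : forall a x b, ract (lact a x) b = lact a (ract x b)
}.

Section BimodTheory.
Context (k : fieldType) (A C : algType k) (X : bimod A C).
Implicit Types (x y : X) (c : k).

Lemma lactDr a x y : lact a (x + y) = lact a x + lact a y.
Proof. by have := lactD 1 a x y; rewrite !scale1r. Qed.
Lemma ractDl a x y : ract (x + y) a = ract x a + ract y a.
Proof. by have := ractD 1 a x y; rewrite !scale1r. Qed.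
Lemma lact0 a : lact a (0 : X) = 0.
Proof. by apply: (addIr (lact a 0)); rewrite -lactDr !add0r. Qed.
Lemma ract0 a : ract (0 : X) a = 0.
Proof. by apply: (addIr (ract 0 a)); rewrite -ractDl !add0r. Qed.
Lemma lactZr c a x : lact a (c *: x) = c *: lact a x.
Proof. by have := lactD c a x 0; rewrite !addr0 lact0 addr0. Qed.
Lemma ractZl c a x : ract (c *: x) a = c *: ract x a.
Proof. by have := ractD c a x 0; rewrite !addr0 ract0 addr0. Qed.
Lemma lactDl a b x : lact (a + b) x = lact a x + lact b x.
Proof. by have := lactP 1 a b x; rewrite !scale1r. Qed.
Lemma ractDr a b x : ract x (a + b) = ract x a + ract x b.
Proof. by have := ractP 1 a b x; rewrite !scale1r. Qed.
Lemma lact0l x : lact 0 x = 0.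
Proof. by apply: (addIr (lact 0 x)); rewrite -lactDl !add0r. Qed.
Lemma ract0r x : ract x 0 = 0.
Proof. by apply: (addIr (ract x 0)); rewrite -ractDr !add0r. Qed.
Lemma lactZl c a x : lact (c *: a) x = c *: lact a x.
Proof. by have := lactP c a 0 x; rewrite !addr0 lact0l addr0. Qed.
Lemma ractZr c a x : ract x (c *: a) = c *: ract x a.
Proof. by have := ractP c a 0 x; rewrite !addr0 ract0r addr0. Qed.
Lemma lact_sum a I (s : seq I) (f : I -> X) :
  lact a (\sum_(i <- s) f i) = \sum_(i <- s) lact a (f i).
Proof. by elim/big_rec2: _ => [|i u v _ <-]; rewrite ?lact0 ?lactDr. Qed.
Lemma ract_sum a I (s : seq I) (f : I -> X) :
  ract (\sum_(i <- s) f i) a = \sum_(i <- s) ract (f i) a.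
Proof. by elim/big_rec2: _ => [|i u v _ <-]; rewrite ?ract0 ?ractDl. Qed.
End BimodTheory.

Section Morphisms.
Context (k : fieldType) (A C : algType k).

Definition bimor (X Y : bimod A C) (f : X -> Y) : Prop :=
  [/\ forall (c : k) x y, f (c *: x + y) = c *: f x + f y,
      forall a x, f (lact a x) = lact a (f x) &
      forall x a, f (ract x a) = ract (f x) a].

Definition projective (X : bimod A C) : Prop :=
  forall (Y Z : bimod A C) (p : Y -> Z) (g : X -> Z),
    bimor p -> (forall z, exists y, p y = z) -> bimor g ->
    exists2 f : X -> Y, bimor f & forall x, p (f x) = g x.

Record subbimod (X : bimod A C) := Subbimod {
  sbset :> X -> Prop;
  sbset0 : sbset 0;
  sbsetP : forall (c : k) x y, sbset x -> sbset y -> sbset (c *: x + y);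
  sbsetl : forall a x, sbset x -> sbset (lact a x);
  sbsetr : forall x a, sbset x -> sbset (ract x a)
}.

Section SubCarrier.
Context (X : bimod A C) (R : subbimod X).

Definition sbpred : {pred X} := fun x => `[< R x >].
Lemma sbpred_closed : submod_closed sbpred.
Proof.
split=> [|c x y /asboolP hx /asboolP hy]; apply/asboolP; first exact: sbset0.
exact: sbsetP.
Qed.
HB.instance Definition _ := GRing.isSubmodClosed.Build k X sbpred sbpred_closed.

Record subcar := Subcar { subval : X; subvalP : subval \in sbpred }.
HB.instance Definition _ := [isSub for subval].
HB.instance Definition _ := [Choice of subcar by <:].
HB.instance Definition _ := [SubChoice_isSubLmodule of subcar by <:].

Lemma sub_lact_in a (x : subcar) : lact a (subval x) \in sbpred.
Proof. by apply/asboolP/sbsetl/asboolP/subvalP. Qed.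
Lemma sub_ract_in a (x : subcar) : ract (subval x) a \in sbpred.
Proof. by apply/asboolP/sbsetr/asboolP/subvalP. Qed.

Definition sub_bimod : bimod A C.
Proof.
refine (@Bimod k A C subcar
  (fun a x => Subcar (sub_lact_in a x)) (fun x a => Subcar (sub_ract_in a x))
  _ _ _ _ _ _ _ _ _) => *; apply: val_inj; rewrite /= ?linearP /=.
- exact: lactP.
- exact: lactD.
- exact: lact1.
- exact: lactA.
- exact: ractP.
- exact: ractD.
- exact: ract1.
- exact: ractA.
- exact: lractA.
Defined.

Definition sub_incl : sub_bimod -> X := subval.
End SubCarrier.
End Morphisms.

Section Restriction.
Context (k : fieldType).

Definition kunit (A : algType k) (c : k^o) : A := c *: 1.
Lemma kunit_linear (A : algType k) : linear (@kunit A).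
Proof. by move=> c x y; rewrite /kunit scalerDl scalerA. Qed.
HB.instance Definition _ (A : algType k) :=
  GRing.isLinear.Build k k^o A *:%R (@kunit A) (@kunit_linear A).
Lemma kunit_mul (A : algType k) : monoid_morphism (@kunit A).
Proof. by split=> [|x y]; rewrite /kunit ?scale1r // -scalerAl mul1r scalerA. Qed.
HB.instance Definition _ (A : algType k) :=
  GRing.isMonoidMorphism.Build k^o A (@kunit A) (@kunit_mul A).

Definition reg (A : algType k) : bimod A A.
Proof.
refine (@Bimod k A A A (fun a x => a * x) (fun x a => x * a)
  _ _ _ _ _ _ _ _ _) => *.
- by rewrite mulrDl scalerAl.
- by rewrite mulrDr scalerAr.
- by rewrite mul1r.
- by rewrite mulrA.
- by rewrite mulrDr scalerAr.
- by rewrite mulrDl scalerAl.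
- by rewrite mulr1.
- by rewrite mulrA.
- by rewrite mulrA.
Defined.

Definition res (A A' C C' : algType k) (f : {lrmorphism A' -> A})
    (g : {lrmorphism C' -> C}) (X : bimod A C) : bimod A' C'.
Proof.
refine (@Bimod k A' C' X (fun a x => lact (f a) x) (fun x a => ract x (g a))
  _ _ _ _ _ _ _ _ _) => *.
- by rewrite linearP lactP.
- exact: lactD.
- by rewrite rmorph1 lact1.
- by rewrite rmorphM lactA.
- by rewrite linearP ractP.
- exact: ractD.
- by rewrite rmorph1 ract1.
- by rewrite rmorphM ractA.
- exact: lractA.
Defined.

Definition as_left (A C : algType k) : bimod A C -> bimod A k^o :=
  res idfun (@kunit C).
Definition as_right (A C : algType k) : bimod A C -> bimod k^o C :=
  res (@kunit A) idfun.
End Restriction.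

(* Tensor product over a possibly noncommutative algebra S: formal finite     *)
(* sums of pairs, modulo the congruence generated by bilinearity and by       *)
(* (x s, y) ~ (x, s y).                                                       *)
Section Tensor.
Context (k : fieldType) (A S C : algType k) (X : bimod A S) (Y : bimod S C).
Implicit Types (x : X) (y : Y) (s : seq (X * Y)).

Inductive trel : seq (X * Y) -> seq (X * Y) -> Prop :=
| trel_refl s : trel s s
| trel_sym s t : trel s t -> trel t s
| trel_trans s t u : trel s t -> trel t u -> trel s u
| trel_cat s s' t t' : trel s s' -> trel t t' -> trel (s ++ t) (s' ++ t')
| trel_comm s t : trel (s ++ t) (t ++ s)
| trel_0 y : trel [:: (0, y)] [::]
| trel_Dl x x' y : trel [:: (x + x', y)] [:: (x, y); (x', y)]
| trel_Dr x y y' : trel [:: (x, y + y')] [:: (x, y); (x, y')]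
| trel_bal x a y : trel [:: (ract x a, y)] [:: (x, lact a y)].

Definition trelb s t : bool := `[< trel s t >].
Lemma trelb_equiv : equiv_class_of trelb.
Proof.
split=> [s|s t|s t u].
- exact/asboolP/trel_refl.
- by apply/asbool_equiv_eq; split; exact: trel_sym.
- by move=> /asboolP h1 /asboolP h2; exact/asboolP/(trel_trans h1 h2).
Qed.
Canonical trelb_equivrel := EquivRelPack trelb_equiv.

Definition tcar := {eq_quot trelb_equivrel}.
HB.instance Definition _ := Choice.on tcar.

Definition tcl (s : seq (X * Y)) : tcar := \pi_tcar%qT s.
Lemma tclP s t : (tcl s = tcl t) <-> trel s t.
Proof. by split=> [/eqmodP/asboolP|h] //; apply/eqmodP/asboolP. Qed.
Lemma tcl_repr (t : tcar) : tcl (repr t) = t.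
Proof. exact: reprK. Qed.
Lemma repr_tcl s : trel (repr (tcl s)) s.
Proof. by apply/tclP; rewrite tcl_repr. Qed.

Definition tmapl (g : X -> X) s := [seq (g p.1, p.2) | p <- s].
Lemma tmapl_rel (g : X -> X) : {morph g : x x' / x + x'} ->
  (forall x a, g (ract x a) = ract (g x) a) ->
  forall s t, trel s t -> trel (tmapl g s) (tmapl g t).
Proof.
move=> gD gr s t; elim=> {s t} /=.
- by move=> s; exact: trel_refl.
- by move=> s t _; exact: trel_sym.
- by move=> s t u _ h _; exact: trel_trans.
- by move=> s s' t t' _ h _ h'; rewrite /tmapl !map_cat; exact: trel_cat.
- by move=> s t; rewrite /tmapl !map_cat; exact: trel_comm.
- move=> y; have -> : g 0 = 0 by apply: (addIr (g 0)); rewrite -gD !add0r.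
  exact: trel_0.
- by move=> x x' y; rewrite gD; exact: trel_Dl.
- by move=> x y y'; exact: trel_Dr.
- by move=> x a y; rewrite gr; exact: trel_bal.
Qed.

Definition tadd (t u : tcar) : tcar := tcl (repr t ++ repr u).
Definition tscale (c : k) (t : tcar) : tcar := tcl (tmapl (fun x => c *: x) (repr t)).
Definition topp (t : tcar) : tcar := tscale (-1) t.

Lemma tadd_cl s t : tadd (tcl s) (tcl t) = tcl (s ++ t).
Proof. by apply/tclP/trel_cat; exact: repr_tcl. Qed.
Lemma tscale_cl c s : tscale c (tcl s) = tcl (tmapl (fun x => c *: x) s).
Proof.
apply/tclP/tmapl_rel/repr_tcl => [x x'|x a]; first by rewrite scalerDr.
by rewrite ractZl.
Qed.

Lemma taddA : associative tadd.
Proof.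
by move=> t u v; rewrite -[t]tcl_repr -[u]tcl_repr -[v]tcl_repr !tadd_cl catA.
Qed.
Lemma taddC : commutative tadd.
Proof. by move=> t u; apply/tclP/trel_comm. Qed.
Lemma tadd0 : left_id (tcl [::]) tadd.
Proof. by move=> t; rewrite -[t]tcl_repr tadd_cl. Qed.
Lemma tadd_cons x y s : tcl ((x, y) :: s) = tadd (tcl [:: (x, y)]) (tcl s).
Proof. by rewrite tadd_cl. Qed.
Lemma taddN : left_inverse (tcl [::]) topp tadd.
Proof.
move=> t; rewrite -[t]tcl_repr /topp tscale_cl; elim: (repr t) => [|[x y] s IH] /=.
  by rewrite tadd_cl.
rewrite tadd_cons (tadd_cons x) taddA [_ (tadd _ _) (tcl [:: (x, y)])]taddC.
rewrite [tadd (tcl [:: (x, y)]) _]taddA -taddA IH tadd_cl /=.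
rewrite taddC tadd0; apply/tclP/(trel_trans (trel_sym (trel_Dl _ _ _))).
by rewrite scaleN1r subrr; exact: trel_0.
Qed.
HB.instance Definition _ := GRing.isZmodule.Build tcar taddA taddC tadd0 taddN.

Lemma tclD s t : tcl (s ++ t) = tcl s + tcl t.
Proof. by rewrite -tadd_cl. Qed.

Lemma tscaleA a b (v : tcar) : tscale a (tscale b v) = tscale (a * b) v.
Proof.
rewrite -[v]tcl_repr !tscale_cl /tmapl -map_comp; congr tcl.
by apply: eq_map => p /=; rewrite scalerA.
Qed.
Lemma tscale1 : left_id 1 tscale.
Proof.
move=> v; rewrite -[v]tcl_repr !tscale_cl; congr tcl.
by rewrite -[RHS]map_id; apply: eq_map => -[x y] /=; rewrite scale1r.
Qed.
Lemma tscaleDr : right_distributive tscale +%R.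
Proof.
move=> c u v; rewrite -[u]tcl_repr -[v]tcl_repr -tclD !tscale_cl -tclD.
by rewrite /tmapl map_cat.
Qed.
Lemma tscaleDl v : {morph tscale^~ v : a b / a + b}.
Proof.
move=> a b; rewrite -[v]tcl_repr !tscale_cl; elim: (repr v) => [|[x y] s IH].
  by rewrite -tclD.
rewrite /= -cat1s tclD IH -[(a *: x, y) :: _]cat1s -[(b *: x, y) :: _]cat1s !tclD.
rewrite [RHS]addrACA; congr (_ + _).
by rewrite -tclD scalerDl; apply/tclP/trel_Dl.
Qed.
HB.instance Definition _ :=
  GRing.Zmodule_isLmodule.Build k tcar tscaleA tscale1 tscaleDr tscaleDl.

Definition tpure x y : tcar := tcl [:: (x, y)].

Lemma tclE s : tcl s = \sum_(p <- s) tpure p.1 p.2.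
Proof.
elim: s => [|[x y] s IH]; first by rewrite big_nil.
by rewrite big_cons -IH -tclD.
Qed.

Definition balanced (Z : zmodType) (f : X -> Y -> Z) : Prop :=
  [/\ forall x x' y, f (x + x') y = f x y + f x' y,
      forall x y y', f x (y + y') = f x y + f x y' &
      forall x a y, f (ract x a) y = f x (lact a y)].

(* The map induced by f; only meaningful when f is balanced, see tliftE.      *)
Definition tlift (Z : zmodType) (f : X -> Y -> Z) (t : tcar) : Z :=
  \sum_(p <- repr t) f p.1 p.2.

Lemma tlift_cl (Z : zmodType) (f : X -> Y -> Z) s : balanced f ->
  tlift f (tcl s) = \sum_(p <- s) f p.1 p.2.
Proof.
move=> [fDl fDr fb].
have H s1 s2 : trel s1 s2 ->
    \sum_(p <- s1) f p.1 p.2 = \sum_(p <- s2) f p.1 p.2.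
  elim=> {s1 s2}.
  - by [].
  - by move=> s1 s2 _ ->.
  - by move=> s1 s2 s3 _ -> _ ->.
  - by move=> s1 s2 s3 s4 _ h _ h'; rewrite !big_cat /= h h'.
  - by move=> s1 s2; rewrite !big_cat /= addrC.
  - move=> y; rewrite big_nil big_seq1 /=.
    by apply: (addIr (f 0 y)); rewrite -fDl !add0r.
  - by move=> x x' y; rewrite !big_cons !big_nil !addr0 /= fDl.
  - by move=> x y y'; rewrite !big_cons !big_nil !addr0 /= fDr.
  - by move=> x a y; rewrite !big_seq1 /= fb.
exact/H/repr_tcl.
Qed.

Lemma tliftE (Z : zmodType) (f : X -> Y -> Z) x y : balanced f ->
  tlift f (tpure x y) = f x y.
Proof. by move=> fb; rewrite tlift_cl // big_seq1. Qed.

Lemma tliftD (Z : zmodType) (f : X -> Y -> Z) u v : balanced f ->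
  tlift f (u + v) = tlift f u + tlift f v.
Proof.
move=> fb; rewrite -[u]tcl_repr -[v]tcl_repr -tclD !tlift_cl //.
by rewrite big_cat.
Qed.

Lemma tlift0 (Z : zmodType) (f : X -> Y -> Z) : balanced f -> tlift f 0 = 0.
Proof. by move=> fb; rewrite [LHS](tlift_cl [::]) // big_nil. Qed.

Lemma tpureDl x x' y : tpure (x + x') y = tpure x y + tpure x' y.
Proof. by rewrite /tpure -tclD; apply/tclP/trel_Dl. Qed.
Lemma tpureDr x y y' : tpure x (y + y') = tpure x y + tpure x y'.
Proof. by rewrite /tpure -tclD; apply/tclP/trel_Dr. Qed.
Lemma tpureA x a y : tpure (ract x a) y = tpure x (lact a y).
Proof. exact/tclP/trel_bal. Qed.
Lemma tpure_balanced : balanced tpure.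
Proof. by split; [exact: tpureDl|exact: tpureDr|exact: tpureA]. Qed.
Lemma tpureZl c x y : tpure (c *: x) y = c *: tpure x y.
Proof. by rewrite [RHS]tscale_cl. Qed.
Lemma tpureZr c x y : tpure x (c *: y) = c *: tpure x y.
Proof.
by rewrite -tpureZl -[in RHS](ract1 x) -ractZr tpureA lactZl lact1.
Qed.
Lemma tpure0l y : tpure 0 y = 0.
Proof. exact/tclP/trel_0. Qed.
Lemma tpure0r x : tpure x 0 = 0.
Proof. by rewrite -(scale0r (0 : Y)) tpureZr scale0r. Qed.
Lemma tpure_suml I (s : seq I) (f : I -> X) y :
  tpure (\sum_(i <- s) f i) y = \sum_(i <- s) tpure (f i) y.
Proof. by elim/big_rec2: _ => [|i u v _ <-]; rewrite ?tpure0l ?tpureDl. Qed.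
Lemma tpure_sumr I (s : seq I) (f : I -> Y) x :
  tpure x (\sum_(i <- s) f i) = \sum_(i <- s) tpure x (f i).
Proof. by elim/big_rec2: _ => [|i u v _ <-]; rewrite ?tpure0r ?tpureDr. Qed.

Lemma tens_ind (P : tcar -> Prop) : P 0 -> (forall x y, P (tpure x y)) ->
  (forall u v, P u -> P v -> P (u + v)) -> forall t, P t.
Proof.
move=> P0 Pp PD t; rewrite -[t]tcl_repr tclE.
by elim: (repr t) => [|p s IH]; rewrite ?big_nil ?big_cons //; apply: PD.
Qed.

Lemma tlift_lin (Z : lmodType k) (f : X -> Y -> Z) : balanced f ->
  (forall c x y, f (c *: x) y = c *: f x y) ->
  forall c u v, tlift f (c *: u + v) = c *: tlift f u + tlift f v.
Proof.
move=> fb fZ c u v; rewrite tliftD //; congr (_ + _).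
elim/tens_ind: u => [|x y|u u' IH IH'].
- by rewrite scaler0 tlift0 // scaler0.
- by rewrite -tpureZl !tliftE.
- by rewrite scalerDr !tliftD // IH IH' scalerDr.
Qed.

Definition tlact (a : A) : tcar -> tcar := tlift (fun x y => tpure (lact a x) y).
Definition tract (t : tcar) (a : C) : tcar := tlift (fun x y => tpure x (ract y a)) t.

Lemma tlact_bal a : balanced (fun x y => tpure (lact a x) y).
Proof.
split=> *; first by rewrite lactDr tpureDl.
  by rewrite tpureDr.
by rewrite -lractA tpureA.
Qed.
Lemma tract_bal a : balanced (fun x y => tpure x (ract y a)).
Proof.
split=> *; first by rewrite tpureDl.
  by rewrite ractDl tpureDr.
by rewrite lractA tpureA.
Qed.

Lemma tlact_pure a x y : tlact a (tpure x y) = tpure (lact a x) y.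
Proof. exact/tliftE/tlact_bal. Qed.
Lemma tract_pure a x y : tract (tpure x y) a = tpure x (ract y a).
Proof. exact/tliftE/tract_bal. Qed.
Lemma tlactD a u v : tlact a (u + v) = tlact a u + tlact a v.
Proof. exact/tliftD/tlact_bal. Qed.
Lemma tractD a u v : tract (u + v) a = tract u a + tract v a.
Proof. exact/tliftD/tract_bal. Qed.
Lemma tlact0 a : tlact a 0 = 0. Proof. exact/tlift0/tlact_bal. Qed.
Lemma tract0 a : tract 0 a = 0. Proof. exact/tlift0/tract_bal. Qed.

Definition tens : bimod A C.
Proof.
refine (@Bimod k A C tcar tlact tract _ _ _ _ _ _ _ _ _).
- move=> c a b x; elim/tens_ind: x => [|x y|u v IH IH'].
  + by rewrite !tlact0 scaler0 addr0.
  + by rewrite !tlact_pure lactP tpureDl tpureZl.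
  + by rewrite !tlactD IH IH' scalerDr addrACA.
- move=> c a u v; apply: tlift_lin; first exact: tlact_bal.
  by move=> *; rewrite lactZr tpureZl.
- elim/tens_ind => [|x y|u v IH IH'].
  + by rewrite tlact0.
  + by rewrite tlact_pure lact1.
  + by rewrite tlactD IH IH'.
- move=> a b; elim/tens_ind => [|x y|u v IH IH'].
  + by rewrite !tlact0.
  + by rewrite !tlact_pure lactA.
  + by rewrite !tlactD IH IH'.
- move=> c a b x; elim/tens_ind: x => [|x y|u v IH IH'].
  + by rewrite !tract0 scaler0 addr0.
  + by rewrite !tract_pure ractP tpureDr tpureZr.
  + by rewrite !tractD IH IH' scalerDr addrACA.
- move=> c a u v; apply: tlift_lin; first exact: tract_bal.
  by move=> *; rewrite tpureZl.
- elim/tens_ind => [|x y|u v IH IH'].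
  + by rewrite tract0.
  + by rewrite tract_pure ract1.
  + by rewrite tractD IH IH'.
- move=> a b; elim/tens_ind => [|x y|u v IH IH'].
  + by rewrite !tract0.
  + by rewrite !tract_pure ractA.
  + by rewrite !tractD IH IH'.
- move=> a x b; elim/tens_ind: x => [|x y|u v IH IH'].
  + by rewrite !(tract0, tlact0).
  + by rewrite !(tract_pure, tlact_pure).
  + by rewrite !(tractD, tlactD) IH IH'.
Defined.

Lemma lact_pure a x y : lact a (tpure x y : tens) = tpure (lact a x) y.
Proof. exact: tlact_pure. Qed.
Lemma ract_pure a x y : ract (tpure x y : tens) a = tpure x (ract y a).
Proof. exact: tract_pure. Qed.
End Tensor.
Arguments lact : simpl never.
Arguments ract : simpl never.

Section TensorBase.
Context (k : fieldType).

Lemma lact_base (C : algType k) (X : bimod k^o C) (c : k) (x : X) :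
  lact (c : k^o) x = c *: x.
Proof.
have e : (c : k^o) = c *: (1 : k^o) by exact/esym/(mulr1 (c : k)).
by rewrite [in LHS]e lactZl lact1.
Qed.
Lemma ract_base (A : algType k) (X : bimod A k^o) (c : k) (x : X) :
  ract x (c : k^o) = c *: x.
Proof.
have e : (c : k^o) = c *: (1 : k^o) by exact/esym/(mulr1 (c : k)).
by rewrite [in LHS]e ractZr ract1.
Qed.

Lemma bilin_balanced (A C : algType k) (X : bimod A k^o) (Y : bimod k^o C)
    (Z : lmodType k) (f : X -> Y -> Z) :
  (forall c x x' y, f (c *: x + x') y = c *: f x y + f x' y) ->
  (forall c x y y', f x (c *: y + y') = c *: f x y + f x y') -> balanced f.
Proof.
move=> fl fr.
have fDl x x' y : f (x + x') y = f x y + f x' y by rewrite -[x]scale1r fl !scale1r.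
have fDr x y y' : f x (y + y') = f x y + f x y' by rewrite -[y]scale1r fr !scale1r.
split=> // x a y; rewrite lact_base ract_base -[a *: x]addr0 fl -[a *: y]addr0 fr.
have -> : f 0 y = 0 by apply: (addIr (f 0 y)); rewrite -fDl !add0r.
by have -> : f x 0 = 0 by apply: (addIr (f x 0)); rewrite -fDr !add0r.
Qed.

Section Lin.
Context (U V : lmodType k) (f : U -> V).
Context (flin : forall (c : k) x y, f (c *: x + y) = c *: f x + f y).
Lemma linD x y : f (x + y) = f x + f y.
Proof. by rewrite -[x]scale1r flin !scale1r. Qed.
Lemma lin0 : f 0 = 0.
Proof. by apply: (addIr (f 0)); rewrite -linD !add0r. Qed.
Lemma linZ c x : f (c *: x) = c *: f x.
Proof. by rewrite -[c *: x]addr0 flin lin0 addr0. Qed.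
Lemma linN x : f (- x) = - f x.
Proof. by rewrite -scaleN1r linZ scaleN1r. Qed.
Lemma lin_sum I (s : seq I) (F : I -> U) :
  f (\sum_(i <- s) F i) = \sum_(i <- s) f (F i).
Proof. by elim/big_rec2: _ => [|i u v _ <-]; rewrite ?lin0 ?linD. Qed.
End Lin.
End TensorBase.

(* Z-gradings, as families of subspaces whose direct sum is the whole space.  *)
Record grading (k : fieldType) (V : lmodType k) := Grading {
  deg :> int -> V -> Prop;
  deg0 : forall i, deg i 0;
  degP : forall i (c : k) x y, deg i x -> deg i y -> deg i (c *: x + y);
  deg_span : forall v, exists s : seq V,
    (forall x, x \in s -> exists i, deg i x) /\ v = \sum_(x <- s) x;
  deg_free : forall (s : seq int) (f : int -> V), uniq s ->
    (forall i, deg i (f i)) -> \sum_(i <- s) f i = 0 ->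
    forall i, i \in s -> f i = 0
}.

Section GradingTheory.
Context (k : fieldType) (V : lmodType k) (g : grading V).

Lemma degD i x y : g i x -> g i y -> g i (x + y).
Proof. by move=> hx hy; rewrite -[x]scale1r; exact: degP. Qed.
Lemma degZ i (c : k) x : g i x -> g i (c *: x).
Proof. by move=> hx; rewrite -[_ *: _]addr0; apply: degP => //; exact: deg0. Qed.
Lemma degN i x : g i x -> g i (- x).
Proof. by move=> hx; rewrite -scaleN1r; exact: degZ. Qed.
Lemma degB i x y : g i x -> g i y -> g i (x - y).
Proof. by move=> hx hy; apply: degD => //; exact: degN. Qed.

Lemma decompP v : exists fs : (int -> V) * seq int,
  [/\ uniq fs.2, forall i, g i (fs.1 i), forall i, i \notin fs.2 -> fs.1 i = 0 &
      v = \sum_(i <- fs.2) fs.1 i].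
Proof.
have [s [hs ->]] := deg_span g v.
elim: s hs => [|x s IH] hs.
  by exists (fun=> 0, [::]); split => //= [i|]; rewrite ?big_nil //; exact: deg0.
have [|[f r] /= [ur hf f0 se]] := IH; first by move=> y ys; apply: hs; rewrite inE ys orbT.
have [i hi] := hs x (mem_head _ _).
exists (fun j => if j == i then x + f j else f j, i :: rem i r); split=> /=.
- by rewrite mem_rem_uniq // inE eqxx /= rem_uniq.
- by move=> j; case: eqP => [->|_] //; apply: degD.
- move=> j; rewrite inE negb_or => /andP[/negPf ji]; rewrite ji => h.
  by apply: f0; apply: contra h => jr; rewrite mem_rem_uniq // inE ji.
- rewrite big_cons se big_cons eqxx -addrA.
  congr (_ + _); have [ir|ir] := boolP (i \in r).
    rewrite (perm_big _ (perm_to_rem ir)) big_cons; congr (_ + _).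
    rewrite big_seq [RHS]big_seq; apply: eq_bigr => j.
    by rewrite mem_rem_uniq // inE => /andP[/negPf ->].
  rewrite f0 // add0r rem_id //; rewrite big_seq [RHS]big_seq.
  by apply: eq_bigr => j jr; case: eqP => // ji; rewrite -ji jr in ir.
Qed.

Definition decomp v := sval (cid (decompP v)).
Definition hcomp (i : int) (v : V) : V := (decomp v).1 i.
Definition hsupp v := (decomp v).2.

Lemma hcomp_deg i v : g i (hcomp i v).
Proof. by rewrite /hcomp /decomp; case: cid => fs []. Qed.
Lemma hsupp_uniq v : uniq (hsupp v).
Proof. by rewrite /hsupp /decomp; case: cid => fs []. Qed.
Lemma hcomp_out v i : i \notin hsupp v -> hcomp i v = 0.
Proof. by rewrite /hcomp /hsupp /decomp; case: cid => fs /= [_ _ + _]; apply. Qed.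
Lemma hcomp_sum v : v = \sum_(i <- hsupp v) hcomp i v.
Proof. by rewrite /hcomp /hsupp /decomp; case: cid => fs []. Qed.

Lemma sum_widen (s r : seq int) (f : int -> V) : uniq s -> uniq r ->
  {subset s <= r} -> (forall i, i \notin s -> f i = 0) ->
  \sum_(i <- s) f i = \sum_(i <- r) f i.
Proof.
move=> us ur sr f0; rewrite [RHS](bigID (mem s)) /= [X in _ = _ + X]big1 ?addr0.
  rewrite -[RHS]big_filter; apply: perm_big; apply: uniq_perm => //.
    exact: filter_uniq.
  by move=> i; rewrite mem_filter; case: (boolP (i \in s)) => // /sr ->.
exact: f0.
Qed.

Lemma hcomp_sum_in v r : uniq r -> {subset hsupp v <= r} ->
  v = \sum_(i <- r) hcomp i v.
Proof.
move=> ur sr; rewrite {1}(hcomp_sum v); apply: sum_widen => //.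
  exact: hsupp_uniq.
by move=> i; exact: hcomp_out.
Qed.

Lemma hcomp_unique v r (f : int -> V) : uniq r -> (forall i, g i (f i)) ->
  (forall i, i \notin r -> f i = 0) -> v = \sum_(i <- r) f i ->
  forall i, hcomp i v = f i.
Proof.
move=> ur hf f0 ve i; pose q := undup (hsupp v ++ r).
have uq : uniq q by exact: undup_uniq.
have H : \sum_(j <- q) (hcomp j v - f j) = 0.
  rewrite sumrB -(@sum_widen r q f) //; last by move=> j jr; rewrite mem_undup mem_cat jr orbT.
  rewrite -hcomp_sum_in // -?ve ?subrr // => j jr.
  by rewrite mem_undup mem_cat jr.
have [iq|] := boolP (i \in q).
  apply/eqP; rewrite -subr_eq0; apply/eqP.
  apply: (deg_free (s := q) (f := fun j => hcomp j v - f j) uq) => // j.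
  by apply: degB => //; exact: hcomp_deg.
by rewrite mem_undup mem_cat negb_or => /andP[/hcomp_out -> /f0 ->].
Qed.

Lemma hcomp_lin i (c : k) x y : hcomp i (c *: x + y) = c *: hcomp i x + hcomp i y.
Proof.
pose q := undup (hsupp x ++ hsupp y).
apply: (@hcomp_unique _ q (fun i => c *: hcomp i x + hcomp i y)).
- exact: undup_uniq.
- by move=> j; apply: degP; exact: hcomp_deg.
- move=> j; rewrite mem_undup mem_cat negb_or => /andP[/hcomp_out -> /hcomp_out ->].
  by rewrite scaler0 addr0.
- rewrite big_split /= -scaler_sumr -!hcomp_sum_in ?undup_uniq //.
    by move=> j jr; rewrite mem_undup mem_cat jr orbT.
  by move=> j jr; rewrite mem_undup mem_cat jr.
Qed.

Lemma hcompD i x y : hcomp i (x + y) = hcomp i x + hcomp i y.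
Proof. by have := hcomp_lin i 1 x y; rewrite !scale1r. Qed.

Lemma hcomp_homog i j x : g j x -> hcomp i x = if i == j then x else 0.
Proof.
move=> hx.
apply: (@hcomp_unique _ [:: j] (fun i => if i == j then x else 0)) => //.
- by move=> l; case: eqP => [->|_] //; exact: deg0.
- by move=> l; rewrite inE => /negPf ->.
- by rewrite big_seq1 eqxx.
Qed.

Lemma hcomp_nat (f : V -> V) : {morph f : x y / x + y} ->
  (forall i x, g i x -> g i (f x)) -> forall i v, hcomp i (f v) = f (hcomp i v).
Proof.
move=> fD fg i v.
have f0 : f 0 = 0 by apply: (addIr (f 0)); rewrite -fD !add0r.
apply: (@hcomp_unique _ (hsupp v) (fun i => f (hcomp i v))).
- exact: hsupp_uniq.
- by move=> j; apply/fg/hcomp_deg.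
- by move=> j /hcomp_out ->.
- rewrite {1}(hcomp_sum v).
  by elim/big_rec2: _ => [|j u w _ <-]; rewrite ?f0 ?fD.
Qed.
End GradingTheory.

(* V placed in degree d.                                                      *)
Definition conc (k : fieldType) (d : int) (V : lmodType k) : grading V.
Proof.
refine (@Grading k V (fun i x => i = d \/ x = 0) _ _ _ _).
- by right.
- by move=> i c x y [->|->] [|->]; auto; right; rewrite scaler0 addr0.
- move=> v; exists [:: v]; rewrite big_seq1; split=> // x _.
  by exists d; left.
- move=> s f us hf; have [ds|ds] := boolP (d \in s); last first.
    by move=> _ i is_; case: (hf i) => // id; rewrite id (negPf ds) in is_.
  rewrite (bigD1_seq d) //= big1 ?addr0 => [fd i _|i id].
    by case: (hf i) => // ->.
  by case: (hf i) => // /eqP; rewrite (negPf id).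
Defined.

(* A positively graded algebra together with an identification of its degree  *)
(* 0 part with S; gaug is the projection onto that part.                      *)
Record gralg (k : fieldType) (S : algType k) := Gralg {
  galg :> algType k;
  ggr : grading galg;
  ggr_pos : forall i x, i < 0 -> ggr i x -> x = 0;
  ggrM : forall i j x y, ggr i x -> ggr j y -> ggr (i + j) (x * y);
  gincl : {lrmorphism S -> galg};
  gaug : {lrmorphism galg -> S};
  gaugK : forall s, gaug (gincl s) = s;
  gincl_im : forall x, ggr 0 x <-> exists s, x = gincl s;
  gaug_pos : forall i x, 0 < i -> ggr i x -> gaug x = 0
}.

Definition triv (k : fieldType) (S : algType k) : gralg S.
Proof.
refine (@Gralg k S S (conc 0 S) _ _ idfun idfun _ _ _) => //=.
- by move=> i x i0 [ie|//]; rewrite ie in i0.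
- move=> i j x y [->|->]; last by right; rewrite mul0r.
  by move=> [->|->]; [left|right; rewrite mulr0].
- by move=> x; split=> [_|_]; [exists x|left].
- by move=> i x i0 [ie|//]; rewrite ie in i0.
Defined.

Section GradedBimodules.
Context (k : fieldType).

Record gbimod (S S' : algType k) (A : gralg S) (C : gralg S') := Gbimod {
  gb :> bimod A C;
  gdeg : grading gb;
  gdegl : forall i j a x, ggr A i a -> gdeg j x -> gdeg (i + j) (lact a x);
  gdegr : forall i j x a, gdeg i x -> ggr C j a -> gdeg (i + j) (ract x a)
}.

Section Notions.
Context (S S' : algType k) (A : gralg S) (C : gralg S').

Definition gmor (X Y : gbimod A C) (f : X -> Y) : Prop :=
  bimor f /\ forall i x, gdeg X i x -> gdeg Y i (f x).

Definition gprojective (X : gbimod A C) : Prop :=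
  forall (Y Z : gbimod A C) (p : Y -> Z) (g : X -> Z),
    gmor p -> (forall z, exists y, p y = z) -> gmor g ->
    exists2 f : X -> Y, gmor f & forall x, p (f x) = g x.

Record gresolution (X : gbimod A C) (P : nat -> gbimod A C)
    (d : forall n, P n.+1 -> P n) (e : P 0%N -> X) : Prop := {
  res_proj : forall n, gprojective (P n);
  res_mord : forall n, gmor (@d n);
  res_more : gmor e;
  res_surj : forall x, exists u, e u = x;
  res_exact0 : forall u : P 0%N, e u = 0 <-> exists v, d 0%N v = u;
  res_exact : forall n (u : P n.+1), d n u = 0 <-> exists v, d n.+1 v = u
}.

(* Projective dimension is computed with graded projective resolutions.       *)
Definition gpd_le (X : gbimod A C) (n : nat) : Prop :=
  exists (P : nat -> gbimod A C) (d : forall n, P n.+1 -> P n) (e : P 0%N -> X),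
    gresolution d e /\ forall m, (n < m)%N -> forall u : P m, u = 0.
Definition gpd_eq (X : gbimod A C) (n : nat) : Prop :=
  gpd_le X n /\ forall m, gpd_le X m -> (n <= m)%N.

Definition generated_in (X : gbimod A C) (n : int) : Prop :=
  forall Q : subbimod X, (forall x, gdeg X n x -> Q x) -> forall x, Q x.
End Notions.

Definition gmorA (S S' : algType k) (A : gralg S) (A' : gralg S') (f : A' -> A) :=
  forall i a, ggr A' i a -> ggr A i (f a).

Definition gres (S1 S2 S3 S4 : algType k) (A : gralg S1) (A' : gralg S2)
  (C : gralg S3) (C' : gralg S4) (f : {lrmorphism A' -> A}) (hf : gmorA f)
  (g : {lrmorphism C' -> C}) (hg : gmorA g) (X : gbimod A C) : gbimod A' C'.
Proof.
refine (@Gbimod S2 S4 A' C' (res f g X) (gdeg X) _ _) => *.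
  by apply: gdegl => //; exact: hf.
by apply: gdegr => //; exact: hg.
Defined.

Lemma gmorA_id (S : algType k) (A : gralg S) : gmorA (A := A) (idfun : A -> A).
Proof. by []. Qed.
Lemma gmorA_incl (S : algType k) (A : gralg S) : gmorA (A' := triv S) (gincl A).
Proof.
move=> i a [->|->]; last by rewrite linear0; exact: deg0.
by apply/gincl_im; exists a.
Qed.
Lemma gmorA_kunit (S : algType k) (A : gralg S) :
  gmorA (A' := triv k^o) (@kunit k A).
Proof.
move=> i a [->|->]; last by rewrite linear0; exact: deg0.
by apply/gincl_im; exists (kunit S a); rewrite linearZ rmorph1.
Qed.
Lemma gmorA_aug (S : algType k) (A : gralg S) : gmorA (A := triv S) (gaug A).
Proof.
move=> i a ha; have [i0|i0|i0] := ltgtP i 0.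
- by right; rewrite (ggr_pos i0 ha) linear0.
- by right; exact: gaug_pos i0 ha.
- by left.
Qed.

Definition greg (S : algType k) (A : gralg S) : gbimod A A :=
  @Gbimod S S A A (reg A) (ggr A) (@ggrM k S A) (@ggrM k S A).

Definition gconc (S S' : algType k) (d : int) (X : bimod S S') :
  gbimod (triv S) (triv S').
Proof.
refine (@Gbimod S S' (triv S) (triv S') X (conc d X) _ _).
- move=> i j a x [->|->]; last by right; rewrite lact0l.
  by rewrite add0r => -[->|->]; [left|right; rewrite lact0].
- move=> i j x a [->|->]; last by right; rewrite ract0.
  by move=> [->|->]; [left; rewrite addr0|right; rewrite ract0r].
Defined.

Section GTens.
Context (S S1 S2 : algType k) (A : gralg S1) (C : gralg S2).
Context (X : gbimod A (triv S)) (Y : gbimod (triv S) C).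
Local Notation T := (tens X Y).

Definition tdeg (n : int) (t : T) : Prop := exists s : seq (X * Y),
  (forall p, p \in s -> exists i j, [/\ i + j = n, gdeg X i p.1 & gdeg Y j p.2]) /\
  t = \sum_(p <- s) tpure p.1 p.2.

Lemma tdeg_ind n (P : T -> Prop) : P 0 ->
  (forall i j x y, i + j = n -> gdeg X i x -> gdeg Y j y -> P (tpure x y)) ->
  (forall u v, P u -> P v -> P (u + v)) -> forall t, tdeg n t -> P t.
Proof.
move=> P0 Pp PD t [s [hs ->]]; elim: s hs => [|p s IH] hs.
  by rewrite big_nil.
rewrite big_cons; apply: PD; last by apply: IH => q qs; apply: hs; rewrite inE qs orbT.
by have [i [j [ij hx hy]]] := hs p (mem_head _ _); exact: Pp hx hy.
Qed.

Lemma tdeg0 n : tdeg n 0.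
Proof. by exists [::]; rewrite big_nil. Qed.
Lemma tdegD n u v : tdeg n u -> tdeg n v -> tdeg n (u + v).
Proof.
move=> [s [hs ->]] [s' [hs' ->]]; exists (s ++ s'); rewrite big_cat; split=> // p.
by rewrite mem_cat => /orP[/hs|/hs'].
Qed.
Lemma tdeg_pure i j x y : gdeg X i x -> gdeg Y j y -> tdeg (i + j) (tpure x y).
Proof.
move=> hx hy; exists [:: (x, y)]; rewrite big_seq1; split=> // p.
by rewrite inE => /eqP ->; exists i, j.
Qed.

Lemma tdegP n (c : k) u v : tdeg n u -> tdeg n v -> tdeg n (c *: u + v).
Proof.
move=> hu hv; apply: tdegD => //; elim/tdeg_ind: hu => {u}.
- by rewrite scaler0; exact: tdeg0.
- by move=> i j x y <- hx hy; rewrite -tpureZl; apply: tdeg_pure => //; exact: degZ.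
- by move=> u w hu hw; rewrite scalerDr; exact: tdegD.
Qed.

Lemma tdeg_span t : exists s : seq T,
  (forall x, x \in s -> exists i, tdeg i x) /\ t = \sum_(x <- s) x.
Proof.
elim/tens_ind: t => [|x y|u v [s [hs ->]] [s' [hs' ->]]].
- by exists [::]; rewrite big_nil.
- exists [seq tpure (hcomp (gdeg X) i x) (hcomp (gdeg Y) j y) |
          i <- hsupp (gdeg X) x, j <- hsupp (gdeg Y) y]; split.
    move=> z /allpairsP[[i j] [_ _ ->]]; exists (i + j).
    by apply: tdeg_pure; exact: hcomp_deg.
  rewrite big_allpairs_dep /= {1}(hcomp_sum (gdeg X) x) tpure_suml.
  by apply: eq_bigr => i _; rewrite {1}(hcomp_sum (gdeg Y) y) tpure_sumr.
- exists (s ++ s'); rewrite big_cat; split=> // x.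
  by rewrite mem_cat => /orP[/hs|/hs'].
Qed.

Let pX := hcomp (gdeg X).
Let pY := hcomp (gdeg Y).
Definition tproj (i j : int) : T -> T := tlift (fun x y => tpure (pX i x) (pY j y)).

Lemma tproj_bal i j : balanced (fun x y => tpure (pX i x) (pY j y) : T).
Proof.
split=> [x x' y|x y y'|x a y].
- by rewrite /pX hcompD tpureDl.
- by rewrite /pY hcompD tpureDr.
- rewrite /pX /pY (@hcomp_nat _ _ _ (fun x => ract x a)); last first.
  + by move=> l z hz; rewrite -[l]addr0; apply: gdegr => //; left.
  + by move=> ? ?; rewrite ractDl.
  rewrite (@hcomp_nat _ _ _ (fun y => lact a y)); last first.
  + by move=> l z hz; rewrite -[l]add0r; apply: gdegl => //; left.
  + by move=> ? ?; rewrite lactDr.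
  exact: tpureA.
Qed.
Lemma tprojD i j u v : tproj i j (u + v) = tproj i j u + tproj i j v.
Proof. exact/tliftD/tproj_bal. Qed.
Lemma tproj0 i j : tproj i j 0 = 0.
Proof. exact/tlift0/tproj_bal. Qed.
Lemma tprojE i j x y : tproj i j (tpure x y) = tpure (pX i x) (pY j y).
Proof. exact/tliftE/tproj_bal. Qed.

Lemma tproj_off i j n t : i + j != n -> tdeg n t -> tproj i j t = 0.
Proof.
move=> ij; elim/tdeg_ind => [|i' j' x y ij' hx hy|u v hu hv].
- exact: tproj0.
- rewrite tprojE /pX /pY (hcomp_homog _ hx) (hcomp_homog _ hy).
  case: eqP => [ii|_]; last by rewrite tpure0l.
  case: eqP => [jj|_]; last by rewrite tpure0r.
  by rewrite ii jj ij' eqxx in ij.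
- by rewrite tprojD hu hv addr0.
Qed.

Lemma tproj_sum t : exists I J : seq int, forall I' J', uniq I' -> uniq J' ->
  {subset I <= I'} -> {subset J <= J'} ->
  t = \sum_(i <- I') \sum_(j <- J') tproj i j t.
Proof.
elim/tens_ind: t => [|x y|u v [I [J h]] [I2 [J2 h2]]].
- exists [::], [::] => *; rewrite big1 // => i _; rewrite big1 // => j _.
  exact: tproj0.
- exists (hsupp (gdeg X) x), (hsupp (gdeg Y) y) => I' J' uI uJ sI sJ.
  rewrite {1}(hcomp_sum_in uI sI) tpure_suml; apply: eq_bigr => i _.
  rewrite {1}(hcomp_sum_in uJ sJ) tpure_sumr; apply: eq_bigr => j _.
  by rewrite tprojE.
- exists (I ++ I2), (J ++ J2) => I' J' uI uJ sI sJ.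
  rewrite {1}(h I' J') //; first last.
  + by move=> j jJ; apply: sJ; rewrite mem_cat jJ.
  + by move=> j jJ; apply: sI; rewrite mem_cat jJ.
  rewrite {1}(h2 I' J') //; first last.
  + by move=> j jJ; apply: sJ; rewrite mem_cat jJ orbT.
  + by move=> j jJ; apply: sI; rewrite mem_cat jJ orbT.
  rewrite -big_split; apply: eq_bigr => i _; rewrite -big_split.
  by apply: eq_bigr => j _; rewrite tprojD.
Qed.

Lemma tdeg_free (s : seq int) (f : int -> T) : uniq s ->
  (forall i, tdeg i (f i)) -> \sum_(i <- s) f i = 0 ->
  forall i, i \in s -> f i = 0.
Proof.
move=> us hf sf n ns.
have Q i j : tproj i j (f n) = 0.
  have [ijn|] := eqVneq (i + j) n; last by move=> ne; exact: tproj_off (hf n).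
  have : tproj i j (\sum_(m <- s) f m) = 0 by rewrite sf tproj0.
  rewrite (bigD1_seq n) //= tprojD => <-; rewrite -[LHS]addr0; congr (_ + _).
  apply/esym; elim/big_ind: _ => [|u v hu hv|m mn].
  - exact: tproj0.
  - by rewrite tprojD hu hv addr0.
  - by apply: tproj_off (hf m); rewrite ijn eq_sym.
have [I [J h]] := tproj_sum (f n).
rewrite (h (undup I) (undup J)) ?undup_uniq // => [|i|j]; rewrite ?mem_undup //.
by rewrite big1 // => i _; rewrite big1.
Qed.

Definition tens_grading : grading T := @Grading k T tdeg tdeg0 tdegP tdeg_span tdeg_free.

Definition gtens : gbimod A C.
Proof.
refine (@Gbimod S1 S2 A C T tens_grading _ _).
- move=> i n a t ha; elim/tdeg_ind => [|j l x y <- hx hy|u v hu hv].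
  + by rewrite lact0; exact: tdeg0.
  + rewrite lact_pure addrA; apply: tdeg_pure => //; exact: gdegl.
  + by rewrite lactDr; exact: tdegD.
- move=> n i t a ht ha; move: ht; elim/tdeg_ind => [|j l x y <- hx hy|u v hu hv].
  + by rewrite ract0; exact: tdeg0.
  + rewrite ract_pure -addrA; apply: tdeg_pure => //; exact: gdegr.
  + by rewrite ractDl; exact: tdegD.
Defined.
End GTens.

Section GSum.
Context (S S' : algType k) (A : gralg S) (C : gralg S') (X Y : gbimod A C).

Definition bisum : bimod A C.
Proof.
refine (@Bimod k A C (X * Y)%type (fun a u => (lact a u.1, lact a u.2))
  (fun u a => (ract u.1 a, ract u.2 a)) _ _ _ _ _ _ _ _ _).
- by move=> *; rewrite !lactP.
- by move=> *; rewrite !lactD.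
- by move=> [x y]; rewrite !lact1.
- by move=> *; rewrite !lactA.
- by move=> *; rewrite !ractP.
- by move=> *; rewrite !ractD.
- by move=> [x y]; rewrite !ract1.
- by move=> *; rewrite !ractA.
- by move=> *; rewrite !lractA.
Defined.

Definition sum_grading : grading bisum.
Proof.
refine (@Grading k bisum (fun i u => gdeg X i u.1 /\ gdeg Y i u.2) _ _ _ _).
- by move=> i; split; exact: deg0.
- by move=> i c x y [? ?] [? ?]; split; exact: degP.
- move=> [x y]; have [s [hs ->]] := deg_span (gdeg X) x.
  have [r [hr ->]] := deg_span (gdeg Y) y.
  exists ([seq (z, 0) | z <- s] ++ [seq (0, z) | z <- r]); split.
    move=> z; rewrite mem_cat => /orP[/mapP[w /hs[i hw] ->]|/mapP[w /hr[i hw] ->]];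
    by exists i; split=> //; exact: deg0.
  rewrite big_cat !big_map /=; elim: s {hs} => [|z s IH]; last first.
    by rewrite !big_cons -addrA -IH; congr (_, _) => /=; rewrite add0r.
  rewrite !big_nil add0r; elim: r {hr} => [|z r IH]; first by rewrite !big_nil.
  by rewrite !big_cons -IH; congr (_, _) => /=; rewrite add0r.
- move=> s f us hf sf i is_.
  have E : (\sum_(j <- s) (f j).1 = 0) * (\sum_(j <- s) (f j).2 = 0).
    have E1 : (\sum_(j <- s) f j).1 = \sum_(j <- s) (f j).1 by exact: (raddf_sum fst).
    have E2 : (\sum_(j <- s) f j).2 = \sum_(j <- s) (f j).2 by exact: (raddf_sum snd).
    by rewrite -E1 -E2 sf.
  rewrite [f i]surjective_pairing.
  rewrite (@deg_free _ _ (gdeg X) s (fun j => (f j).1)) ?E //; last by move=> j; case: (hf j).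
  rewrite (@deg_free _ _ (gdeg Y) s (fun j => (f j).2)) ?E //.
  by move=> j; case: (hf j).
Defined.

Definition gsum : gbimod A C.
Proof.
refine (@Gbimod S S' A C bisum sum_grading _ _).
- by move=> i j a x ha [? ?]; split; exact: gdegl.
- by move=> i j x a [? ?] ha; split; exact: gdegr.
Defined.
End GSum.
End GradedBimodules.

(* The tensor algebra T_S(M): finitely supported families indexed by n of     *)
(* elements of the n-fold tensor power M (x) (M (x) (... (x) S)) over S.      *)
Section TensorAlgebra.
Context (k : fieldType) (S : algType k) (M : bimod S S).

Fixpoint tpow (n : nat) : bimod S S :=
  if n is m.+1 then tens M (tpow m) else reg S.

Record talg := Talg {
  tcoef :> forall n, tpow n;
  tcoef_fin : exists N, forall n, (N <= n)%N -> tcoef n = 0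
}.

Lemma talg_eq (t u : talg) : (forall n, t n = u n) -> t = u.
Proof.
case: t u => [t ht] [u hu] /= tu; have e : t = u by exact: functional_extensionality_dep.
by rewrite -e in hu *; congr Talg; exact: Prop_irrelevance.
Qed.

HB.instance Definition _ := gen_eqMixin talg.
HB.instance Definition _ := gen_choiceMixin talg.

Lemma t0_fin : exists N, forall n, (N <= n)%N -> (0 : tpow n) = 0.
Proof. by exists 0%N. Qed.
Definition t0 : talg := @Talg (fun n => 0) t0_fin.

Lemma tlin_fin (c : k) (t u : talg) :
  exists N, forall n, (N <= n)%N -> c *: t n + u n = 0.
Proof.
have [N hN] := tcoef_fin t; have [K hK] := tcoef_fin u.
exists (maxn N K) => n; rewrite geq_max => /andP[/hN -> /hK ->].
by rewrite scaler0 addr0.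
Qed.
Definition tlin c t u : talg := Talg (tlin_fin c t u).

Definition taddt t u := tlin 1 t u.
Definition toppt t := tlin (-1) t t0.
Definition tscalet c t := tlin c t t0.

Lemma taddtA : associative taddt.
Proof. by move=> t u v; apply: talg_eq => n /=; rewrite !scale1r addrA. Qed.
Lemma taddtC : commutative taddt.
Proof. by move=> t u; apply: talg_eq => n /=; rewrite !scale1r addrC. Qed.
Lemma taddt0 : left_id t0 taddt.
Proof. by move=> t; apply: talg_eq => n /=; rewrite scaler0 add0r. Qed.
Lemma taddtN : left_inverse t0 toppt taddt.
Proof.
by move=> t; apply: talg_eq => n /=; rewrite scale1r scaleN1r addr0 addNr.
Qed.
HB.instance Definition _ := GRing.isZmodule.Build talg taddtA taddtC taddt0 taddtN.

Lemma tscaletA a b v : tscalet a (tscalet b v) = tscalet (a * b) v.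
Proof. by apply: talg_eq => n /=; rewrite !addr0 scalerA. Qed.
Lemma tscalet1 : left_id 1 tscalet.
Proof. by move=> v; apply: talg_eq => n /=; rewrite addr0 scale1r. Qed.
Lemma tscaletDr : right_distributive tscalet +%R.
Proof. by move=> c u v; apply: talg_eq => n /=; rewrite !addr0 !scale1r scalerDr. Qed.
Lemma tscaletDl v : {morph tscalet^~ v : a b / a + b}.
Proof. by move=> a b; apply: talg_eq => n /=; rewrite !addr0 scale1r scalerDl. Qed.
HB.instance Definition _ :=
  GRing.Zmodule_isLmodule.Build k talg tscaletA tscalet1 tscaletDr tscaletDl.

Lemma tcoefD (t u : talg) n : (t + u) n = t n + u n.
Proof. by rewrite /= scale1r. Qed.
Lemma tcoefZ c (t : talg) n : (c *: t) n = c *: t n.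
Proof. by rewrite /= addr0. Qed.
Lemma tcoef0 n : (0 : talg) n = 0.
Proof. by []. Qed.
Lemma tcoef_sum I (s : seq I) (f : I -> talg) n :
  (\sum_(i <- s) f i) n = \sum_(i <- s) f i n.
Proof. by elim/big_rec2: _ => [|i u v _ <-]; rewrite ?tcoefD. Qed.

Lemma tscal_fin (s : S) (t : talg) :
  exists N, forall n, (N <= n)%N -> lact s (t n) = 0.
Proof. by have [N hN] := tcoef_fin t; exists N => n /hN ->; rewrite lact0. Qed.
Definition tscal s t : talg := Talg (tscal_fin s t).

Definition shift_coef (x : M) (t : talg) (n : nat) : tpow n :=
  if n is m.+1 return tpow n then tpure x (t m) else 0.
Lemma shift_fin x t : exists N, forall n, (N <= n)%N -> shift_coef x t n = 0.
Proof.
have [N hN] := tcoef_fin t; exists N.+1 => -[|n] //= /hN ->.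
by rewrite tpure0r.
Qed.
Definition shift x t : talg := Talg (shift_fin x t).

(* Left multiplication by an element of the n-fold tensor power.              *)
Fixpoint tact (n : nat) : tpow n -> talg -> talg :=
  match n return tpow n -> talg -> talg with
  | 0 => fun s t => tscal s t
  | m.+1 => fun w t => tlift (fun (x : M) (v : tpow m) => shift x (tact v t)) w
  end.

Lemma shiftDl x x' t : shift (x + x') t = shift x t + shift x' t.
Proof.
apply: talg_eq => -[|n]; rewrite tcoefD /=; first by rewrite addr0.
exact: tpureDl.
Qed.
Lemma shiftDr x t u : shift x (t + u) = shift x t + shift x u.
Proof.
apply: talg_eq => -[|n]; rewrite tcoefD /=; first by rewrite addr0.
by rewrite scale1r; exact: tpureDr.
Qed.
Lemma shiftA x s t : shift (ract x s) t = shift x (tscal s t).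
Proof. by apply: talg_eq => -[|n] //=; exact: tpureA. Qed.
Lemma shiftZl c x t : shift (c *: x) t = c *: shift x t.
Proof.
apply: talg_eq => -[|n]; rewrite tcoefZ /=; first by rewrite scaler0.
exact: tpureZl.
Qed.
Lemma shiftZr c x t : shift x (c *: t) = c *: shift x t.
Proof.
apply: talg_eq => -[|n]; rewrite tcoefZ /=; first by rewrite scaler0.
by rewrite addr0; exact: tpureZr.
Qed.
Lemma shift_lact s x t : shift (lact s x) t = tscal s (shift x t).
Proof.
apply: talg_eq => -[|n] /=; first by rewrite lact0.
by rewrite [RHS]lact_pure.
Qed.

Lemma tactP n :
  [/\ forall v w t, tact (v + w : tpow n) t = tact v t + tact w t &
      forall s (v : tpow n) t, tact (lact s v) t = tscal s (tact v t)].
Proof.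
elim: n => [|n [IHD IHl]].
  split=> [v w t|s v t]; apply: talg_eq => n.
    by rewrite tcoefD /= lactDl.
  by rewrite /= lactA.
have bal t : balanced (fun (x : M) (v : tpow n) => shift x (tact v t)).
  split=> [x x' v|x v v'|x a v]; first exact: shiftDl.
    by rewrite IHD shiftDr.
  by rewrite IHl shiftA.
split=> [v w t|s v t]; first exact: tliftD.
elim/tens_ind: v => [|x v|v w IH IH'].
- rewrite /= lact0 [LHS]tlift0 // tlift0 //; apply: talg_eq => i /=.
  by rewrite lact0.
- by rewrite /= lact_pure !tliftE // shift_lact.
- rewrite /= lactDr [LHS]tliftD // [tlift _ (v + w)]tliftD //.
  rewrite [X in X + _]IH [X in _ + X]IH'.
  by apply: talg_eq => i; rewrite tcoefD /= !scale1r lactDr.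
Qed.

Lemma tactDl n (v w : tpow n) t : tact (v + w) t = tact v t + tact w t.
Proof. by have [] := tactP n. Qed.
Lemma tact_lact n s (v : tpow n) t : tact (lact s v) t = tscal s (tact v t).
Proof. by have [] := tactP n. Qed.
Lemma tact_bal n t : balanced (fun (x : M) (v : tpow n) => shift x (tact v t)).
Proof.
split=> [x x' v|x v v'|x a v]; first exact: shiftDl.
  by rewrite tactDl shiftDr.
by rewrite tact_lact shiftA.
Qed.
Lemma tact_pure n x (v : tpow n) t :
  tact (n := n.+1) (tpure x v) t = shift x (tact v t).
Proof. exact/tliftE/tact_bal. Qed.
Lemma tact0l n t : tact (0 : tpow n) t = 0.
Proof. by apply: (addIr (tact (0 : tpow n) t)); rewrite -tactDl !add0r. Qed.

Lemma tpow_ind n (P : tpow n.+1 -> Prop) : P 0 ->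
  (forall x (v : tpow n), P (tpure x v)) ->
  (forall u v, P u -> P v -> P (u + v)) -> forall t, P t.
Proof. exact: tens_ind. Qed.

Lemma tactDr n (v : tpow n) t u : tact v (t + u) = tact v t + tact v u.
Proof.
elim: n v => [|n IHn] v.
  by apply: talg_eq => i; rewrite tcoefD /= !scale1r lactDr.
elim/tpow_ind: v => [|x v|v w IH IH'].
- by rewrite !tact0l addr0.
- by rewrite !tact_pure IHn shiftDr.
- by rewrite !tactDl IH IH' addrACA.
Qed.
Lemma tactZl n c (v : tpow n) t : tact (c *: v) t = c *: tact v t.
Proof.
rewrite -[in LHS](lact1 v) -lactZl tact_lact; apply: talg_eq => i.
by rewrite tcoefZ /= lactZl lact1.
Qed.
Lemma tactZr n c (v : tpow n) t : tact v (c *: t) = c *: tact v t.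
Proof.
elim: n v => [|n IHn] v.
  by apply: talg_eq => i; rewrite tcoefZ /= addr0 lactZr.
elim/tpow_ind: v => [|x v|v w IH IH'].
- by rewrite !tact0l scaler0.
- by rewrite !tact_pure IHn shiftZr.
- by rewrite !tactDl IH IH' scalerDr.
Qed.
Lemma tact0r n (v : tpow n) : tact v 0 = 0.
Proof. by apply: (addIr (tact v 0)); rewrite -tactDr !add0r. Qed.
Lemma tact_sumr n (v : tpow n) I (s : seq I) (f : I -> talg) :
  tact v (\sum_(i <- s) f i) = \sum_(i <- s) tact v (f i).
Proof. by elim/big_rec2: _ => [|i u w _ <-]; rewrite ?tact0r ?tactDr. Qed.

Definition tbound (t : talg) : nat := sval (cid (tcoef_fin t)).
Lemma tboundP t n : (tbound t <= n)%N -> t n = 0.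
Proof. by rewrite /tbound; case: cid => N hN /= /hN. Qed.

Definition tmult (t u : talg) : talg := \sum_(n < tbound t) tact (t n) u.

Lemma tmult_widen N (t u : talg) : (forall n, (N <= n)%N -> t n = 0) ->
  tmult t u = \sum_(n < N) tact (t n) u.
Proof.
have H K L : (forall n, (K <= n)%N -> t n = 0) -> (K <= L)%N ->
    \sum_(n < K) tact (t n) u = \sum_(n < L) tact (t n) u.
  move=> hK KL; rewrite (big_ord_widen L (fun n => tact (t n) u)) //.
  rewrite big_mkcond; apply: eq_bigr => i _; case: ltnP => // /hK ->.
  by rewrite tact0l.
move=> hN; rewrite /tmult (H _ _ (@tboundP t) (leq_maxl _ N)).
by rewrite [RHS](H _ _ hN (leq_maxr (tbound t) _)).
Qed.

Lemma tmultDl t u v : tmult (t + u) v = tmult t v + tmult u v.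
Proof.
pose N := maxn (tbound t) (tbound u).
have ht n : (N <= n)%N -> t n = 0.
  by rewrite geq_max => /andP[/tboundP].
have hu n : (N <= n)%N -> u n = 0.
  by rewrite geq_max => /andP[_ /tboundP].
rewrite !(@tmult_widen N) // => [|n hn]; last by rewrite tcoefD ht ?hu ?addr0.
by rewrite -big_split; apply: eq_bigr => n _; rewrite tcoefD tactDl.
Qed.
Lemma tmultDr t u v : tmult t (u + v) = tmult t u + tmult t v.
Proof. by rewrite -big_split; apply: eq_bigr => n _; rewrite tactDr. Qed.
Lemma tmult0l u : tmult 0 u = 0.
Proof. by apply: (addIr (tmult 0 u)); rewrite -tmultDl !add0r. Qed.
Lemma tmult_suml I (s : seq I) (f : I -> talg) u :
  tmult (\sum_(i <- s) f i) u = \sum_(i <- s) tmult (f i) u.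
Proof. by elim/big_rec2: _ => [|i v w _ <-]; rewrite ?tmult0l ?tmultDl. Qed.

Lemma tscal_tmult s t u : tmult (tscal s t) u = tscal s (tmult t u).
Proof.
rewrite (@tmult_widen (tbound t)) => [|n /tboundP tn]; last by rewrite /= tn lact0.
rewrite /tmult; under eq_bigr do rewrite tact_lact.
apply: talg_eq => n; rewrite tcoef_sum /= tcoef_sum lact_sum.
by apply: eq_bigr.
Qed.
Lemma shift_tmult x t u : tmult (shift x t) u = shift x (tmult t u).
Proof.
rewrite (@tmult_widen (tbound t).+1) => [|[//|n] /tboundP tn]; last first.
  by rewrite /= tn tpure0r.
rewrite big_ord_recl tact0l add0r /tmult.
under eq_bigr do rewrite tact_pure.
elim/big_rec2: _ => [|i v w _ ->]; last by rewrite shiftDr.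
by apply: talg_eq => -[|n] //=; rewrite tpure0r.
Qed.
Lemma tact_tmult n (v : tpow n) t u : tmult (tact v t) u = tact v (tmult t u).
Proof.
elim: n v => [|n IHn] v; first exact: tscal_tmult.
elim/tpow_ind: v => [|x v|v w IH IH'].
- by rewrite !tact0l tmult0l.
- by rewrite !tact_pure shift_tmult IHn.
- by rewrite !tactDl tmultDl IH IH'.
Qed.
Lemma tmultA : associative tmult.
Proof.
move=> t u v; rewrite {2}/tmult tmult_suml; apply: eq_bigr => n _.
by rewrite tact_tmult.
Qed.

Lemma tone_fin : exists N, forall n, (N <= n)%N ->
  (if n is 0 return tpow n then 1 else 0) = 0.
Proof. by exists 1%N => -[]. Qed.
Definition tone : talg :=
  @Talg (fun n => if n is 0 return tpow n then 1 else 0) tone_fin.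

Lemma tmult1l : left_id tone tmult.
Proof.
move=> t; rewrite (@tmult_widen 1) => [|[]] //.
rewrite big_ord_recl big_ord0 addr0; apply: talg_eq => n /=.
by rewrite lact1.
Qed.
(* v, placed in tensor degree n                                               *)
Definition tin n (v : tpow n) : talg := tact v tone.

Lemma tin_eq n (v : tpow n) : tin v n = v.
Proof.
elim: n v => [|n IHn] v; first exact: mulr1.
elim/tpow_ind: v => [|x v|v w IH IH'].
- by rewrite /tin tact0l.
- by rewrite /tin tact_pure /= -/(tin v) IHn.
- by rewrite /tin tactDl tcoefD -/(tin v) -/(tin w) IH IH'.
Qed.
Lemma tin_neq n (v : tpow n) m : m != n -> tin v m = 0.
Proof.
elim: n v m => [|n IHn] v [|m] // mn; first by rewrite /= lact0.
  elim/tpow_ind: v => [|x v|v w IH IH'].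
  - by rewrite /tin tact0l.
  - by rewrite /tin tact_pure.
  - by rewrite /tin tactDl tcoefD -/(tin v) -/(tin w) IH IH' addr0.
elim/tpow_ind: v => [|x v|v w IH IH'].
- by rewrite /tin tact0l.
- by rewrite /tin tact_pure /= -/(tin v) IHn // tpure0r.
- by rewrite /tin tactDl tcoefD -/(tin v) -/(tin w) IH IH' addr0.
Qed.

Lemma tmult1r : right_id tone tmult.
Proof.
move=> t; apply: talg_eq => n; rewrite /tmult tcoef_sum.
have [tn|nt] := leqP (tbound t) n.
  rewrite (tboundP tn) big1 // => i _; apply: tin_neq.
  by apply: contraTneq tn => ->; rewrite -ltnNge.
rewrite (bigD1 (Ordinal nt)) //= [X in X + _](tin_eq (t n)) big1 ?addr0 // => i ni.
by apply: tin_neq; rewrite eq_sym.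
Qed.
Lemma tone_neq0 : tone != 0.
Proof.
apply/eqP => /(congr1 (fun t : talg => tcoef t 0)) /= /eqP.
by rewrite oner_eq0.
Qed.
HB.instance Definition _ := GRing.Zmodule_isNzRing.Build talg
  tmultA tmult1l tmult1r tmultDl tmultDr tone_neq0.

Lemma tmultZl (c : k) (t u : talg) : c *: (t * u) = (c *: t) * u.
Proof.
rewrite [RHS](@tmult_widen (tbound t)) => [|n /tboundP tn].
  by rewrite scaler_sumr; apply: eq_bigr => n _; rewrite tcoefZ tactZl.
by rewrite tcoefZ tn scaler0.
Qed.
HB.instance Definition _ := GRing.Lmodule_isLalgebra.Build k talg tmultZl.
Lemma tmultZr (c : k) (t u : talg) : c *: (t * u) = t * (c *: u).
Proof. by rewrite scaler_sumr; apply: eq_bigr => n _; rewrite tactZr. Qed.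
HB.instance Definition _ := GRing.Lalgebra_isAlgebra.Build k talg tmultZr.

Definition tscalar (s : S) : talg := @tin 0 s.
Definition tgen (x : M) : talg := @tin 1 (@tpure _ _ _ _ M (reg S) x (1 : S)).
Definition tdegree (n : nat) (t : talg) : Prop := forall m, m != n -> t m = 0.

(* x (x) y |-> x y, embedding M (x)_S M as the degree 2 part                  *)
Definition tgen2 : tens M M -> talg := tlift (fun x y => tgen x * tgen y).

Lemma tin_mult n (v : tpow n) (t : talg) : tin v * t = tact v t.
Proof. by rewrite [LHS]tact_tmult [_ t]tmult1l. Qed.
Lemma tgenE x : tgen x = shift x 1.
Proof.
rewrite /tgen /tin tact_pure; congr shift.
by apply: talg_eq => i /=; rewrite lact1.
Qed.
Lemma tgen_mult x t : tgen x * t = shift x t.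
Proof.
rewrite /tgen tin_mult tact_pure; congr shift.
by apply: talg_eq => i /=; rewrite lact1.
Qed.
Lemma tgenD x y : tgen (x + y) = tgen x + tgen y.
Proof. by rewrite !tgenE shiftDl. Qed.
Lemma tgen_lact s x : tgen (lact s x) = tscalar s * tgen x.
Proof. by rewrite tin_mult !tgenE shift_lact. Qed.
Lemma tgen_ract x s : tgen (ract x s) = tgen x * tscalar s.
Proof. by rewrite tgen_mult tgenE shiftA. Qed.
Lemma tgen2_bal : balanced (fun x y => tgen x * tgen y).
Proof.
split=> [x x' y|x y y'|x a y]; rewrite !tgen_mult ?shiftDl //.
  by rewrite !tgenE !shiftDl shiftDr.
by rewrite shiftA !tgenE shift_lact.
Qed.
Lemma tgen2E x y : tgen2 (tpure x y) = tgen x * tgen y.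
Proof. exact/tliftE/tgen2_bal. Qed.
End TensorAlgebra.

Section Koszul.
Context (k : fieldType).

Definition ideal_gen (T : algType k) (G : T -> Prop) (x : T) : Prop :=
  forall I : T -> Prop, I 0 -> (forall u v, I u -> I v -> I (u + v)) ->
    (forall a u b, I u -> I (a * u * b)) -> (forall u, G u -> I u) -> I x.

(* p exhibits B as the graded algebra T_S(M)/(R).                             *)
Record quad_presentation (S : algType k) (M : bimod S S)
    (R : subbimod (tens M M)) (B : gralg S)
    (p : {lrmorphism talg M -> B}) : Prop := {
  qp_surj : forall b, exists t, p t = b;
  qp_ker : forall t, p t = 0 <-> ideal_gen (fun u => exists2 r, R r & u = tgen2 r) t;
  qp_deg : forall (n : nat) b, ggr B n%:Z b <-> exists2 t, tdegree n t & p t = b;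
  qp_scalar : forall s, p (tscalar M s) = gincl B s
}.

Definition findim (V : lmodType k) (W : V -> Prop) : Prop :=
  exists (n : nat) (e : 'I_n -> V), forall x, W x ->
    exists c : 'I_n -> k, x = \sum_i c i *: e i.

Context (S : algType k).

(* B_i as an S-bimodule                                                       *)
Definition gpart (B : gralg S) (i : int) : bimod S S.
Proof.
refine (@sub_bimod k S S (res (gincl B) (gincl B) (reg B))
  (@Subbimod k S S (res (gincl B) (gincl B) (reg B)) (ggr B i) _ _ _ _)).
- exact: deg0.
- exact: degP.
- by move=> a x hx; rewrite -[i]add0r; apply: ggrM => //; apply/gincl_im; exists a.
- by move=> x a hx; rewrite -[i]addr0; apply: ggrM => //; apply/gincl_im; exists a.
Defined.

(* B_0 = S as a graded right B-module, B acting through B -> B_0.             *)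
Definition gaug_mod (B : gralg S) : gbimod (triv k^o) B :=
  gres (@gmorA_kunit k S (triv S)) (@gmorA_aug k S B) (gconc 0 (reg S)).

Record koszul (B : gralg S) : Prop := {
  koszul_findim : forall i, findim (ggr B i);
  koszul_projl : forall i, 0 < i -> projective (as_left (gpart B i));
  koszul_projr : forall i, 0 < i -> projective (as_right (gpart B i));
  koszul_res : exists (P : nat -> gbimod (triv k^o) B)
      (d : forall n, P n.+1 -> P n) (e : P 0%N -> gaug_mod B),
    gresolution d e /\ forall n, generated_in (P n) n%:Z
}.
End Koszul.

Section Bar.
Context (k : fieldType) (S : algType k) (B : gralg S).

Definition S_kk : gbimod (triv k^o) (triv k^o) :=
  gres (@gmorA_kunit k S (triv S)) (@gmorA_kunit k S (triv S)) (greg (triv S)).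
Definition B_Bk : gbimod B (triv k^o) :=
  gres (@gmorA_id k S B) (@gmorA_kunit k S B) (greg B).
Definition B_BS : gbimod B (triv S) :=
  gres (@gmorA_id k S B) (@gmorA_incl k S B) (greg B).
Definition B_SB : gbimod (triv S) B :=
  gres (@gmorA_incl k S B) (@gmorA_id k S B) (greg B).

Section BarOf.
Context (Q : gbimod (triv S) B).

(* S^(x)n (x) Q, tensor products over k                                       *)
Fixpoint barW (n : nat) : gbimod (triv k^o) B :=
  if n is m.+1 then gtens S_kk (barW m)
  else gres (@gmorA_kunit k S (triv S)) (@gmorA_id k S B) Q.

(* B (x) S^(x)n (x) Q                                                         *)
Definition bar (n : nat) : gbimod B B := gtens B_Bk (barW n).

Definition barW_slide n (s : S) (w : barW n.+1) : barW n.+1 :=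
  tlift (fun (s1 : S_kk) (v : barW n) => tpure (s * s1 : S_kk) v) w.

(* s_0 (x) s_1 (x) ... (x) q |-> s_0 s_1 (x) ... - s_0 (x) s_1 s_2 (x) ... +- *)
Fixpoint barW_d (n : nat) : barW n.+1 -> barW n :=
  match n return barW n.+1 -> barW n with
  | 0 => tlift (fun (s : S_kk) (q : barW 0) => @lact k S B Q s q)
  | m.+1 => tlift (fun (s : S_kk) (w : barW m.+1) =>
              barW_slide s w - tpure s (barW_d w))
  end.

Definition bar_slide n (b : B) (w : barW n.+1) : bar n :=
  tlift (fun (s : S_kk) (v : barW n) => tpure (b * gincl B s : B_Bk) v) w.

(* The differential of degree -(n+1); see bar_dE.                             *)
Definition bar_d (n : nat) : bar n.+1 -> bar n :=
  tlift (fun (b : B_Bk) (w : barW n.+1) => bar_slide b w - tpure b (barW_d w)).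

Lemma barW_slide_bal n s : balanced (fun (s1 : S_kk) (v : barW n) =>
  tpure (s * s1 : S_kk) v : barW n.+1).
Proof.
apply: bilin_balanced => [c x x' y|c x y y'].
  by rewrite mulrDr -scalerAr -tpureZl -tpureDl.
by rewrite -tpureZr -tpureDr.
Qed.
Lemma barW_slideE n s (s1 : S) (v : barW n) :
  barW_slide s (tpure (s1 : S_kk) v) = tpure (s * s1 : S_kk) v.
Proof. exact/tliftE/barW_slide_bal. Qed.
Lemma barW_slide_linr n s (c : k) (v w : barW n.+1) :
  barW_slide s (c *: v + w) = c *: barW_slide s v + barW_slide s w.
Proof.
apply: tlift_lin; first exact: barW_slide_bal.
by move=> d x y; rewrite -tpureZl -scalerAr.
Qed.
Lemma barW_slide_linl n (c : k) (s t : S) (w : barW n.+1) :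
  barW_slide (c *: s + t) w = c *: barW_slide s w + barW_slide t w.
Proof.
elim/tens_ind: w => [|x y|u v IH IH'].
- by rewrite !(lin0 (barW_slide_linr _)) scaler0 addr0.
- by rewrite !barW_slideE mulrDl -scalerAl tpureDl tpureZl.
- by rewrite !(linD (barW_slide_linr _)) IH IH' scalerDr addrACA.
Qed.

Lemma barW_dS n (w : barW n.+2) :
  barW_d w = tlift (fun (s : S_kk) (v : barW n.+1) =>
               barW_slide s v - tpure s (barW_d v) : barW n.+1) w.
Proof. by []. Qed.

Lemma barW_d0_bal : balanced (fun (s : S_kk) (q : barW 0) => @lact k S B Q s q).
Proof.
apply: bilin_balanced => [c x x' y|c x y y']; first exact: (@lactP k S B Q).
exact: (@lactD k S B Q).
Qed.

Lemma barW_d_bal_lin n :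
  (forall (c : k) (v w : barW n.+1), barW_d (c *: v + w) = c *: barW_d v + barW_d w) /\
  balanced (fun (s : S_kk) (v : barW n.+1) =>
    barW_slide s v - tpure s (barW_d v) : barW n.+1).
Proof.
elim: n => [|n [IHn IHb]].
  have L (c : k) (v w : barW 1) : barW_d (c *: v + w) = c *: barW_d v + barW_d w.
    by apply: (tlift_lin barW_d0_bal) => d s q; exact: (@lactZl k S B Q).
  split=> //; apply: bilin_balanced => [c x x' y|c x y y'].
    by rewrite barW_slide_linl tpureDl tpureZl scalerBr opprD addrACA.
  by rewrite barW_slide_linr L tpureDr tpureZr scalerBr opprD addrACA.
have L (c : k) (v w : barW n.+2) : barW_d (c *: v + w) = c *: barW_d v + barW_d w.
  rewrite !barW_dS; apply: (tlift_lin IHb) => d s q.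
  by rewrite tpureZl scalerBr (linZ (fun c s t => barW_slide_linl c s t q)).
split=> //; apply: bilin_balanced => [c x x' y|c x y y'].
  by rewrite barW_slide_linl tpureDl tpureZl scalerBr opprD addrACA.
by rewrite barW_slide_linr L tpureDr tpureZr scalerBr opprD addrACA.
Qed.
Lemma barW_d_lin n (c : k) (v w : barW n.+1) :
  barW_d (c *: v + w) = c *: barW_d v + barW_d w.
Proof. by have [] := barW_d_bal_lin n. Qed.
Lemma barW_d_bal n : balanced (fun (s : S_kk) (v : barW n.+1) =>
  barW_slide s v - tpure s (barW_d v) : barW n.+1).
Proof. by have [] := barW_d_bal_lin n. Qed.

(* The canonical projection B (x) Q -> B (x)_S Q.                             *)
Definition bar_aug : bar 0 -> gtens B_BS Q :=
  tlift (fun (b : B_Bk) (q : barW 0) => tpure (b : B_BS) (q : Q)).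

Fixpoint barW_pure (n : nat) (s : nat -> S) (q : Q) : barW n :=
  if n is m.+1 return barW n
  then tpure (s 0%N : S_kk) (barW_pure m (fun l => s l.+1) q) else q.
Definition bar_pure n (b : B) s q : bar n := tpure (b : B_Bk) (barW_pure n s q).
(* (s_0, s_1, ...) |-> (s_0, ..., s_(j-1) s_j, s_(j+1), ...)                  *)
Definition merge (j : nat) (s : nat -> S) (l : nat) : S :=
  if (l.+1 < j)%N then s l else if l.+1 == j then s l * s l.+1 else s l.+1.

Lemma bar_slide_bal n b : balanced (fun (s : S_kk) (v : barW n) =>
  tpure (b * gincl B s : B_Bk) v : bar n).
Proof.
apply: bilin_balanced => [c x x' y|c x y y'].
  by rewrite linearP mulrDr -scalerAr -tpureZl -tpureDl.
by rewrite -tpureZr -tpureDr.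
Qed.
Lemma bar_slideE n b (s : S) (v : barW n) :
  bar_slide b (tpure (s : S_kk) v) = tpure (b * gincl B s : B_Bk) v.
Proof. exact/tliftE/bar_slide_bal. Qed.
Lemma bar_slide_linr n b (c : k) (v w : barW n.+1) :
  bar_slide b (c *: v + w) = c *: bar_slide b v + bar_slide b w.
Proof.
apply: tlift_lin; first exact: bar_slide_bal.
by move=> d x y; rewrite -tpureZl linearZ scalerAr.
Qed.
Lemma bar_slide_linl n (c : k) (a b : B) (w : barW n.+1) :
  bar_slide (c *: a + b) w = c *: bar_slide a w + bar_slide b w.
Proof.
elim/tens_ind: w => [|x y|u v IH IH'].
- by rewrite !(lin0 (bar_slide_linr _)) scaler0 addr0.
- by rewrite !bar_slideE mulrDl -scalerAl tpureDl tpureZl.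
- by rewrite !(linD (bar_slide_linr _)) IH IH' scalerDr addrACA.
Qed.
Lemma bar_d_bal n : balanced (fun (b : B_Bk) (w : barW n.+1) =>
  bar_slide b w - tpure b (barW_d w) : bar n).
Proof.
apply: bilin_balanced => [c x x' y|c x y y'].
  by rewrite bar_slide_linl tpureDl tpureZl scalerBr opprD addrACA.
by rewrite bar_slide_linr barW_d_lin tpureDr tpureZr scalerBr opprD addrACA.
Qed.

Lemma barW_dE n (s : nat -> S) (q : Q) :
  barW_d (barW_pure n.+1 s q) =
    \sum_(1 <= j < n.+1) (-1) ^+ j.-1 *: barW_pure n (merge j s) q +
    (-1) ^+ n *: barW_pure n s (lact (s n) q).
Proof.
elim: n s => [|n IHn] s.
  by rewrite big_geq // add0r scale1r [LHS](tliftE _ _ barW_d0_bal).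
pose s' l := s l.+1.
have -> : barW_d (barW_pure n.+2 s q) =
    barW_slide (s 0%N) (barW_pure n.+1 s' q) -
    tpure (s 0%N : S_kk) (barW_d (barW_pure n.+1 s' q)).
  exact: (tliftE _ _ (barW_d_bal n)).
rewrite [barW_slide _ _]barW_slideE IHn tpureDr tpure_sumr tpureZr opprD addrA.
congr (_ + _); last by rewrite -scaleN1r scalerA -exprS.
rewrite [in RHS]big_nat_recl // [X in _ = X + _]scale1r; congr (_ + _).
rewrite -sumrN; apply: eq_big_nat => -[//|j] _ /=.
by rewrite tpureZr exprS mulN1r scaleNr.
Qed.

Lemma bar_dE n (b : B) (s : nat -> S) (q : Q) :
  bar_d (bar_pure n.+1 b s q) =
    bar_pure n (b * gincl B (s 0%N)) (fun l => s l.+1) q +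
    \sum_(1 <= j < n.+1) (-1) ^+ j *: bar_pure n b (merge j s) q +
    (-1) ^+ n.+1 *: bar_pure n b s (lact (s n) q).
Proof.
rewrite [LHS](tliftE _ _ (bar_d_bal n)) [bar_slide _ _]bar_slideE barW_dE.
rewrite tpureDr tpure_sumr tpureZr opprD addrA; congr (_ + _ + _).
  rewrite -sumrN; apply: eq_big_nat => -[//|j] _ /=.
  by rewrite tpureZr exprS mulN1r scaleNr.
by rewrite exprS mulN1r scaleNr.
Qed.

Lemma bar_augE (b : B) (q : Q) :
  bar_aug (tpure (b : B_Bk) (q : barW 0)) = tpure (b : B_BS) q.
Proof.
apply/tliftE/bilin_balanced => [c x x' y|c x y y'].
  by rewrite -tpureZl -tpureDl.
by rewrite -tpureZr -tpureDr.
Qed.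
End BarOf.

Context (M : bimod S S) (R : subbimod (tens M M)) (p : {lrmorphism talg M -> B}).

(* N (x)_S B for N = M, R, with M in degree 1 and R in degree 2; for N = S it *)
(* is B itself (B_SB).                                                        *)
Definition coefM : gbimod (triv S) B := gtens (gconc 1 M) B_SB.
Definition coefR : gbimod (triv S) B := gtens (gconc 2 (sub_bimod R)) B_SB.

(* barS i is B (x) S^(x)i (x) S (x)_S B, identified with B (x) S^(x)i (x) B.  *)
Definition barR (i : nat) : gbimod B B := bar coefR i.
Definition barM (i : nat) : gbimod B B := bar coefM i.
Definition barS (i : nat) : gbimod B B := bar B_SB i.

Definition dM_in (b1 : B) (x : M) (b2 : B) : gtens B_BS B_SB :=
  tpure (b1 * p (tgen x) : B_BS) (b2 : B_SB) -
  tpure (b1 : B_BS) (p (tgen x) * b2 : B_SB).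
Definition dM : gtens B_BS coefM -> gtens B_BS B_SB :=
  tlift (fun (b1 : B_BS) (q : coefM) =>
    tlift (fun (x : gconc 1 M) (b2 : B_SB) => dM_in b1 x b2) q).

Definition dR_in (b1 : B) (x1 x2 : M) (b2 : B) : gtens B_BS coefM :=
  tpure (b1 * p (tgen x1) : B_BS) (tpure (x2 : gconc 1 M) (b2 : B_SB) : coefM) +
  tpure (b1 : B_BS) (tpure (x1 : gconc 1 M) (p (tgen x2) * b2 : B_SB) : coefM).
Definition dR : gtens B_BS coefR -> gtens B_BS coefM :=
  tlift (fun (b1 : B_BS) (q : coefR) =>
    tlift (fun (r : gconc 2 (sub_bimod R)) (b2 : B_SB) =>
      tlift (fun x1 x2 : M => dR_in b1 x1 x2 b2) (sub_incl r)) q).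

Definition bar_mul : barS 0 -> greg B :=
  tlift (fun (b : B_Bk) (b' : barW B_SB 0) => (b : B) * (b' : B)).

Lemma bar_mulE (b b' : B) :
  bar_mul (tpure (b : B_Bk) (b' : barW B_SB 0)) = b * b'.
Proof.
apply/tliftE/bilin_balanced => [c x x' y|c x y y'].
  by rewrite mulrDl scalerAl.
by rewrite mulrDr scalerAr.
Qed.

Section Formulas.
Context (hp : quad_presentation R p).
Let j (x : M) : B := p (tgen x).

Let jD x y : j (x + y) = j x + j y. Proof. by rewrite /j tgenD linearD. Qed.
Let jl s x : j (lact s x) = gincl B s * j x.
Proof. by rewrite /j tgen_lact rmorphM; congr (_ * _); exact: (qp_scalar hp). Qed.
Let jr x s : j (ract x s) = j x * gincl B s.
Proof. by rewrite /j tgen_ract rmorphM; congr (_ * _); exact: (qp_scalar hp). Qed.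

(* A formula additive in b1 and b2 and compatible with S on both sides of N   *)
(* descends to B (x)_S N (x)_S B.                                             *)
Lemma tlift3E (N : gbimod (triv S) (triv S)) (Z : zmodType)
    (f : B -> N -> B -> Z) :
  (forall a b x c, f (a + b) x c = f a x c + f b x c) ->
  (forall a x y c, f a (x + y) c = f a x c + f a y c) ->
  (forall a x b c, f a x (b + c) = f a x b + f a x c) ->
  (forall a s x c, f (a * gincl B s) x c = f a (lact s x) c) ->
  (forall a x s c, f a (ract x s) c = f a x (gincl B s * c)) ->
  forall a x c,
    tlift (fun (b1 : B_BS) (q : gtens N B_SB) =>
      tlift (fun (x : N) (b2 : B_SB) => f b1 x b2) q)
      (tpure (a : B_BS) (tpure x (c : B_SB) : gtens N B_SB)) = f a x c.
Proof.
move=> f1 f2 f3 fl fr a x c.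
have bal b : balanced (fun (x : N) (b2 : B_SB) => f b x b2).
  by split=> [y y' d|y d d'|y s d]; [exact: f2|exact: f3|exact: fr].
rewrite tliftE ?tliftE //; split=> [b b' q|b q q'|b s q].
- elim/tens_ind: q => [|y d|u v IH IH'].
  + by rewrite !tlift0 // addr0.
  + by rewrite !tliftE // f1.
  + by rewrite !tliftD // IH IH' addrACA.
- by rewrite tliftD.
- elim/tens_ind: q => [|y d|u v IH IH'].
  + by rewrite lact0 !tlift0.
  + by rewrite lact_pure !tliftE //; exact: fl.
  + by rewrite lactDr !tliftD // IH IH'.
Qed.

Lemma dME (b1 : B) (x : M) (b2 : B) :
  dM (tpure (b1 : B_BS) (tpure (x : gconc 1 M) (b2 : B_SB) : coefM)) =
    tpure (b1 * p (tgen x) : B_BS) (b2 : B_SB) -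
    tpure (b1 : B_BS) (p (tgen x) * b2 : B_SB).
Proof.
apply: (@tlift3E (gconc 1 M) _ (fun (b1 : B) (x : M) (b2 : B) =>
  tpure (b1 * j x : B_BS) (b2 : B_SB) - tpure (b1 : B_BS) (j x * b2 : B_SB))).
- by move=> a b y c; rewrite mulrDl !tpureDl opprD addrACA.
- by move=> a y z c; rewrite jD mulrDr mulrDl tpureDl tpureDr opprD addrACA.
- by move=> a y b c; rewrite mulrDr !tpureDr opprD addrACA.
- move=> a s y c; rewrite jl mulrA -(mulrA _ (j y) c); congr (_ - _).
  exact: (@tpureA k B S B B_BS B_SB a s (j y * c)).
- move=> a y s c; rewrite jr !mulrA; congr (_ - _).
  exact: (@tpureA k B S B B_BS B_SB (a * j y) s c).
Qed.

Let dR_bal b1 b2 : balanced (fun x1 x2 : M => dR_in b1 x1 x2 b2).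
Proof.
split=> [x x' y|x y y'|x s y].
- transitivity (tpure (b1 * j (x + x') : B_BS) (tpure (y : gconc 1 M) (b2 : B_SB) : coefM) +
    tpure (b1 : B_BS) (tpure (x + x' : gconc 1 M) (j y * b2 : B_SB) : coefM)) => //.
  by rewrite jD mulrDr tpureDl (@tpureDl _ _ _ _ (gconc 1 M)) tpureDr addrACA.
- transitivity (tpure (b1 * j x : B_BS) (tpure (y + y' : gconc 1 M) (b2 : B_SB) : coefM) +
    tpure (b1 : B_BS) (tpure (x : gconc 1 M) (j (y + y') * b2 : B_SB) : coefM)) => //.
  by rewrite jD mulrDl (@tpureDl _ _ _ _ (gconc 1 M)) !tpureDr addrACA.
- congr (_ + _).
    rewrite -[p (tgen _)]/(j _) jr mulrA.
    etransitivity; first exact: (@tpureA k B S B B_BS coefM (b1 * j x) s (tpure (y : gconc 1 M) (b2 : B_SB))).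
    by congr (tpure _ _); exact: (@lact_pure k S S B (gconc 1 M) B_SB).
  congr (tpure _ _); rewrite -[p (tgen (lact s y))]/(j _) jl -mulrA.
  exact: (@tpureA k S S B (gconc 1 M) B_SB x s (j y * b2)).
Qed.

(* dR on b1 (x) (sum_l x_l (x) y_l) (x) b2, for an element of R written as a  *)
(* sum of pure tensors of M (x)_S M.                                          *)
Lemma dRE (b1 b2 : B) (r : sub_bimod R) (s : seq (M * M)) :
  sub_incl r = \sum_(l <- s) tpure l.1 l.2 ->
  dR (tpure (b1 : B_BS) (tpure (r : gconc 2 (sub_bimod R)) (b2 : B_SB) : coefR)) =
    \sum_(l <- s) dR_in b1 l.1 l.2 b2.
Proof.
move=> rs; rewrite -(tlift_cl _ (dR_bal b1 b2)) tclE -rs.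
apply: (@tlift3E (gconc 2 (sub_bimod R)) _ (fun (b1 : B) (r : sub_bimod R) (b2 : B) =>
  tlift (fun x1 x2 : M => dR_in b1 x1 x2 b2) (sub_incl r))).
- move=> a b z c; elim/tens_ind: (sub_incl z) => [|x y|u v IH IH'].
  + by rewrite !tlift0 // addr0.
  + by rewrite !tliftE // /dR_in mulrDl !tpureDl addrACA.
  + by rewrite !tliftD // IH IH' addrACA.
- by move=> a x y c; rewrite -tliftD.
- move=> a z b c; elim/tens_ind: (sub_incl z) => [|x y|u v IH IH'].
  + by rewrite !tlift0 // addr0.
  + by rewrite !tliftE // /dR_in mulrDr !tpureDr addrACA.
  + by rewrite !tliftD // IH IH' addrACA.
- move=> a t z c; have -> : sub_incl (lact t z) = lact t (sub_incl z) by [].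
  elim/tens_ind: (sub_incl z) => [|x y|u v IH IH'].
  + by rewrite lact0 !tlift0.
  + rewrite lact_pure !tliftE //; congr (_ + _).
      congr (tpure _ _); rewrite -[p (tgen (lact t x))]/(j _) jl.
      exact/esym/mulrA.
    etransitivity; first exact: (@tpureA k B S B B_BS coefM a t).
    by congr (tpure _ _); exact: (@lact_pure k S S B (gconc 1 M) B_SB).
  + by rewrite lactDr !tliftD // IH IH'.
- move=> a z t c; have -> : sub_incl (ract z t) = ract (sub_incl z) t by [].
  elim/tens_ind: (sub_incl z) => [|x y|u v IH IH'].
  + by rewrite ract0 !tlift0.
  + rewrite ract_pure !tliftE //; congr (_ + _).
      congr (tpure _ _); exact: (@tpureA k S S B (gconc 1 M) B_SB y t c).
    congr (tpure _ _); congr (tpure _ _); rewrite -[p (tgen (ract y t))]/(j _) jr.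
    exact/esym/mulrA.
  + by rewrite ractDl !tliftD // IH IH'.
Qed.

End Formulas.

(* totP n is P^(-n), totd n is delta^(-n-1); elements are (x, (y, z)) with x  *)
(* in the R-summand, y in the M-summand, z in the S-summand.                  *)
Definition totP (n : nat) : gbimod B B :=
  match n with
  | 0 => barS 0
  | 1 => gsum (barM 0) (barS 1)
  | m.+2 => gsum (barR m) (gsum (barM m.+1) (barS m.+2))
  end.

Definition totd (th2 : forall i, barR i -> barM i) (th1 : forall i, barM i -> barS i)
    (h : forall i, barR i -> barS i.+1) (n : nat) : totP n.+1 -> totP n :=
  match n return totP n.+1 -> totP n with
  | 0 => fun u => th1 0%N u.1 + bar_d u.2
  | 1 => fun u => (th2 0%N u.1 - bar_d u.2.1,
                   - h 0%N u.1 + th1 1%N u.2.1 + bar_d u.2.2)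
  | m.+2 => fun u => (bar_d u.1,
                      (th2 m.+1 u.1 - bar_d u.2.1,
                       - h m.+1 u.1 + th1 m.+2 u.2.1 + bar_d u.2.2))
  end.
End Bar.

(* Main.v *)
Require Import Defs.
From HB Require Import structures.
From mathcomp Require Import all_boot all_order all_algebra.
From mathcomp Require Import boolp.
Set Implicit Arguments.
Unset Strict Implicit.
Unset Printing Implicit Defensive.
Import Order.TTheory GRing.Theory Num.Theory.
Local Open Scope ring_scope.

(** The complex is an iterated mapping cone.  Its three columns are bar complexes
    resolving [B (x)_S N (x)_S B] for [N = R, M, S], and the maps lifted by [th2] and
    [th1] form the Koszul bimodule sequence
    [0 -> B (x)_S R (x)_S B -> B (x)_S M (x)_S B -> B (x)_S B -> B -> 0].  When the
    columns and this sequence are exact, a diagram chase shows that the cone is exact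
    over [B], the homotopy [h] making up for [th1 th2] being only null-homotopic
    ([cone_resolution]).  So three things have to be shown: the terms are projective,
    the columns are exact, and the Koszul bimodule sequence is exact.

    Projectivity enters through dual bases, as finite lists of generators with
    right linear coordinate forms.  The components of [B] of positive degree have
    such lists because they are projective and finite dimensional, and the
    component [S] of degree 0 has one of length 1; hence [B] has coordinates on
    each finite subset, which suffices for right flatness ([tens_map_exact]).  The
    same forms carry the bar complex of [B] to that of [S], which is contractible,
    and give exactness of the columns ([bar_exact]).  As [M] is [B_1] and [R] is the
    kernel of the split surjection from [M (x)_S M] to [B_2], both have dual bases
    over [S], which makes the terms projective ([gproj_coef], [gproj_bar]).

    For the bimodule sequence one starts with the right modules
    [0 -> R (x)_S B -> M (x)_S B -> B -> S -> 0].  Its exactness at [B] and at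
    [M (x)_S B] expresses that [B] is generated by [M] over [S] with relations [R]
    ([koszul1_exact]).  At [R (x)_S B] the dimension bound is used: comparing with a
    resolution of length 2 makes the kernel a graded direct summand of
    [R (x)_S B], which is generated in degree 2, whereas the kernel is zero in
    degree 2 ([koszul2_injective]).  By flatness the sequence stays exact at its
    two left terms after applying [B (x)_S -].  The bimodule differentials differ
    from the resulting ones by maps that lower the degree of the right-hand factor,
    so a descending induction on that degree transfers exactness to them
    ([perturbed_injective], [perturbed_exact]). *)

(** * Graded morphisms, graded kernels and lifting *)

Section Bimor.
Context (k : fieldType) (A C : algType k) (X Y : bimod A C) (f : X -> Y) (hf : bimor f).
Lemma bimor_lin (c : k) x y : f (c *: x + y) = c *: f x + f y.
Proof. by case: hf. Qed.
Lemma bimorD x y : f (x + y) = f x + f y.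
Proof. exact: (linD bimor_lin). Qed.
Lemma bimorB x y : f (x - y) = f x - f y.
Proof. by rewrite bimorD (linN bimor_lin). Qed.
Lemma bimor0 : f 0 = 0.
Proof. exact: (lin0 bimor_lin). Qed.
Lemma bimorl a x : f (lact a x) = lact a (f x).
Proof. by case: hf. Qed.
Lemma bimorr x a : f (ract x a) = ract (f x) a.
Proof. by case: hf. Qed.

Definition ker_sub : subbimod X.
Proof.
refine (@Subbimod k A C X (fun x => f x = 0) _ _ _ _).
- exact: bimor0.
- by move=> c x y fx fy; rewrite bimor_lin fx fy scaler0 addr0.
- by move=> a x fx; rewrite bimorl fx lact0.
- by move=> x a fx; rewrite bimorr fx ract0.
Defined.
End Bimor.

Section SubIncl.
Context (k : fieldType) (A C : algType k) (X : bimod A C) (K : subbimod X).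
Lemma sub_incl_lin (c : k) (x y : sub_bimod K) :
  sub_incl (c *: x + y) = c *: sub_incl x + sub_incl y.
Proof. exact: (linearP val). Qed.
Lemma sub_sumE (s : seq (sub_bimod K)) :
  sub_incl (\sum_(x <- s) x) = \sum_(x <- s) sub_incl x.
Proof. exact: (raddf_sum val). Qed.
End SubIncl.

Section Graded.
Context (k : fieldType) (S S' : algType k) (A : gralg S) (C : gralg S').


Lemma gmor_lin (X Y : gbimod A C) (f : X -> Y) : gmor f ->
  forall (c : k) x y, f (c *: x + y) = c *: f x + f y.
Proof. by case=> /bimor_lin. Qed.
Lemma gmorD (X Y : gbimod A C) (f : X -> Y) : gmor f ->
  forall x y, f (x + y) = f x + f y.
Proof. by case=> /bimorD. Qed.
Lemma gmorB (X Y : gbimod A C) (f : X -> Y) : gmor f ->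
  forall x y, f (x - y) = f x - f y.
Proof. by case=> /bimorB. Qed.
Lemma gmor0 (X Y : gbimod A C) (f : X -> Y) : gmor f -> f 0 = 0.
Proof. by case=> /bimor0. Qed.

Lemma gmor_id (X : gbimod A C) : gmor (fun x : X => x).
Proof. by []. Qed.

Lemma gmor_comp (X Y Z : gbimod A C) (g : Y -> Z) (f : X -> Y) :
  gmor g -> gmor f -> gmor (fun x => g (f x)).
Proof.
move=> [[gl ga gr] gd] [[fl fa fr] fd]; split; last by move=> i x /fd/gd.
by split=> [c x y|a x|x a]; rewrite ?fl ?fa ?fr ?gl ?ga ?gr.
Qed.

Lemma gmor_add (X Y : gbimod A C) (f g : X -> Y) :
  gmor f -> gmor g -> gmor (fun x => f x + g x).
Proof.
move=> [[fl fa fr] fd] [[gl ga gr] gd]; split.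
  split=> [c x y|a x|x a].
  - by rewrite fl gl scalerDr addrACA.
  - by rewrite fa ga lactDr.
  - by rewrite fr gr ractDl.
by move=> i x hx; apply: degD; [exact: fd|exact: gd].
Qed.

Lemma gmor_opp (X Y : gbimod A C) (f : X -> Y) : gmor f -> gmor (fun x => - f x).
Proof.
move=> [[fl fa fr] fd]; split.
  split=> [c x y|a x|x a].
  - by rewrite fl opprD scalerN.
  - by rewrite fa -!scaleN1r lactZr.
  - by rewrite fr -!scaleN1r ractZl.
by move=> i x hx; apply: degN; exact: fd.
Qed.

Lemma gmor_sub (X Y : gbimod A C) (f g : X -> Y) :
  gmor f -> gmor g -> gmor (fun x => f x - g x).
Proof. by move=> hf hg; exact: gmor_add hf (gmor_opp hg). Qed.

Lemma hcomp_gmor (X Y : gbimod A C) (f : X -> Y) : gmor f ->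
  forall i x, f (hcomp (gdeg X) i x) = hcomp (gdeg Y) i (f x).
Proof.
move=> hf i x; apply/esym.
apply: (@hcomp_unique _ _ _ _ (hsupp (gdeg X) x)
  (fun i => f (hcomp (gdeg X) i x))).
- exact: hsupp_uniq.
- by move=> j; apply: (proj2 hf); exact: hcomp_deg.
- by move=> j /hcomp_out ->; exact: gmor0.
- by rewrite {1}(hcomp_sum (gdeg X) x); exact: (lin_sum (gmor_lin hf)).
Qed.

(** Components of a preimage are preimages of the components. *)
Lemma gmor_preim (X Y : gbimod A C) (f : X -> Y) : gmor f ->
  (forall y, exists x, f x = y) ->
  forall i y, gdeg Y i y -> exists2 x, gdeg X i x & f x = y.
Proof.
move=> hf surj i y hy; have [x fx] := surj y.
exists (hcomp (gdeg X) i x); first exact: hcomp_deg.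
by rewrite hcomp_gmor // fx (hcomp_homog _ hy) eqxx.
Qed.

Section GSub.
Context (X : gbimod A C) (K : subbimod X).
Hypothesis (Kh : forall i x, K x -> K (hcomp (gdeg X) i x)).

Definition gsub_grading : grading (sub_bimod K).
Proof.
refine (@Grading k (sub_bimod K) (fun i x => gdeg X i (sub_incl x)) _ _ _ _).
- by move=> i; exact: deg0.
- by move=> i c x y hx hy; rewrite sub_incl_lin; exact: degP.
- move=> [x Kx].
  have Kc i : hcomp (gdeg X) i x \in sbpred K.
    by apply/asboolP/Kh/asboolP.
  exists [seq Subcar (Kc i) | i <- hsupp (gdeg X) x]; split.
    by move=> _ /mapP[i _ ->]; exists i; exact: hcomp_deg.
  apply: val_inj; rewrite [LHS](hcomp_sum (gdeg X) x) /=.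
  by rewrite [RHS]sub_sumE big_map.
- move=> s f us hf sf i is_; apply: val_inj.
  apply: (deg_free (g := gdeg X) (s := s) (f := fun j => sub_incl (f j))) => //.
  by rewrite -[LHS](raddf_sum val) sf.
Defined.

Definition gsub : gbimod A C.
Proof.
refine (@Gbimod k S S' A C (sub_bimod K) gsub_grading _ _).
- by move=> i j a x ha hx; exact: gdegl.
- by move=> i j x a hx ha; exact: gdegr.
Defined.
End GSub.

(** Projectivity applied to the surjection from [X] onto the graded kernel of [d'];
    comparison maps and homotopies are built from this form of lifting. *)
Lemma gproj_lift (Q X Y Z : gbimod A C) (d : X -> Y) (d' : Y -> Z) (g : Q -> Y) :
  gprojective Q -> gmor d -> gmor d' -> gmor g ->
  (forall x, d' (d x) = 0) -> (forall y, d' y = 0 -> exists x, d x = y) ->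
  (forall q, d' (g q) = 0) ->
  exists2 f : Q -> X, gmor f & forall q, d (f q) = g q.
Proof.
move=> Qp hd hd' hg dd ex gz.
pose K := ker_sub (proj1 hd').
have Kh i y : K y -> K (hcomp (gdeg Y) i y).
  move=> Ky; change (d' (hcomp (gdeg Y) i y) = 0).
  by rewrite hcomp_gmor // Ky (hcomp_homog _ (deg0 _ i)) if_same.
have Kin y : d' y = 0 -> y \in sbpred K by move=> h; apply/asboolP.
pose dK (x : X) : gsub Kh := Subcar (Kin _ (dd x)).
pose gK (q : Q) : gsub Kh := Subcar (Kin _ (gz q)).
have hdK : gmor dK.
  case: hd => [[dl da dr] dg]; split; last by move=> i x hx; exact: dg.
  by split=> [c x y|a x|x a]; apply: val_inj; rewrite /= ?linearP /=;
     [exact: dl|exact: da|exact: dr].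
have hgK : gmor gK.
  case: hg => [[gl ga gr] gg]; split; last by move=> i x hx; exact: gg.
  by split=> [c x y|a x|x a]; apply: val_inj; rewrite /= ?linearP /=;
     [exact: gl|exact: ga|exact: gr].
have [[y Ky]|f hf fE] := Qp _ _ dK gK hdK _ hgK.
  by have /asboolP/ex[x xy] := Ky; exists x; apply: val_inj.
by exists f => // q; have /(congr1 val) := fE q.
Qed.
End Graded.
(** * Right coordinate systems and flatness *)

Record rform (k : fieldType) (A S : algType k) (X : bimod A S) := Rform {
  rfun :> X -> S;
  rform_lin : forall (c : k) x y, rfun (c *: x + y) = c *: rfun x + rfun y;
  rform_ract : forall x s, rfun (ract x s) = rfun x * s
}.

Section Coordinates.
Context (k : fieldType).

Section Def.
Context (A S : algType k) (X : bimod A S).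

(** The dual basis lemma turned into a definition.  With [P] total it
    characterizes finitely generated projective right modules.  Having such a list
    for each finite [P] passes to infinite direct sums, and still makes tensoring
    with [X] exact. *)
Definition right_coords (P : X -> Prop) (cs : seq (X * rform X)) : Prop :=
  forall x, P x -> x = \sum_(c <- cs) ract c.1 (c.2 x).

Definition right_dualizable : Prop :=
  exists cs, right_coords (fun=> True) cs.
Definition locally_dualizable : Prop :=
  forall s : seq X, exists cs, right_coords (fun x => x \in s) cs.

Lemma rformD (f : rform X) x y : f (x + y) = f x + f y.
Proof. exact: (linD (rform_lin f)). Qed.
Lemma rformZ (f : rform X) c x : f (c *: x) = c *: f x.
Proof. exact: (linZ (rform_lin f)). Qed.
End Def.

Section Free.
Context (S : algType k) (n : nat).
Definition free_right : bimod k^o S.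
Proof.
refine (@Bimod k k^o S {ffun 'I_n -> S} (fun c f => (c : k) *: f)
  (fun f s => [ffun i => f i * s]) _ _ _ _ _ _ _ _ _).
- by move=> c a b x; rewrite scalerDl scalerA.
- by move=> c a x y; rewrite scalerDr !scalerA mulrC.
- by move=> x; rewrite scale1r.
- by move=> a b x; rewrite scalerA.
- by move=> c a b x; apply/ffunP => i; rewrite !ffunE mulrDr scalerAr.
- by move=> c a x y; apply/ffunP => i; rewrite !ffunE mulrDl scalerAl.
- by move=> x; apply/ffunP => i; rewrite !ffunE mulr1.
- by move=> a b x; apply/ffunP => i; rewrite !ffunE mulrA.
- by move=> a x b; apply/ffunP => i; rewrite !ffunE scalerAl.
Defined.
End Free.

(** A spanning family makes the module a quotient of a free module, and
    projectivity splits that quotient; the components of the splitting are the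
    coordinate forms. *)
Lemma projective_dualizable (A S : algType k) (X : bimod A S) n (e : 'I_n -> X) :
  (forall x, exists c : 'I_n -> k, x = \sum_i c i *: e i) ->
  projective (as_right X) -> right_dualizable X.
Proof.
move=> span proj.
pose p (f : free_right S n) : as_right X := \sum_i ract (e i) ((f : {ffun _}) i).
have hp : bimor p.
  have lin (c : k) (f g : free_right S n) : p (c *: f + g) = c *: p f + p g.
    rewrite /p scaler_sumr -big_split; apply: eq_bigr => i _.
    by rewrite !ffunE ractP.
  split=> // [a f|f s].
    by rewrite !lact_base (linZ lin).
  rewrite {2}/p [RHS]ract_sum; apply: eq_bigr => i _.
  by rewrite ffunE; exact/esym/(@ractA k A S X).
have [x||f hf fE] := proj _ _ p (fun x => x) hp.
  have [c ->] := span x; exists ([ffun i => c i *: 1] : free_right S n).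
  by apply: eq_bigr => i _; rewrite ffunE ractZr ract1.
  by [].
case: hf => fl _ fr.
have cl i (c : k) x y : (f (c *: x + y) : {ffun _}) i =
    c *: (f x : {ffun _}) i + (f y : {ffun _}) i.
  by rewrite fl !ffunE.
have cr i x s : (f (ract x s) : {ffun _}) i = (f x : {ffun _}) i * s.
  by have := fr x s; rewrite [@ract _ _ _ (as_right X) x s]/(@ract _ _ _ X x s) => ->;
     rewrite ffunE.
exists [seq (e i, @Rform _ _ _ X (fun x => (f x : {ffun _}) i) (cl i) (cr i))
       | i <- index_enum 'I_n] => x _.
by rewrite big_map -[LHS]fE.
Qed.
End Coordinates.

Section LeftMor.
Context (k : fieldType) (S C C' : algType k) (Y : bimod S C) (Y' : bimod S C').
(** Homogeneous projections respect the left action of [S] but not the right action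
    of [B], so functoriality of [X (x)_S -] is stated for such maps. *)
Definition left_mor (g : Y -> Y') : Prop :=
  {morph g : x y / x + y} /\ forall a x, g (lact a x) = lact a (g x).
Lemma left_mor0 g : left_mor g -> g 0 = 0.
Proof. by case=> gD _; apply: (addIr (g 0)); rewrite -gD !add0r. Qed.
End LeftMor.

Lemma bimor_left (k : fieldType) (S C : algType k) (Y Y' : bimod S C) (g : Y -> Y') :
  bimor g -> left_mor g.
Proof. by move=> hg; split; [exact: (bimorD hg)|case: hg]. Qed.

Section Flatness.
Context (k : fieldType) (A S C : algType k) (X : bimod A S).

Section Contraction.
Context (Y : bimod S C).

Lemma contract_bal (f : rform X) : balanced (fun (x : X) (y : Y) => lact (f x) y).
Proof.
split=> [x x' y|x y y'|x s y].
- by rewrite rformD lactDl.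
- by rewrite lactDr.
- by rewrite rform_ract lactA.
Qed.
Definition contract (f : rform X) : tens X Y -> Y := tlift (fun x y => lact (f x) y).
Lemma contract_pure f x y : contract f (tpure x y) = lact (f x) y.
Proof. exact/tliftE/contract_bal. Qed.
Lemma contractD f u v : contract f (u + v) = contract f u + contract f v.
Proof. exact/tliftD/contract_bal. Qed.
Lemma contract0 f : contract f 0 = 0.
Proof. exact/tlift0/contract_bal. Qed.

(** The finitely many left-hand components of a representative of [u] have
    coordinates, and the coordinates can be moved across the tensor sign. *)
Lemma tens_coords : locally_dualizable X -> forall u : tens X Y,
  exists cs : seq (X * rform X), u = \sum_(c <- cs) tpure c.1 (contract c.2 u).
Proof.
move=> Xd u; rewrite -[u]tcl_repr tclE; have [cs csE] := Xd [seq q.1 | q <- repr u].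
exists cs; elim: (repr u) csE => [|[x y] s IH] csE.
  by rewrite !big_nil big1 // => c _; rewrite contract0 tpure0r.
rewrite !big_cons /= {1}IH => [|z zs]; last by apply: csE; rewrite inE zs orbT.
rewrite {1}(csE x (mem_head _ _)) tpure_suml -big_split; apply: eq_bigr => c _ /=.
by rewrite contractD contract_pure tpureDr -tpureA.
Qed.
End Contraction.

Section TensMap.
Context (Y Y' : bimod S C) (g : Y -> Y') (hg : left_mor g).
Lemma tens_map_bal : balanced (fun (x : X) (y : Y) => tpure x (g y) : tens X Y').
Proof.
case: (hg) => gD ga; split=> [x x' y|x y y'|x s y].
- exact: tpureDl.
- by rewrite gD tpureDr.
- by rewrite ga tpureA.
Qed.
Definition tens_map : tens X Y -> tens X Y' := tlift (fun x y => tpure x (g y)).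
Lemma tens_map_pure x y : tens_map (tpure x y) = tpure x (g y).
Proof. exact/tliftE/tens_map_bal. Qed.
Lemma tens_mapD u v : tens_map (u + v) = tens_map u + tens_map v.
Proof. exact/tliftD/tens_map_bal. Qed.
Lemma tens_map0 : tens_map 0 = 0.
Proof. exact/tlift0/tens_map_bal. Qed.
Lemma contract_tens_map f u : contract f (tens_map u) = g (contract f u).
Proof.
elim/tens_ind: u => [|x y|u v IH IH'].
- by rewrite tens_map0 !contract0 left_mor0.
- by rewrite tens_map_pure !contract_pure; case: hg.
- by rewrite tens_mapD !contractD IH IH'; case: hg.
Qed.
End TensMap.

(** Locally dualizable modules are flat: an element killed by [id (x) g] has all
    its contractions killed by [g], and lifting finitely many of these lifts the
    element. *)
Lemma tens_map_exact (Y1 Y2 Y3 : bimod S C) (f : Y1 -> Y2) (g : Y2 -> Y3) :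
  locally_dualizable X -> left_mor f -> left_mor g ->
  (forall y, g y = 0 -> exists z, f z = y) ->
  forall u : tens X Y2, tens_map g u = 0 -> exists v, tens_map f v = u.
Proof.
move=> Xd hf hg ex u gu; have [cs ->] := tens_coords Xd u.
elim: cs => [|c cs [v vE]].
  by exists 0; rewrite tens_map0 // big_nil.
have [z fz] : exists z, f z = contract c.2 u.
  by apply: ex; rewrite -contract_tens_map // gu contract0.
by exists (tpure c.1 z + v); rewrite tens_mapD // tens_map_pure // fz vE big_cons.
Qed.

Lemma tens_map_inj (Y1 Y2 : bimod S C) (f : Y1 -> Y2) :
  locally_dualizable X -> left_mor f -> (forall y, f y = 0 -> y = 0) ->
  forall u : tens X Y1, tens_map f u = 0 -> u = 0.
Proof.
move=> Xd hf inj u fu; have [cs ->] := tens_coords Xd u.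
rewrite big1 // => c _; rewrite (inj (contract c.2 u)) ?tpure0r //.
by rewrite -contract_tens_map // fu contract0.
Qed.
End Flatness.

Section FinDim.
Context (k : fieldType).

(** A spanning family of minimal length is linearly independent, so coordinates
    along it are unique, hence linear. *)
Lemma findim_dualizable (V : bimod k^o k^o) n (e : 'I_n -> V) :
  (forall x, exists c : 'I_n -> k, x = \sum_i c i *: e i) -> right_dualizable V.
Proof.
move=> span.
pose spans m := `[< exists e : 'I_m -> V,
  forall x, exists c : 'I_m -> k, x = \sum_i c i *: e i >].
have ex : exists m, spans m by exists n; apply/asboolP; exists e.
case: (ex_minnP ex) => m /asboolP[{}e {}span] mmin.
have indep (c : 'I_m -> k) : \sum_i c i *: e i = 0 -> forall i, c i = 0.
  case: m e span mmin c => [|m] e span mmin c sum0 j; first by case: j.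
  apply: contrapT => /eqP cj.
  have /mmin : spans m; last by rewrite ltnn.
  apply/asboolP; exists (fun i => e (lift j i)) => x; have [a ->] := span x.
  exists (fun i => a (lift j i) - a j / c j * c (lift j i)).
  (* a relation with [c j != 0] expresses [e j] by the others *)
  have ej : e j = - \sum_(i < m) (c (lift j i) / c j) *: e (lift j i).
    apply: (scalerI cj); rewrite scalerN scaler_sumr.
    move/eqP: sum0; rewrite (bigD1_ord j) //= addr_eq0 => /eqP ->.
    by congr (- _); apply: eq_bigr => i _; rewrite scalerA mulrC divfK.
  rewrite (bigD1_ord j) //= ej scalerN scaler_sumr -sumrN -big_split.
  apply: eq_bigr => i _ /=; rewrite addrC scalerA -scalerBl; congr (_ *: _).
  by congr (_ - _); rewrite mulrA mulrAC.
have [c cE] : exists c : V -> 'I_m -> k, forall x, x = \sum_i c x i *: e i.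
  by exists (fun x => sval (cid (span x))) => x; case: cid.
have clin i (a : k) x y : c (a *: x + y) i = a * c x i + c y i.
  apply/eqP; rewrite -subr_eq0; apply/eqP.
  apply: (indep (fun i => c (a *: x + y) i - (a * c x i + c y i))).
  have -> : \sum_i (c (a *: x + y) i - (a * c x i + c y i)) *: e i =
      \sum_i c (a *: x + y) i *: e i -
      (a *: (\sum_i c x i *: e i) + \sum_i c y i *: e i).
    rewrite scaler_sumr -big_split -sumrB; apply: eq_bigr => j _ /=.
    by rewrite scalerBl scalerDl scalerA.
  by rewrite -!cE subrr.
have cl i (a : k) x y : c (a *: x + y) i = a *: (c x i : k^o) + c y i := clin i a x y.
have cr i x (s : k^o) : c (ract x s) i = (c x i : k^o) * s.
  have c0 : c 0 i = 0.
    by apply: (addIr (c 0 i)); have := clin i 1 0 0; rewrite scaler0 addr0 mul1r add0r.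
  by rewrite ract_base -[_ *: x]addr0 clin c0 addr0; exact: mulrC.
exists [seq (e i, @Rform _ _ _ V (fun x => c x i : k^o) (cl i) (cr i))
       | i <- index_enum 'I_m] => x _.
rewrite big_map {1}(cE x); apply: eq_bigr => i _ /=.
by rewrite ract_base.
Qed.
End FinDim.

Lemma hcomp0E (k : fieldType) (S : algType k) (B : gralg S) (b : B) :
  hcomp (ggr B) 0 b = gincl B (gaug B b).
Proof.
have [s sE] : exists s, hcomp (ggr B) 0 b = gincl B s by apply/gincl_im/hcomp_deg.
rewrite sE; congr (gincl B _); rewrite -[LHS](gaugK B) -sE.
rewrite [in RHS](hcomp_sum (ggr B) b) linear_sum.
have aug0 i : i != 0 -> gaug B (hcomp (ggr B) i b) = 0.
  rewrite neq_lt => /orP[i0|i0]; last exact: gaug_pos i0 (hcomp_deg _ _ _).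
  by rewrite (ggr_pos i0 (hcomp_deg _ _ _)) linear0.
have [b0|b0] := boolP (0 \in hsupp (ggr B) b).
  by rewrite (bigD1_seq 0) ?hsupp_uniq //= big1 ?addr0 // => i /aug0.
rewrite (hcomp_out b0) linear0 big_seq big1 // => i ib.
by apply: aug0; apply: contraNneq b0 => <-.
Qed.

Section KoszulCoordinates.
Context (k : fieldType) (S : algType k) (B : gralg S) (B_koszul : koszul B).

Lemma S_dualizable : right_dualizable (S_kk S).
Proof.
have [n [e span]] := koszul_findim B_koszul 0.
apply: (@findim_dualizable k (S_kk S) n (fun i => gaug B (e i))) => s.
have [|c /(congr1 (gaug B))] := span (gincl B s); first by apply/gincl_im; exists s.
rewrite gaugK linear_sum => sE; exists c; rewrite [LHS]sE.
by apply: eq_bigr => i _; rewrite linearZ.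
Qed.

Definition in_gpart i b (hb : ggr B i b) : gpart B i.
Proof. by exists b; apply/asboolP. Defined.
Lemma gpart_deg i (x : gpart B i) : ggr B i (sub_incl x).
Proof. by case: x => x /= /asboolP. Qed.

Lemma gpart_dualizable i : 0 < i -> right_dualizable (gpart B i).
Proof.
move=> i0; have [n [e span]] := koszul_findim B_koszul i.
apply: (@projective_dualizable _ _ _ _ n
  (fun l => in_gpart (hcomp_deg (ggr B) i (e l)))); last first.
  exact: koszul_projr.
move=> x; have [c xE] := span _ (gpart_deg x); exists c.
apply: val_inj; rewrite [RHS](lin_sum (@sub_incl_lin _ _ _ _ _)).
have hx : hcomp (ggr B) i (sub_incl x) = sub_incl x.
  by rewrite (hcomp_homog i (gpart_deg x)) eqxx.
rewrite [LHS](_ : _ = hcomp (ggr B) i (sub_incl x)) // xE.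
rewrite (lin_sum (hcomp_lin (ggr B) i)); apply: eq_bigr => l _.
by rewrite (linZ (hcomp_lin (ggr B) i)) [RHS](linZ (@sub_incl_lin _ _ _ _ _)).
Qed.

Lemma hcomp_mulr (i : int) (b : B) s :
  hcomp (ggr B) i (b * gincl B s) = hcomp (ggr B) i b * gincl B s.
Proof.
apply: (hcomp_nat (f := fun b => b * gincl B s)) => [x y|j x hx].
  by rewrite mulrDl.
by rewrite -[j]addr0; apply: ggrM => //; apply/gincl_im; exists s.
Qed.

(** [B] may have infinitely many nonzero components, so coordinates are only
    available on finitely many components at a time. *)
Lemma B_locally_dualizable : locally_dualizable (B_BS B).
Proof.
have part i : exists cs : seq (B * rform (B_BS B)), forall b : B,
    hcomp (ggr B) i b = \sum_(c <- cs) c.1 * gincl B (c.2 b).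
  have [i0|i0|->] := ltgtP i 0.
  - exists [::] => b; rewrite big_nil.
    by apply: ggr_pos i0 _; exact: hcomp_deg.
  - have [cs csE] := gpart_dualizable i0.
    pose pr b := in_gpart (hcomp_deg (ggr B) i b).
    have prl (f : rform (gpart B i)) (c : k) x y :
        f (pr (c *: x + y)) = c *: f (pr x) + f (pr y).
      by rewrite -rform_lin; congr (f _); apply: val_inj; rewrite /= hcomp_lin.
    have prr (f : rform (gpart B i)) (x : B) s : f (pr (x * gincl B s)) = f (pr x) * s.
      by rewrite -rform_ract; congr (f _); apply: val_inj; rewrite /= hcomp_mulr.
    exists [seq (sub_incl c.1,
                 @Rform _ _ _ (B_BS B) (fun b => c.2 (pr b)) (prl c.2) (prr c.2))
           | c : gpart B i * rform (gpart B i) <- cs] => b.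
    have := congr1 (@sub_incl _ _ _ _ _) (csE (pr b) I).
    by rewrite (lin_sum (@sub_incl_lin _ _ _ _ _)) big_map.
  - have augr (b : B) s : gaug B (b * gincl B s) = gaug B b * s.
      by rewrite rmorphM /= gaugK.
    have augl (c : k) (x y : B) : gaug B (c *: x + y) = c *: gaug B x + gaug B y.
      exact: linearP.
    exists [:: (1, @Rform _ _ _ (B_BS B) (gaug B) augl augr)] => b.
    by rewrite big_seq1 mul1r hcomp0E.
move=> s.
have [cs csE] : exists cs : seq (B * rform (B_BS B)), forall b : B, b \in s ->
    b = \sum_(c <- cs) c.1 * gincl B (c.2 b).
  pose q := undup (flatten [seq hsupp (ggr B) b | b <- s]).
  suff [cs csE] : exists cs : seq (B * rform (B_BS B)), forall b : B,
      \sum_(i <- q) hcomp (ggr B) i b = \sum_(c <- cs) c.1 * gincl B (c.2 b).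
    exists cs => b bs; rewrite -csE; apply: hcomp_sum_in => [|i ib].
      exact: undup_uniq.
    by rewrite mem_undup; apply/flatten_mapP; exists b.
  elim: q => [|i q [cs csE]]; first by exists [::] => b; rewrite !big_nil.
  have [cs' csE'] := part i; exists (cs' ++ cs) => b.
  by rewrite big_cons big_cat csE -csE'.
by exists cs => b bs; exact: csE.
Qed.
End KoszulCoordinates.
(** * Graded projectivity of the terms *)

Section Projectivity.
Context (k : fieldType).

Lemma bimor_base_left (C : algType k) (X Y : bimod k^o C) (f : X -> Y) :
  (forall (c : k) x y, f (c *: x + y) = c *: f x + f y) ->
  (forall x b, f (ract x b) = ract (f x) b) -> bimor f.
Proof. by move=> fl fr; split=> // a x; rewrite !lact_base (linZ fl). Qed.

Context (S : algType k) (B : gralg S).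

Definition right_mod (Q : gbimod (triv S) B) : gbimod (triv k^o) B :=
  gres (@gmorA_kunit k S (triv S)) (@gmorA_id k S B) Q.

(** A lift is prescribed by the images of the generators [x (x) 1], [x] running over
    the first components of a coordinate system of [N]. *)
Lemma gproj_coef (d : int) (N : bimod S S) : right_dualizable N ->
  gprojective (right_mod (gtens (gconc d N) (B_SB B))).
Proof.
move=> [cs csE] Y Z p g hp surj hg.
have /choice[y yP] : forall x : N, exists y : Y, gdeg Y d y /\
    p y = g (tpure (x : gconc d N) (1 : B_SB B)).
  move=> x.
  have [|y hy py] := @gmor_preim _ _ _ _ _ _ _ p hp surj d
      (g (tpure (x : gconc d N) (1 : B_SB B))); last by exists y.
  apply: (proj2 hg).
  have one0 : gdeg (B_SB B) 0 (1 : B) by apply/gincl_im; exists 1; rewrite rmorph1.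
  by have := tdeg_pure (or_introl erefl : gdeg (gconc d N) d x) one0; rewrite addr0.
pose f0 (x : gconc d N) (b : B_SB B) : Y :=
  \sum_(c <- cs) ract (y c.1) (gincl B (c.2 x) * (b : B)).
have f0b : balanced f0.
  split=> [x x' b|x b b'|x s b]; rewrite /f0 -?big_split; apply: eq_bigr => c _ /=.
  - by rewrite rformD linearD mulrDl ractDr.
  - by rewrite mulrDr ractDr.
  - by rewrite rform_ract rmorphM -mulrA.
have f0r x b b' : f0 x (b * b') = ract (f0 x b) b'.
  by rewrite /f0 ract_sum; apply: eq_bigr => c _; rewrite ractA mulrA.
exists (tlift f0); first split.
- apply: bimor_base_left => [c u v|u b].
    apply: (tlift_lin f0b) => a x b.
    rewrite /f0 scaler_sumr; apply: eq_bigr => c0 _.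
    by rewrite rformZ linearZ -scalerAl ractZr.
  elim/tens_ind: u => [|x b'|u v IH IH'].
  + by rewrite ract0 tlift0 // ract0.
  + by rewrite [ract _ _]ract_pure !tliftE //; exact: f0r.
  + by rewrite ractDl !tliftD // IH IH' ractDl.
- move=> n u; elim/tdeg_ind => [|i j x b <- hx hb|v w hv hw].
  + by rewrite tlift0 //; exact: deg0.
  + rewrite tliftE // /f0; elim/big_ind: _ => [|v w|c _].
    * exact: deg0.
    * exact: degD.
    case: (hx) => [->|->]; last first.
      have -> : c.2 0 = 0 by apply: (addIr (c.2 0)); rewrite -rformD !add0r.
      by rewrite linear0 mul0r ract0r; exact: deg0.
    apply: gdegr; first exact: (proj1 (yP _)).
    by rewrite -[j]add0r; apply: ggrM => //; apply/gincl_im; exists (c.2 x).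
  + by rewrite tliftD //; exact: degD.
- have [[gl _ gr] _] := hg; have [[pl _ pr] _] := hp.
  elim/tens_ind => [|x b|u v IH IH'].
  + by rewrite tlift0 // (lin0 pl) (lin0 gl).
  + rewrite tliftE // /f0 (lin_sum pl).
    have -> : tpure x b = \sum_(c <- cs)
        ract (tpure (c.1 : gconc d N) (1 : B_SB B) : gtens (gconc d N) (B_SB B))
          (gincl B (c.2 x) * (b : B)).
      rewrite {1}(csE x I) tpure_suml; apply: eq_bigr => c _.
      rewrite ract_pure; etransitivity; first exact: (@tpureA k S S B (gconc d N) (B_SB B)).
      congr (tpure _ _); change (gincl B (c.2 x) * b = 1 * (gincl B (c.2 x) * b)).
      by rewrite mul1r.
    rewrite [RHS](lin_sum gl); apply: eq_bigr => c _.
    rewrite pr (proj2 (yP c.1)); apply/esym; exact: gr.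
  + by rewrite tliftD // (linD pl) IH IH' (linD gl).
Qed.

Lemma gproj_reg : gprojective (right_mod (B_SB B)).
Proof.
move=> Y Z p g hp surj hg.
have one0 : gdeg (B_SB B) 0 (1 : B) by apply/gincl_im; exists 1; rewrite rmorph1.
have [y hy py] := gmor_preim hp surj (proj2 hg 0 (1 : B) one0).
exists (fun b => ract y (b : B)); first split.
- apply: bimor_base_left => [c u v|u b]; first exact: ractP.
  by rewrite ractA.
- by move=> n b hb; rewrite -[n]add0r; exact: gdegr.
- move=> b; have [[_ _ pr] _] := hp; have [[_ _ gr] _] := hg.
  rewrite pr py -gr; congr g; exact: mul1r.
Qed.

(** Over [k] the factor [S] is free of finite rank and sits in degree 0, so the
    tensor product is a finite direct sum of copies of [W]. *)
Lemma gproj_tens_S (W : gbimod (triv k^o) B) :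
  right_dualizable (S_kk S) -> gprojective W -> gprojective (gtens (S_kk S) W).
Proof.
move=> [cs csE] Wp Y Z p g hp surj hg.
have [[gl _ gr] gd] := hg; have [[pl _ pr] _] := hp.
have hgs s : gmor (fun w : W => g (tpure (s : S_kk S) w)).
  split; first apply: bimor_base_left => [c u v|u b].
  - by rewrite tpureDr tpureZr gl.
  - by rewrite -gr [in RHS]ract_pure.
  - move=> i w hw; apply: gd; rewrite -[i]add0r; apply: tdeg_pure => //; exact: or_introl.
have /choice[f fP] : forall s : S, exists f : W -> Y, gmor f /\
    forall w, p (f w) = g (tpure (s : S_kk S) w).
  move=> s; by have [f hf fE] := Wp _ _ p _ hp surj (hgs s); exists f.
pose phi (h : rform (S_kk S)) (s : S) : k := h s.
have phi_lin h (a : k) s s' : phi h (a *: s + s') = a * phi h s + phi h s'.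
  exact: (rform_lin h a s s').
pose f0 (s : S_kk S) (w : W) : Y := \sum_(c <- cs) phi c.2 s *: f c.1 w.
have f0b : balanced f0.
  apply: bilin_balanced => [c x x' y|c x y y'];
    rewrite /f0 scaler_sumr -big_split; apply: eq_bigr => c0 _ /=.
    by rewrite phi_lin scalerDl scalerA.
  rewrite [f c0.1 _](gmor_lin (proj1 (fP c0.1)) c y y') scalerDr !scalerA.
  by rewrite [c * _]mulrC.
exists (tlift f0); first split.
- apply: bimor_base_left => [c u v|u b].
    apply: (tlift_lin f0b) => a x b; rewrite /f0 scaler_sumr.
    by apply: eq_bigr => c0 _; rewrite (rformZ c0.2 a x : phi _ _ = a * _) scalerA.
  elim/tens_ind: u => [|x w|u v IH IH'].
  + by rewrite ract0 tlift0 // ract0.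
  + rewrite ract_pure !tliftE // /f0 ract_sum; apply: eq_bigr => c _.
    by rewrite ractZl (bimorr (proj1 (proj1 (fP _)))).
  + by rewrite ractDl !tliftD // IH IH' ractDl.
- move=> n u; elim/tdeg_ind => [|i j x w <- hx hw|v w hv hw].
  + by rewrite tlift0 //; exact: deg0.
  + rewrite tliftE // /f0; elim/big_ind: _ => [|v v'|c _].
    * exact: deg0.
    * exact: degD.
    case: (hx) => [->|->]; last first.
      have -> : phi c.2 0 = 0.
        have := phi_lin c.2 1 0 0; rewrite scaler0 addr0 mul1r -[LHS]addr0.
        by move=> /addrI.
      by rewrite scale0r; exact: deg0.
    by rewrite add0r; apply: degZ; exact: (proj2 (proj1 (fP _))).
  + by rewrite tliftD //; exact: degD.
- elim/tens_ind => [|x w|u v IH IH'].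
  + by rewrite tlift0 // (lin0 pl) (lin0 gl).
  + rewrite tliftE // /f0 (lin_sum pl).
    rewrite [in RHS](csE x I) tpure_suml (lin_sum gl); apply: eq_bigr => c _.
    by rewrite (linZ pl) (proj2 (fP c.1)) ract_base tpureZl (linZ gl).
  + by rewrite tliftD // (linD pl) IH IH' (linD gl).
Qed.

(** Induction [B (x) -] along [k -> B] is left adjoint to restriction. *)
Lemma gproj_induced (W : gbimod (triv k^o) B) :
  gprojective W -> gprojective (gtens (B_Bk B) W).
Proof.
move=> Wp Y Z p g hp surj hg.
pose res1 (V : gbimod B B) : gbimod (triv k^o) B :=
  gres (@gmorA_kunit k S B) (@gmorA_id k S B) V.
have [[gl ga gr] gd] := hg; have [[pl pa pr] pd] := hp.
have hp1 : gmor (X := res1 Y) (Y := res1 Z) p.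
  by split=> //; split=> // a x; exact: pa.
have one0 : gdeg (B_Bk B) 0 (1 : B) by apply/gincl_im; exists 1; rewrite rmorph1.
have hg1 : gmor (Y := res1 Z) (fun w : W => g (tpure (1 : B_Bk B) w)).
  split; first apply: bimor_base_left => [c u v|u b].
  - by rewrite tpureDr tpureZr gl.
  - by rewrite -[RHS]gr [in RHS]ract_pure.
  - by move=> i w hw; apply: gd; rewrite -[i]add0r; exact: tdeg_pure.
have [f [[fl _ fr] fd] fE] := Wp _ _ _ _ hp1 surj hg1.
pose f0 (b : B_Bk B) (w : W) : Y := @lact k B B Y (b : B) (f w).
have f0b : balanced f0.
  apply: bilin_balanced => [c x x' y|c x y y']; first exact: lactP.
  by rewrite /f0 fl; exact: lactD.
exists (tlift f0); first split.
- split=> [c u v|a u|u b].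
  + by apply: (tlift_lin f0b) => a x b; exact: lactZl.
  + elim/tens_ind: u => [|x w|u v IH IH'].
    * by rewrite lact0 tlift0 // lact0.
    * by rewrite lact_pure !tliftE // /f0 lactA.
    * by rewrite lactDr !tliftD // IH IH' lactDr.
  + elim/tens_ind: u => [|x w|u v IH IH'].
    * by rewrite ract0 tlift0 // ract0.
    * by rewrite ract_pure !tliftE // /f0 fr lractA.
    * by rewrite ractDl !tliftD // IH IH' ractDl.
- move=> n u; elim/tdeg_ind => [|i j x w <- hx hw|v w hv hw].
  + by rewrite tlift0 //; exact: deg0.
  + by rewrite tliftE //; apply: gdegl => //; exact: fd.
  + by rewrite tliftD //; exact: degD.
- elim/tens_ind => [|x w|u v IH IH'].
  + by rewrite tlift0 // (lin0 pl) (lin0 gl).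
  + rewrite tliftE // /f0 pa fE -ga lact_pure; congr (g (tpure _ _)).
    exact: mulr1.
  + by rewrite tliftD // (linD pl) IH IH' (linD gl).
Qed.

Lemma gproj_bar (Q : gbimod (triv S) B) n :
  right_dualizable (S_kk S) -> gprojective (right_mod Q) -> gprojective (bar Q n).
Proof.
move=> Sd Qp; apply: gproj_induced; elim: n => // n IH.
exact: gproj_tens_S.
Qed.

Lemma gproj_sum (S1 S2 : algType k) (A : gralg S1) (C : gralg S2) (X X' : gbimod A C) :
  gprojective X -> gprojective X' -> gprojective (gsum X X').
Proof.
move=> Xp Xp' Y Z p g hp surj hg.
have [[gl ga gr] gd] := hg.
have h1 : gmor (fun x : X => g ((x, 0) : gsum X X')).
  split; last by move=> i x hx; apply: gd; split=> //; exact: deg0.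
  split=> [c x y|a x|x a].
  - by rewrite -gl; congr g; congr (_, _); rewrite /= scaler0 addr0.
  - by rewrite -ga; congr g; congr (_, _); rewrite /= lact0.
  - by rewrite -gr; congr g; congr (_, _); rewrite /= ract0.
have h2 : gmor (fun x : X' => g ((0, x) : gsum X X')).
  split; last by move=> i x hx; apply: gd; split=> //; exact: deg0.
  split=> [c x y|a x|x a].
  - by rewrite -gl; congr g; congr (_, _); rewrite /= scaler0 addr0.
  - by rewrite -ga; congr g; congr (_, _); rewrite /= lact0.
  - by rewrite -gr; congr g; congr (_, _); rewrite /= ract0.
have [f1 [[l1 a1 r1] d1] f1E] := Xp _ _ _ _ hp surj h1.
have [f2 [[l2 a2 r2] d2] f2E] := Xp' _ _ _ _ hp surj h2.
exists (fun u => f1 u.1 + f2 u.2); first split.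
- split=> [c x y|a x|x a].
  + by rewrite l1 l2 scalerDr addrACA.
  + by rewrite a1 a2 lactDr.
  + by rewrite r1 r2 ractDl.
- by move=> i u [hu hu']; apply: degD; [exact: d1|exact: d2].
- move=> [x x']; rewrite (gmorD hp) /= f1E f2E -(linD gl); congr g.
  by congr (_, _); rewrite /= ?addr0 ?add0r.
Qed.
End Projectivity.
(** * The bar resolution *)

Section BarResolution.
Context (k : fieldType) (S : algType k) (B : gralg S) (Q : gbimod (triv S) B).
Local Notation barW := (barW Q).
Local Notation bar := (bar Q).

Let dWD n := linD (@barW_d_lin k S B Q n).
Let dWN n := linN (@barW_d_lin k S B Q n).
Let dW0 n := lin0 (@barW_d_lin k S B Q n).
Let sWD n s := linD (@barW_slide_linr k S B Q n s).
Let sWN n s := linN (@barW_slide_linr k S B Q n s).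
Let sW0 n s := lin0 (@barW_slide_linr k S B Q n s).
Let sBD n b := linD (@bar_slide_linr k S B Q n b).
Let sBN n b := linN (@bar_slide_linr k S B Q n b).
Let sB0 n b := lin0 (@bar_slide_linr k S B Q n b).

Lemma barW_dP n (s : S) (v : barW n.+1) :
  barW_d (tpure (s : S_kk S) v : barW n.+2) =
    barW_slide s v - tpure (s : S_kk S) (barW_d v).
Proof. exact: (tliftE _ _ (barW_d_bal Q n)). Qed.
Lemma barW_d0P (s : S) (q : Q) :
  barW_d (tpure (s : S_kk S) (q : barW 0) : barW 1) = @lact k S B Q s q.
Proof. exact: (tliftE _ _ (barW_d0_bal Q)). Qed.
Lemma bar_dP n (b : B) (w : barW n.+1) :
  bar_d (tpure (b : B_Bk B) w : bar n.+1) = bar_slide b w - tpure (b : B_Bk B) (barW_d w).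
Proof. exact: (tliftE _ _ (bar_d_bal Q n)). Qed.

Lemma bar_d_lin n (c : k) (u v : bar n.+1) :
  bar_d (c *: u + v) = c *: bar_d u + bar_d v.
Proof.
apply: (tlift_lin (bar_d_bal Q n)) => a b w.
by rewrite tpureZl scalerBr (linZ (fun c x y => bar_slide_linl c x y w)).
Qed.

Let dBD n := linD (@bar_d_lin n).
Let dBN n := linN (@bar_d_lin n).
Let dB0 n := lin0 (@bar_d_lin n).

Lemma barW_d_slide n (s : S) (w : barW n.+2) :
  barW_d (barW_slide s w) = barW_slide s (barW_d w).
Proof.
elim/tens_ind: w => [|t v|v w IH IH'].
- by rewrite !(dW0, sW0).
- rewrite barW_slideE !barW_dP sWD.
  rewrite sWN barW_slideE; congr (_ - _).
  elim/tens_ind: v => [|t' v|v w IH IH'].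
  + by rewrite !sW0.
  + by rewrite !barW_slideE mulrA.
  + by rewrite !sWD IH IH'.
- by rewrite !(dWD,
    sWD) IH IH'.
Qed.

Lemma barW_d_slide0 (s : S) (w : barW 1) :
  barW_d (barW_slide s w) = @lact k S B Q s (barW_d w).
Proof.
elim/tens_ind: w => [|t v|v w IH IH'].
- rewrite sW0.
  by rewrite dW0 lact0.
- by rewrite barW_slideE !barW_d0P lactA.
- rewrite sWD.
  by rewrite !dWD IH IH' lactDr.
Qed.

(** [barW_d] commutes with multiplication into the first factor, so in
    [barW_d (barW_d (s (x) v))] all terms but [s (x) barW_d (barW_d v)] cancel. *)
Lemma barW_dd n (w : barW n.+2) : barW_d (barW_d w) = 0.
Proof.
elim: n w => [|n IHn] w.
  elim/tens_ind: w => [|s v|v w IH IH'].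
  - by rewrite !dW0.
  - rewrite barW_dP dWD.
    by rewrite dWN barW_d_slide0 barW_d0P subrr.
  - by rewrite !dWD IH IH' addr0.
elim/tens_ind: w => [|s v|v w IH IH'].
- by rewrite !dW0.
- rewrite barW_dP dWD.
  rewrite dWN barW_d_slide barW_dP IHn.
  by rewrite tpure0r subr0 subrr.
- by rewrite !dWD IH IH' addr0.
Qed.

(** [w |-> 1 (x) w] is a contracting homotopy of the [k]-linear bar complex. *)
Lemma barW_exact n (w : barW n.+1) : barW_d w = 0 -> exists v, barW_d v = w.
Proof.
move=> dw; exists (tpure (1 : S_kk S) w).
rewrite barW_dP dw tpure0r subr0; elim/tens_ind: w {dw} => [|s v|v w IH IH'].
- by rewrite sW0.
- by rewrite barW_slideE mul1r.
- by rewrite sWD IH IH'.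
Qed.

Lemma barW_slide_ract n s (w : barW n.+1) b :
  barW_slide s (ract w b) = ract (barW_slide s w) b.
Proof.
elim/tens_ind: w => [|t v|v w IH IH'].
- by rewrite ract0 sW0 ract0.
- by rewrite barW_slideE !ract_pure barW_slideE.
- by rewrite ractDl !sWD IH IH' ractDl.
Qed.
Lemma barW_d_ract n (w : barW n.+1) b : barW_d (ract w b) = ract (barW_d w) b.
Proof.
elim: n w => [|n IHn] w; elim/tens_ind: w => [|t v|v w IH IH'].
- by rewrite ract0 dW0 ract0.
- by rewrite ract_pure !barW_d0P; exact: (esym (@lractA k S B Q t v b)).
- by rewrite ractDl !dWD IH IH' ractDl.
- by rewrite ract0 dW0 ract0.
- by rewrite ract_pure !barW_dP barW_slide_ract IHn ractDl -!scaleN1r ractZl ract_pure.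
- by rewrite ractDl !dWD IH IH' ractDl.
Qed.
Lemma bar_slide_ract n b (w : barW n.+1) a :
  bar_slide b (ract w a) = ract (bar_slide b w) a.
Proof.
elim/tens_ind: w => [|t v|v w IH IH'].
- by rewrite ract0 sB0 ract0.
- by rewrite bar_slideE !ract_pure bar_slideE.
- by rewrite ractDl !sBD IH IH' ractDl.
Qed.
Lemma bar_slide_lact n a b (w : barW n.+1) :
  bar_slide (a * b) w = lact a (bar_slide b w).
Proof.
elim/tens_ind: w => [|t v|v w IH IH'].
- by rewrite !sB0 lact0.
- by rewrite !bar_slideE lact_pure -mulrA.
- by rewrite !sBD IH IH' lactDr.
Qed.

Lemma S_kk_mul_deg i (s t : S) : gdeg (S_kk S) i t -> gdeg (S_kk S) i (s * t : S).
Proof. by case=> [->|->]; [left|right; rewrite mulr0]. Qed.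

Lemma barW_slide_deg n i s (w : barW n.+1) :
  gdeg (barW n.+1) i w -> gdeg (barW n.+1) i (barW_slide s w).
Proof.
elim/tdeg_ind => [|j l t v <- ht hv|v w' hv hw].
- by rewrite sW0; exact: deg0.
- by rewrite barW_slideE; apply: tdeg_pure => //; exact: S_kk_mul_deg.
- by rewrite sWD; exact: degD.
Qed.
Lemma barW_d_deg n i (w : barW n.+1) :
  gdeg (barW n.+1) i w -> gdeg (barW n) i (barW_d w).
Proof.
elim: n i w => [|n IHn] i w; elim/tdeg_ind => [|j l t v <- ht hv|v w' hv hw].
- by rewrite dW0; exact: deg0.
- by rewrite barW_d0P; exact: (@gdegl k S S (triv S) B Q).
- by rewrite dWD; exact: degD.
- by rewrite dW0; exact: deg0.
- rewrite barW_dP; apply: degB.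
    case: ht => [->|->]; first by rewrite add0r; exact: barW_slide_deg.
    rewrite (lin0 (fun c x y => barW_slide_linl c x y v)); exact: deg0.
  by apply: tdeg_pure => //; exact: IHn.
- by rewrite dWD; exact: degD.
Qed.
Lemma bar_slide_deg n i j (b : B) (w : barW n.+1) : ggr B i b ->
  gdeg (barW n.+1) j w -> gdeg (bar n) (i + j) (bar_slide b w).
Proof.
move=> hb; elim/tdeg_ind => [|j' l t v <- ht hv|v w' hv hw].
- by rewrite sB0; exact: deg0.
- rewrite bar_slideE addrA; apply: tdeg_pure => //; apply: ggrM => //.
  exact: (@gmorA_incl k S B).
- by rewrite sBD; exact: degD.
Qed.

Lemma gmor_bar_d n : gmor (@bar_d k S B Q n).
Proof.
split; first split; first exact: bar_d_lin.
- move=> a; elim/tens_ind => [|b w|u v IH IH'].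
  + by rewrite lact0 dB0 lact0.
  + by rewrite lact_pure !bar_dP lactDr -!scaleN1r lactZr lact_pure -bar_slide_lact.
  + by rewrite lactDr !dBD IH IH' lactDr.
- move=> u a; elim/tens_ind: u => [|b w|u v IH IH'].
  + by rewrite ract0 dB0 ract0.
  + rewrite ract_pure !bar_dP bar_slide_ract barW_d_ract ractDl -!scaleN1r.
    by rewrite ractZl ract_pure.
  + by rewrite ractDl !dBD IH IH' ractDl.
- move=> i u; elim/tdeg_ind => [|j l b w <- hb hw|u' v hu hv].
  + by rewrite dB0; exact: deg0.
  + rewrite bar_dP; apply: degB; first exact: bar_slide_deg.
    by apply: tdeg_pure => //; exact: barW_d_deg.
  + by rewrite dBD; exact: degD.
Qed.

Lemma bar_d_slide n (b : B) (w : barW n.+2) :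
  bar_d (bar_slide b w) = bar_slide b (barW_d w).
Proof.
elim/tens_ind: w => [|t v|v w IH IH'].
- by rewrite !(dB0, dW0,
    sB0).
- rewrite bar_slideE bar_dP barW_dP sBD.
  rewrite sBN bar_slideE; congr (_ - _).
  elim/tens_ind: v => [|t' v|v w IH IH'].
  + rewrite !sW0.
    by rewrite !sB0.
  + by rewrite barW_slideE !bar_slideE rmorphM mulrA.
  + rewrite !sWD.
    by rewrite !sBD IH IH'.
- by rewrite !(dBD, dWD,
    sBD) IH IH'.
Qed.

Lemma bar_dd n (u : bar n.+2) : bar_d (bar_d u) = 0.
Proof.
elim/tens_ind: u => [|b w|u v IH IH'].
- by rewrite !dB0.
- rewrite bar_dP dBD dBN.
  by rewrite bar_d_slide bar_dP barW_dd tpure0r subr0 subrr.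
- by rewrite !dBD IH IH' addr0.
Qed.

Lemma bar_aug_bal : balanced (fun (b : B_Bk B) (q : barW 0) =>
  tpure (b : B_BS B) (q : Q) : gtens (B_BS B) Q).
Proof.
apply: bilin_balanced => [c x x' y|c x y y'].
  by rewrite -tpureZl -tpureDl.
by rewrite -tpureZr -tpureDr.
Qed.
Lemma bar_augD (u v : bar 0) : bar_aug (u + v) = bar_aug u + bar_aug v.
Proof. exact/tliftD/bar_aug_bal. Qed.
Lemma bar_aug0 : bar_aug (0 : bar 0) = 0.
Proof. exact/tlift0/bar_aug_bal. Qed.
Lemma bar_augN (u : bar 0) : bar_aug (- u) = - bar_aug u.
Proof. by apply/eqP; rewrite -addr_eq0 -bar_augD addNr bar_aug0. Qed.

Lemma bar_aug_surj (t : gtens (B_BS B) Q) : exists u : bar 0, bar_aug u = t.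
Proof.
elim/tens_ind: t => [|b q|u v [u' uE] [v' vE]].
- by exists 0; exact: bar_aug0.
- by exists (tpure (b : B_Bk B) (q : barW 0)); exact: bar_augE.
- by exists (u' + v'); rewrite bar_augD uE vE.
Qed.

Lemma bar_aug_slide (b : B) (w : barW 1) :
  bar_aug (bar_slide b w) = tpure (b : B_BS B) (barW_d w : Q).
Proof.
elim/tens_ind: w => [|t q|v w IH IH'].
- rewrite dW0 sB0.
  by rewrite bar_aug0 tpure0r.
- rewrite bar_slideE bar_augE barW_d0P; exact: (@tpureA k B S B (B_BS B) Q b t q).
- rewrite dWD sBD.
  by rewrite bar_augD IH IH' tpureDr.
Qed.

Lemma bar_aug_d (u : bar 1) : bar_aug (bar_d u) = 0.
Proof.
elim/tens_ind: u => [|b w|u v IH IH'].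
- by rewrite dB0 bar_aug0.
- by rewrite bar_dP bar_augD bar_augN bar_aug_slide bar_augE subrr.
- by rewrite dBD bar_augD IH IH' addr0.
Qed.

(** A right [S]-linear form on [B] turns the bar complex of [B] into that of [S],
    which is contractible; [bar_slide] goes back. *)
Section Form.
Context (f : rform (B_BS B)).

Lemma bar_form_bal n : balanced (fun (b : B_Bk B) (w : barW n) =>
  tpure (f b : S_kk S) w : barW n.+1).
Proof.
apply: bilin_balanced => [c x x' y|c x y y'].
  by rewrite (rform_lin f c x x') -tpureZl -tpureDl.
by rewrite -tpureZr -tpureDr.
Qed.
Definition bar_form n : bar n -> barW n.+1 :=
  tlift (fun (b : B_Bk B) (w : barW n) => tpure (f b : S_kk S) w : barW n.+1).
Lemma bar_formP n (b : B) (w : barW n) :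
  bar_form (tpure (b : B_Bk B) w) = tpure (f b : S_kk S) w.
Proof. exact/tliftE/bar_form_bal. Qed.
Lemma bar_formD n (u v : bar n) : bar_form (u + v) = bar_form u + bar_form v.
Proof. exact/tliftD/bar_form_bal. Qed.
Lemma bar_form0 n : bar_form (0 : bar n) = 0.
Proof. exact/tlift0/bar_form_bal. Qed.
Lemma bar_formN n (u : bar n) : bar_form (- u) = - bar_form u.
Proof. by apply/eqP; rewrite -addr_eq0 -bar_formD addNr bar_form0. Qed.

Lemma bar_form_slide n (b : B) (w : barW n.+1) :
  bar_form (bar_slide b w) = barW_slide (f b) w.
Proof.
elim/tens_ind: w => [|t v|v w IH IH'].
- rewrite sB0 bar_form0.
  by rewrite sW0.
- by rewrite bar_slideE bar_formP barW_slideE (rform_ract f b t).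
- rewrite sBD bar_formD IH IH'.
  by rewrite sWD.
Qed.

Lemma bar_form_d n (u : bar n.+1) : bar_form (bar_d u) = barW_d (bar_form u).
Proof.
elim/tens_ind: u => [|b w|u v IH IH'].
- by rewrite dB0 !bar_form0 dW0.
- by rewrite bar_dP bar_formD bar_formN !bar_formP bar_form_slide barW_dP.
- by rewrite dBD !bar_formD IH IH' dWD.
Qed.

Lemma bar_form_aug (u : bar 0) :
  @contract k B S B (B_BS B) Q f (bar_aug u) = barW_d (bar_form u).
Proof.
elim/tens_ind: u => [|b w|u v IH IH'].
- by rewrite bar_form0 dW0 bar_aug0 contract0.
- by rewrite bar_augE contract_pure bar_formP barW_d0P.
- by rewrite bar_formD dWD bar_augD contractD IH IH'.
Qed.
End Form.

Context (Bd : locally_dualizable (B_BS B)).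

Lemma bar_slide_formD n (b : B) (f : rform (B_BS B)) (u v : bar n) :
  bar_slide b (bar_form f (u + v)) =
    bar_slide b (bar_form f u) + bar_slide b (bar_form f v).
Proof. by rewrite bar_formD sBD. Qed.

(** The contracted bar complex is a retract of the original one on each finite set
    of elements, which is all that exactness needs. *)
Lemma bar_coords n (u : bar n) : exists cs : seq (B * rform (B_BS B)),
  u = \sum_(c <- cs) bar_slide c.1 (bar_form c.2 u).
Proof.
have [cs csE] : exists cs : seq (B * rform (B_BS B)), forall b : B,
    b \in [seq (q.1 : B) | q <- repr u] ->
    b = \sum_(c <- cs) c.1 * gincl B (c.2 b) := Bd _.
exists cs; rewrite -{1}[u]tcl_repr tclE.
have -> : \sum_(c <- cs) bar_slide c.1 (bar_form c.2 u) =
    \sum_(c <- cs) bar_slide c.1 (bar_form c.2 (tcl (repr u) : bar n)).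
  by rewrite tcl_repr.
rewrite tclE.
elim: (repr u) csE => [|[x y] s IH] csE.
  rewrite big_nil big1 // => c _.
  by rewrite bar_form0 sB0.
rewrite big_cons; set u1 := tpure _ _; set u2 := \sum_(q <- s) _.
have e1 : u1 = \sum_(c <- cs) bar_slide c.1 (bar_form c.2 (u1 : bar n)).
  rewrite {1}/u1 (csE x (mem_head _ _)) [LHS]tpure_suml; apply: eq_bigr => c _.
  by rewrite bar_formP bar_slideE.
have e2 : u2 = \sum_(c <- cs) bar_slide c.1 (bar_form c.2 (u2 : bar n)).
  by apply: IH => b bs; apply: csE; rewrite inE bs orbT.
rewrite {1}e1 {1}e2 -big_split; apply: eq_bigr => c _.
exact/esym/bar_slide_formD.
Qed.

Lemma bar_exact n (u : bar n.+1) : bar_d u = 0 -> exists v, bar_d v = u.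
Proof.
move=> du; have [cs ->] := bar_coords u; elim: cs => [|c cs [v vE]].
  by exists 0; rewrite dB0 big_nil.
have [w wE] : exists w, barW_d w = bar_form c.2 u.
  by apply: barW_exact; rewrite -bar_form_d du bar_form0.
exists (bar_slide c.1 w + v); rewrite dBD vE big_cons.
by rewrite bar_d_slide wE.
Qed.

Lemma bar_aug_exact (u : bar 0) : bar_aug u = 0 -> exists v, bar_d v = u.
Proof.
move=> du; have [cs ->] := bar_coords u; elim: cs => [|c cs [v vE]].
  by exists 0; rewrite dB0 big_nil.
have [w wE] : exists w, barW_d w = bar_form c.2 u.
  by apply: barW_exact; rewrite -bar_form_aug du contract0.
exists (bar_slide c.1 w + v); rewrite dBD vE big_cons.
by rewrite bar_d_slide wE.
Qed.
End BarResolution.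
(** * The right Koszul complex of a quadratic algebra *)

Section TensorAlgebraInduction.
Context (k : fieldType) (S : algType k) (M : bimod S S).
Local Notation T := (talg M).

Lemma talg_sum_tin (t : T) : t = \sum_(n < tbound t) tin (t n).
Proof. exact/esym/(@mulr1 T t). Qed.

Lemma tscalar0 : tscalar M 0 = 0.
Proof. exact: tact0l. Qed.

(** [T] is spanned by words, and a nonempty word is a letter shifted onto a shorter
    word. *)
Lemma talg_ind (P : T -> Prop) :
  (forall s, P (tscalar M s)) -> (forall x t, P t -> P (shift x t)) ->
  (forall t u, P t -> P u -> P (t + u)) -> forall t, P t.
Proof.
move=> Ps Px PD; have P0 : P 0 by rewrite -tscalar0; exact: Ps.
have Pin n (v : tpow M n) : P (tin v).
  elim: n v => [|n IHn] v; first exact: Ps.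
  elim/tpow_ind: v => [|x v|v w IH IH'].
  - by rewrite /tin tact0l.
  - by rewrite /tin tact_pure; exact/Px/IHn.
  - by rewrite /tin tactDl; exact: PD.
by move=> t; rewrite [t]talg_sum_tin; elim/big_ind: _ => // n _; exact: Pin.
Qed.

Lemma tscalarM s t : tscalar M s * tscalar M t = tscalar M (s * t).
Proof. by rewrite tin_mult; apply: talg_eq => n /=; rewrite lactA. Qed.
End TensorAlgebraInduction.

Section RightKoszul.
Context (k : fieldType) (S : algType k) (M : bimod S S).
Context (R : subbimod (tens M M)) (B : gralg S) (p : {lrmorphism talg M -> B}).
Context (hp : quad_presentation R p).
Local Notation T := (talg M).
Local Notation coefM := (Defs.coefM B M).
Local Notation coefR := (coefR B R).
Local Notation B_SB := (B_SB B).

Definition letter (x : M) : B := p (tgen x).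

Lemma letterD x y : letter (x + y) = letter x + letter y.
Proof. by rewrite /letter tgenD linearD. Qed.
Lemma letterl s x : letter (lact s x) = gincl B s * letter x.
Proof. by rewrite /letter tgen_lact rmorphM; congr (_ * _); exact: (qp_scalar hp). Qed.
Lemma letterr x s : letter (ract x s) = letter x * gincl B s.
Proof. by rewrite /letter tgen_ract rmorphM; congr (_ * _); exact: (qp_scalar hp). Qed.
Lemma letterZ (c : k) x : letter (c *: x) = c *: letter x.
Proof. by rewrite /letter !tgenE shiftZl linearZ. Qed.
Lemma letter_deg x : ggr B 1 (letter x).
Proof. by apply/(qp_deg hp 1); exists (tgen x) => // m m1; exact: tin_neq. Qed.
Lemma gaug_letter x : gaug B (letter x) = 0.
Proof. exact: gaug_pos (letter_deg x). Qed.
Lemma gaugM (b b' : B) : gaug B (b * b') = gaug B b * gaug B b'.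
Proof. exact: rmorphM. Qed.
Lemma pM t u : p (t * u) = p t * p u.
Proof. exact: rmorphM. Qed.
Lemma pD t u : p (t + u) = p t + p u.
Proof. exact: linearD. Qed.
Lemma gaugD (b b' : B) : gaug B (b + b') = gaug B b + gaug B b'.
Proof. exact: linearD. Qed.
Lemma ginclD (s s' : S) : gincl B (s + s') = gincl B s + gincl B s'.
Proof. exact: linearD. Qed.
Lemma p_shift x t : p (shift x t) = letter x * p t.
Proof. by rewrite -tgen_mult rmorphM. Qed.

Lemma koszul1_bal : balanced (fun (x : gconc 1 M) (b : B_SB) => letter x * (b : B)).
Proof.
split=> [x x' b|x b b'|x s b].
- by rewrite letterD mulrDl.
- by rewrite mulrDr.
- by rewrite letterr -mulrA.
Qed.
(** [koszul2] and [koszul1] continue the augmentation to the complex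
    [R (x)_S B -> M (x)_S B -> B -> S] of right [B]-modules. *)
Definition koszul1 : coefM -> B_SB :=
  tlift (fun (x : gconc 1 M) (b : B_SB) => letter x * (b : B)).
Lemma koszul1P (x : M) (b : B) : koszul1 (tpure (x : gconc 1 M) (b : B_SB)) = letter x * b.
Proof. exact/tliftE/koszul1_bal. Qed.
Lemma koszul1D u v : koszul1 (u + v) = koszul1 u + koszul1 v.
Proof. exact/tliftD/koszul1_bal. Qed.
Lemma koszul10 : koszul1 0 = 0.
Proof. exact/tlift0/koszul1_bal. Qed.

Definition koszul2_in (t : tens M M) (b : B) : coefM :=
  tlift (fun x y => tpure (x : gconc 1 M) (letter y * b : B_SB) : coefM) t.
Lemma koszul2_in_bal b :
  balanced (fun x y : M => tpure (x : gconc 1 M) (letter y * b : B_SB) : coefM).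
Proof.
split=> [x x' y|x y y'|x s y].
- exact: (@tpureDl _ _ _ _ (gconc 1 M)).
- by rewrite letterD mulrDl tpureDr.
- rewrite letterl -mulrA; exact: (@tpureA k S S B (gconc 1 M) B_SB x s (letter y * b)).
Qed.
Lemma koszul2_inP x y b :
  koszul2_in (tpure x y) b = tpure (x : gconc 1 M) (letter y * b : B_SB).
Proof. exact/tliftE/koszul2_in_bal. Qed.
Lemma koszul2_inDl t u b : koszul2_in (t + u) b = koszul2_in t b + koszul2_in u b.
Proof. exact/tliftD/koszul2_in_bal. Qed.
Lemma koszul2_in0 b : koszul2_in 0 b = 0.
Proof. exact/tlift0/koszul2_in_bal. Qed.
Lemma koszul2_inZl (c : k) t b : koszul2_in (c *: t) b = c *: koszul2_in t b.
Proof.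
elim/tens_ind: t => [|x y|t u IH IH'].
- by rewrite scaler0 !koszul2_in0 scaler0.
- by rewrite -tpureZl !koszul2_inP; exact: (@tpureZl _ _ _ _ (gconc 1 M)).
- by rewrite scalerDr !koszul2_inDl IH IH' scalerDr.
Qed.
Lemma koszul2_inDr t b b' : koszul2_in t (b + b') = koszul2_in t b + koszul2_in t b'.
Proof.
elim/tens_ind: t => [|x y|t u IH IH'].
- by rewrite !koszul2_in0 addr0.
- by rewrite !koszul2_inP mulrDr tpureDr.
- by rewrite !koszul2_inDl IH IH' addrACA.
Qed.
Lemma koszul2_inl s t b : koszul2_in (lact s t) b = lact s (koszul2_in t b).
Proof.
elim/tens_ind: t => [|x y|t u IH IH'].
- by rewrite lact0 !koszul2_in0 lact0.
- by rewrite lact_pure !koszul2_inP; exact/esym/(@lact_pure k S S B (gconc 1 M) B_SB).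
- by rewrite lactDr !koszul2_inDl IH IH' lactDr.
Qed.
Lemma koszul2_inr t s b : koszul2_in (ract t s) b = koszul2_in t (gincl B s * b).
Proof.
elim/tens_ind: t => [|x y|t u IH IH'].
- by rewrite ract0 !koszul2_in0.
- by rewrite ract_pure !koszul2_inP letterr mulrA.
- by rewrite ractDl !koszul2_inDl IH IH'.
Qed.
Lemma koszul2_in_ract t b b' : koszul2_in t (b * b') = ract (koszul2_in t b) b'.
Proof.
elim/tens_ind: t => [|x y|t u IH IH'].
- by rewrite !koszul2_in0 ract0.
- by rewrite !koszul2_inP mulrA; exact/esym/(@ract_pure k S S B (gconc 1 M) B_SB).
- by rewrite !koszul2_inDl IH IH' ractDl.
Qed.
Lemma koszul2_in_deg t b i : ggr B i b -> gdeg coefM (2 + i) (koszul2_in t b).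
Proof.
move=> hb; elim/tens_ind: t => [|x y|t u IH IH'].
- by rewrite koszul2_in0; exact: deg0.
- rewrite koszul2_inP (_ : 2 + i = 1 + (1 + i)); last by rewrite addrA.
  apply: (@tdeg_pure k S S S (triv S) B (gconc 1 M) B_SB); first by left.
  exact: ggrM (letter_deg y) hb.
- by rewrite koszul2_inDl; exact: degD.
Qed.

Lemma koszul2_bal : balanced (fun (r : gconc 2 (sub_bimod R)) (b : B_SB) =>
  koszul2_in (sub_incl r) b).
Proof.
split=> [r r' b|r b b'|r s b].
- by rewrite -koszul2_inDl.
- exact: koszul2_inDr.
- exact: koszul2_inr.
Qed.
Definition koszul2 : coefR -> coefM :=
  tlift (fun (r : gconc 2 (sub_bimod R)) (b : B_SB) => koszul2_in (sub_incl r) b).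
Lemma koszul2P (r : sub_bimod R) (b : B) :
  koszul2 (tpure (r : gconc 2 (sub_bimod R)) (b : B_SB)) = koszul2_in (sub_incl r) b.
Proof. exact/tliftE/koszul2_bal. Qed.
Lemma koszul2D u v : koszul2 (u + v) = koszul2 u + koszul2 v.
Proof. exact/tliftD/koszul2_bal. Qed.
Lemma koszul20 : koszul2 0 = 0.
Proof. exact/tlift0/koszul2_bal. Qed.

Lemma gmor_koszul1 : gmor koszul1.
Proof.
split; first split.
- apply: (tlift_lin koszul1_bal) => c x b.
  by rewrite letterZ scalerAl.
- move=> s; elim/tens_ind => [|x b|u v IH IH'].
  + by rewrite lact0 koszul10 lact0.
  + by rewrite lact_pure !koszul1P letterl -mulrA.
  + by rewrite lactDr !koszul1D IH IH' lactDr.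
- move=> u b; elim/tens_ind: u => [|x b'|u v IH IH'].
  + by rewrite ract0 koszul10 ract0.
  + by rewrite ract_pure !koszul1P mulrA.
  + by rewrite ractDl !koszul1D IH IH' ractDl.
- move=> n u; elim/tdeg_ind => [|i j x b <- hx hb|v w hv hw].
  + by rewrite koszul10; exact: deg0.
  + rewrite koszul1P; case: hx => [->|->]; first exact: ggrM (letter_deg x) hb.
    by rewrite -(scale0r (0 : M)) letterZ scale0r mul0r; exact: deg0.
  + by rewrite koszul1D; exact: degD.
Qed.

Lemma gmor_koszul2 : gmor koszul2.
Proof.
split; first split.
- by apply: (tlift_lin koszul2_bal) => c r b; rewrite -koszul2_inZl.
- move=> s; elim/tens_ind => [|r b|u v IH IH'].
  + by rewrite lact0 koszul20 lact0.
  + by rewrite lact_pure !koszul2P -koszul2_inl.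
  + by rewrite lactDr !koszul2D IH IH' lactDr.
- move=> u b; elim/tens_ind: u => [|r b'|u v IH IH'].
  + by rewrite ract0 koszul20 ract0.
  + by rewrite ract_pure !koszul2P -koszul2_in_ract.
  + by rewrite ractDl !koszul2D IH IH' ractDl.
- move=> n u; elim/tdeg_ind => [|i j r b <- hr hb|v w hv hw].
  + by rewrite koszul20; exact: deg0.
  + rewrite koszul2P; case: hr => [->|->]; first exact: koszul2_in_deg.
    by rewrite [sub_incl 0](raddf0 val) koszul2_in0; exact: deg0.
  + by rewrite koszul2D; exact: degD.
Qed.

Lemma koszul1_koszul2_in t b : koszul1 (koszul2_in t b) = p (tgen2 t) * b.
Proof.
elim/tens_ind: t => [|x y|t u IH IH'].
- by rewrite koszul2_in0 koszul10 /tgen2 tlift0 ?linear0 ?mul0r //; exact: tgen2_bal.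
- by rewrite koszul2_inP koszul1P tgen2E rmorphM mulrA.
- rewrite koszul2_inDl koszul1D IH IH' /tgen2 tliftD ?linearD ?mulrDl //.
  exact: tgen2_bal.
Qed.

Lemma p_relation t : R t -> p (tgen2 t) = 0.
Proof.
by move=> Rt; apply/(qp_ker hp) => I _ _ _; apply; exists t.
Qed.
Lemma sub_inclP (r : sub_bimod R) : R (sub_incl r).
Proof. by case: r => r /= /asboolP. Qed.

Lemma koszul1_koszul2 u : koszul1 (koszul2 u) = 0.
Proof.
elim/tens_ind: u => [|r b|u v IH IH'].
- by rewrite koszul20 koszul10.
- by rewrite koszul2P koszul1_koszul2_in p_relation ?mul0r //; exact: sub_inclP.
- by rewrite koszul2D koszul1D IH IH' addr0.
Qed.

(** [unshift] splits the first letter off each word and applies [p] to the rest.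
    The ideal [(R)] is [R T + M (R)]; the second summand is killed by [p] once its
    first letter is split off, and the first one goes to the image of [koszul2].
    This is the content of exactness at [M (x)_S B]. *)
Definition unshift_in n : tpow M n -> coefM :=
  match n return tpow M n -> coefM with
  | 0 => fun _ => 0
  | m.+1 => tlift (fun (x : M) (v : tpow M m) =>
              tpure (x : gconc 1 M) (p (tin v) : B_SB) : coefM)
  end.
Lemma unshift_in_bal m : balanced (fun (x : M) (v : tpow M m) =>
  tpure (x : gconc 1 M) (p (tin v) : B_SB) : coefM).
Proof.
split=> [x x' v|x v v'|x s v].
- exact: (@tpureDl _ _ _ _ (gconc 1 M)).
- by rewrite /tin tactDl linearD tpureDr.
- have -> : p (tin (lact s v)) = gincl B s * p (tin v).
    by rewrite /tin tact_lact -(qp_scalar hp) -rmorphM tin_mult.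
  exact: (@tpureA k S S B (gconc 1 M) B_SB x s (p (tin v))).
Qed.
Lemma unshift_inD n (v w : tpow M n) : unshift_in (v + w) = unshift_in v + unshift_in w.
Proof.
case: n v w => [|n] v w; first exact/esym/addr0.
exact: (tliftD v w (unshift_in_bal n)).
Qed.
Lemma unshift_in0 n : unshift_in (0 : tpow M n) = 0.
Proof. by case: n => [//|n]; exact: (tlift0 (unshift_in_bal n)). Qed.

Definition unshift (t : T) : coefM := \sum_(n < tbound t) unshift_in (t n).

Lemma unshift_widen N (t : T) : (forall n, (N <= n)%N -> t n = 0) ->
  unshift t = \sum_(n < N) unshift_in (t n).
Proof.
have H K L : (forall n, (K <= n)%N -> t n = 0) -> (K <= L)%N ->
    \sum_(n < K) unshift_in (t n) = \sum_(n < L) unshift_in (t n).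
  move=> hK KL; rewrite (big_ord_widen L (fun n => unshift_in (t n))) //.
  rewrite big_mkcond; apply: eq_bigr => i _; case: ltnP => // /hK ->.
  by rewrite unshift_in0.
move=> hN; rewrite /unshift (H _ _ (@tboundP _ _ _ t) (leq_maxl _ N)).
by rewrite [RHS](H _ _ hN (leq_maxr (tbound t) _)).
Qed.

Lemma unshiftD t u : unshift (t + u) = unshift t + unshift u.
Proof.
pose N := maxn (tbound t) (tbound u).
have ht n : (N <= n)%N -> t n = 0 by rewrite geq_max => /andP[/tboundP].
have hu n : (N <= n)%N -> u n = 0 by rewrite geq_max => /andP[_ /tboundP].
rewrite !(@unshift_widen N) // => [|n hn]; last by rewrite tcoefD ht ?hu ?addr0.
by rewrite -big_split; apply: eq_bigr => n _; rewrite tcoefD unshift_inD.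
Qed.
Lemma unshift0 : unshift 0 = 0.
Proof. by apply: (addIr (unshift 0)); rewrite -unshiftD !add0r. Qed.

Lemma unshift_shift x t : unshift (shift x t) = tpure (x : gconc 1 M) (p t : B_SB).
Proof.
rewrite (@unshift_widen (tbound t).+1) => [|[//|n] /tboundP tn]; last first.
  by rewrite /= tn tpure0r.
rewrite big_ord_recl add0r [in RHS](talg_sum_tin t) linear_sum.
rewrite [RHS]tpure_sumr; apply: eq_bigr => n _.
exact/tliftE/unshift_in_bal.
Qed.
Lemma unshift_scalar s : unshift (tscalar M s) = 0.
Proof.
rewrite (@unshift_widen 1) ?big_ord1 // => -[//|n] _.
exact: tin_neq.
Qed.

Lemma unshift_scale s t : unshift (tscalar M s * t) = lact s (unshift t).
Proof.
elim/talg_ind: t => [s'|x t _|t u IH IH'].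
- by rewrite tscalarM !unshift_scalar lact0.
- by rewrite tin_mult -[tact _ _]shift_lact !unshift_shift [RHS]lact_pure.
- by rewrite mulrDr !unshiftD IH IH' lactDr.
Qed.

(** Words of length 0 have no first letter: their contribution to [t * u] is the
    second summand. *)
Lemma unshiftM t u :
  unshift (t * u) = ract (unshift t) (p u) + lact (gaug B (p t)) (unshift u).
Proof.
elim/talg_ind: t => [s|x t _|t t' IH IH'].
- by rewrite unshift_scale unshift_scalar ract0 add0r (qp_scalar hp) gaugK.
- rewrite [_ * u]shift_tmult -[tmult t u]/(t * u) !unshift_shift p_shift gaugM gaug_letter.
  rewrite mul0r lact0l addr0 pM.
  exact/esym/(@ract_pure k S S B (gconc 1 M) B_SB).
- by rewrite mulrDl !unshiftD IH IH' ractDl pD gaugD lactDl addrACA.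
Qed.

Lemma unshift_tgen2 t : unshift (tgen2 t) = koszul2_in t 1.
Proof.
elim/tens_ind: t => [|x y|t u IH IH'].
- by rewrite koszul2_in0 /tgen2 tlift0 ?unshift0 //; exact: tgen2_bal.
- by rewrite tgen2E tgen_mult unshift_shift koszul2_inP mulr1.
- by rewrite koszul2_inDl -IH -IH' -unshiftD /tgen2 tliftD //; exact: tgen2_bal.
Qed.

(** The elements [t] with the asserted property form a two-sided ideal containing
    the relations, by the product formula and because [p t = 0] removes the second
    summand of that formula. *)
Lemma unshift_ker t : p t = 0 -> exists v, koszul2 v = unshift t.
Proof.
move=> /(qp_ker hp)/(_ (fun t => p t = 0 /\ exists v, koszul2 v = unshift t)).
case=> [|u v [pu [w wE]] [pv [w' wE']]|a u b [pu [w wE]]|_ [r Rr ->]|] //.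
- by rewrite linear0 unshift0; split=> //; exists 0; rewrite koszul20.
- rewrite pD pu pv addr0; split=> //.
  by exists (w + w'); rewrite koszul2D wE wE' unshiftD.
- rewrite !pM pu mulr0 mul0r; split=> //.
  exists (ract (lact (gaug B (p a)) w) (p b)).
  rewrite (bimorr (proj1 gmor_koszul2)) (bimorl (proj1 gmor_koszul2)) wE.
  rewrite unshiftM pM pu mulr0 linear0 lact0l addr0.
  by rewrite unshiftM pu ract0r add0r.
- rewrite p_relation //; split=> //.
  have rR : r \in sbpred R by apply/asboolP.
  exists (tpure (Subcar rR : gconc 2 (sub_bimod R)) (1 : B_SB)).
  by rewrite koszul2P unshift_tgen2.
Qed.

Lemma koszul1_unshift t : koszul1 (unshift t) = p t - gincl B (gaug B (p t)).
Proof.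
elim/talg_ind: t => [s|x t _|t u IH IH'].
- by rewrite unshift_scalar koszul10 (qp_scalar hp) gaugK subrr.
- by rewrite unshift_shift koszul1P p_shift gaugM gaug_letter mul0r linear0 subr0.
- by rewrite unshiftD koszul1D IH IH' pD gaugD ginclD opprD addrACA.
Qed.

Lemma koszul0_exact (b : B) : gaug B b = 0 -> exists u, koszul1 u = b.
Proof.
have [t <-] := qp_surj hp b => b0.
by exists (unshift t); rewrite koszul1_unshift b0 linear0 subr0.
Qed.
Lemma gaug_koszul1 u : gaug B (koszul1 u) = 0.
Proof.
elim/tens_ind: u => [|x b|u v IH IH'].
- by rewrite koszul10 linear0.
- by rewrite koszul1P gaugM gaug_letter mul0r.
- by rewrite koszul1D gaugD IH IH' addr0.
Qed.

Lemma unshift_surj (w : coefM) : exists2 t, gaug B (p t) = 0 & unshift t = w.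
Proof.
elim/tens_ind: w => [|x b|u v [t t0 <-] [t' t0' <-]].
- by exists 0; rewrite ?unshift0 ?linear0.
- have [t <-] := qp_surj hp b; exists (shift x t); last exact: unshift_shift.
  by rewrite p_shift gaugM gaug_letter mul0r.
- by exists (t + t'); rewrite ?unshiftD // pD gaugD t0 t0' addr0.
Qed.

Lemma koszul1_exact w : koszul1 w = 0 -> exists v, koszul2 v = w.
Proof.
have [t t0 <-] := unshift_surj w.
by rewrite koszul1_unshift t0 linear0 subr0; exact: unshift_ker.
Qed.
End RightKoszul.
(** * Injectivity of the last Koszul differential *)

Section DualizableClosure.
Context (k : fieldType).

Lemma dualizable_retract (A A' S : algType k) (X : bimod A S) (Y : bimod A' S)
    (f : Y -> X) (g : X -> Y) : right_dualizable X ->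
  (forall (c : k) y y', f (c *: y + y') = c *: f y + f y') ->
  (forall y s, f (ract y s) = ract (f y) s) ->
  (forall (c : k) x x', g (c *: x + x') = c *: g x + g x') ->
  (forall x s, g (ract x s) = ract (g x) s) ->
  (forall y, g (f y) = y) -> right_dualizable Y.
Proof.
move=> [cs csE] fl fr gl gr fK.
have hl (h : rform X) (c : k) x y : h (f (c *: x + y)) = c *: h (f x) + h (f y).
  by rewrite fl rform_lin.
have hr (h : rform X) y s : h (f (ract y s)) = h (f y) * s by rewrite fr rform_ract.
exists [seq (g c.1, @Rform _ _ _ Y (fun y => c.2 (f y)) (hl c.2) (hr c.2))
       | c : X * rform X <- cs] => y _.
rewrite big_map -[LHS]fK {1}(csE (f y) I) (lin_sum gl).
by apply: eq_bigr => c _; rewrite gr.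
Qed.

Lemma dualizable_tens (A S C : algType k) (X : bimod A S) (Y : bimod S C) :
  right_dualizable X -> right_dualizable Y -> right_dualizable (tens X Y).
Proof.
move=> [cs csE] [ds dsE].
have cl (f : rform X) (g : rform Y) (c : k) (u v : tens X Y) :
    g (contract f (c *: u + v)) = c *: g (contract f u) + g (contract f v).
  rewrite -rform_lin; congr (g _); apply: (tlift_lin (contract_bal Y f)) => a x y.
  by rewrite rformZ lactZl.
have cr (f : rform X) (g : rform Y) (u : tens X Y) s :
    g (contract f (ract u s)) = g (contract f u) * s.
  rewrite -rform_ract; congr (g _); elim/tens_ind: u => [|x y|u v IH IH'].
  - by rewrite ract0 !contract0 ract0.
  - by rewrite ract_pure !contract_pure lractA.
  - by rewrite ractDl !contractD IH IH' ractDl.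
exists [seq (tpure c.1 d.1 : tens X Y, @Rform _ _ _ (tens X Y)
    (fun u => d.2 (contract c.2 u)) (cl c.2 d.2) (cr c.2 d.2))
  | c : X * rform X <- cs, d : Y * rform Y <- ds] => t _.
rewrite big_allpairs_dep /=.
have -> : \sum_(c <- cs) \sum_(d <- ds)
    ract (tpure c.1 d.1 : tens X Y) (d.2 (contract c.2 t)) =
    \sum_(c <- cs) tpure c.1 (contract c.2 t).
  apply: eq_bigr => c _; rewrite [in RHS](dsE (contract c.2 t) I) tpure_sumr.
  by apply: eq_bigr => d _; rewrite ract_pure.
elim/tens_ind: t => [|x y|u v IH IH'].
- by rewrite big1 // => c _; rewrite contract0 tpure0r.
- rewrite {1}(csE x I) tpure_suml; apply: eq_bigr => c _.
  by rewrite contract_pure tpureA.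
- by rewrite {1}IH {1}IH' -big_split; apply: eq_bigr => c _; rewrite contractD tpureDr.
Qed.
End DualizableClosure.

(** Comparison maps [f] to the second resolution and [g] back, and a homotopy [s]
    from [g f] to the identity, give [1 - g2 f2 - s1 d2], whose image lies in the
    kernel of [d2].  As [d2'] is injective, [f2] vanishes on that kernel, where this
    map is thus the identity. *)
Lemma kernel_retraction (k : fieldType) (S S' : algType k) (A : gralg S) (C : gralg S')
    (X K0 K1 K2 P0 P1 P2 : gbimod A C)
    (e : K0 -> X) (d1 : K1 -> K0) (d2 : K2 -> K1)
    (e' : P0 -> X) (d1' : P1 -> P0) (d2' : P2 -> P1) :
  gmor e -> gmor d1 -> gmor d2 -> gmor e' -> gmor d1' -> gmor d2' ->
  gprojective K0 -> gprojective K1 -> gprojective K2 ->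
  gprojective P0 -> gprojective P1 -> gprojective P2 ->
  (forall x, exists u, e u = x) -> (forall u, e (d1 u) = 0) ->
  (forall u, e u = 0 -> exists v, d1 v = u) -> (forall u, d1 (d2 u) = 0) ->
  (forall u, d1 u = 0 -> exists v, d2 v = u) ->
  (forall x, exists u, e' u = x) -> (forall u, e' (d1' u) = 0) ->
  (forall u, e' u = 0 -> exists v, d1' v = u) -> (forall u, d1' (d2' u) = 0) ->
  (forall u, d1' u = 0 -> exists v, d2' v = u) -> (forall u, d2' u = 0 -> u = 0) ->
  exists r : K2 -> K2,
    [/\ gmor r, forall u, d2 (r u) = 0 & forall u, d2 u = 0 -> r u = u].
Proof.
move=> he h1 h2 he' h1' h2' k0 k1 k2 p0 p1 p2 es ed1 x0 d12 x1 es' ed1' x0' d12' x1' inj.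
have [f0 hf0 f0E] := k0 _ _ _ _ he' es' he.
have [u|f1 hf1 f1E] := gproj_lift k1 h1' he' (gmor_comp hf0 h1) ed1' x0'.
  by rewrite f0E ed1.
have [u|f2 hf2 f2E] := gproj_lift k2 h2' h1' (gmor_comp hf1 h2) d12' x1'.
  by rewrite f1E d12 (gmor0 hf0).
have [g0 hg0 g0E] := p0 _ _ _ _ he es he'.
have [u|g1 hg1 g1E] := gproj_lift p1 h1 he (gmor_comp hg0 h1') ed1 x0.
  by rewrite g0E ed1'.
have [u|g2 hg2 g2E] := gproj_lift p2 h2 h1 (gmor_comp hg1 h2') d12 x1.
  by rewrite g1E d12' (gmor0 hg0).
have [u|s0 hs0 s0E] := gproj_lift k0 h1 he
  (gmor_sub (@gmor_id _ _ _ _ _ K0) (gmor_comp hg0 hf0)) ed1 x0.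
  by rewrite (gmorB he) g0E f0E subrr.
have [u|s1 hs1 s1E] := gproj_lift k1 h2 h1
  (gmor_sub (gmor_sub (@gmor_id _ _ _ _ _ K1) (gmor_comp hg1 hf1))
    (gmor_comp hs0 h1)) d12 x1.
  by rewrite !(gmorB h1) s0E g1E f1E subrr.
exists (fun u => u - g2 (f2 u) - s1 (d2 u)); split.
- apply: gmor_sub (gmor_comp hs1 h2).
  exact: gmor_sub (@gmor_id _ _ _ _ _ K2) (gmor_comp hg2 hf2).
- by move=> u; rewrite !(gmorB h2) s1E g2E f2E d12 (gmor0 hs0) subr0 subrr.
- move=> u du; rewrite du (gmor0 hs1) subr0.
  have -> : f2 u = 0 by apply: inj; rewrite f2E du (gmor0 hf1).
  by rewrite (gmor0 hg2) subr0.
Qed.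

Lemma gmor_right_mod (k : fieldType) (S : algType k) (B : gralg S)
    (Q Q' : gbimod (triv S) B) (f : Q -> Q') : gmor f ->
  gmor (X := right_mod Q) (Y := right_mod Q') f.
Proof. by move=> [[fl _ fr] fd]; split=> //; exact: bimor_base_left. Qed.

(** The dimension bound concerns right modules only, so the left [S]-structure of
    [Q0], [Q1], [Q2] is forgotten in the comparison. *)
Lemma gpd2_retraction (k : fieldType) (S : algType k) (B : gralg S)
    (X : gbimod (triv k^o) B) (Q0 Q1 Q2 : gbimod (triv S) B)
    (e : right_mod Q0 -> X) (d1 : Q1 -> Q0) (d2 : Q2 -> Q1) :
  gpd_le X 2 -> gmor e -> gmor d1 -> gmor d2 ->
  gprojective (right_mod Q0) -> gprojective (right_mod Q1) ->
  gprojective (right_mod Q2) ->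
  (forall x, exists u, e u = x) -> (forall u, e (d1 u) = 0) ->
  (forall u, e u = 0 -> exists v, d1 v = u) -> (forall u, d1 (d2 u) = 0) ->
  (forall u, d1 u = 0 -> exists v, d2 v = u) ->
  exists r : Q2 -> Q2,
    [/\ {morph r : u v / u + v}, forall u b, r (ract u b) = ract (r u) b,
        forall i u, gdeg Q2 i u -> gdeg Q2 i (r u),
        forall u, d2 (r u) = 0 & forall u, d2 u = 0 -> r u = u].
Proof.
move=> [P [d [e' [[Pp dm em es e0 en] P0]]]] he h1 h2 q0 q1 q2 surj ed x0 dd x1.
have [u|u|u|u|u|r [[[rl _ rr] rd] r0 rid]] := kernel_retraction he (gmor_right_mod h1)
  (gmor_right_mod h2) em (dm 0%N) (dm 1%N) q0 q1 q2 (Pp _) (Pp _) (Pp _)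
  surj ed x0 dd x1 es.
- by apply/e0; exists u.
- by move=> /e0.
- by apply/en; exists u.
- by move=> /en.
- by move=> /en[v <-]; rewrite (P0 3 isT v) (gmor0 (dm _)).
exists r; split=> //; first exact: (linD rl).
Qed.

Section KoszulInjective.
Context (k : fieldType) (S : algType k) (M : bimod S S).
Context (R : subbimod (tens M M)) (B : gralg S) (p : {lrmorphism talg M -> B}).
Context (hp : quad_presentation R p).
Local Notation T := (talg M).
Local Notation coefM := (Defs.coefM B M).
Local Notation coefR := (coefR B R).
Local Notation B_SB := (B_SB B).
Local Notation letter := (letter p).
Local Notation koszul1 := (koszul1 p).
Local Notation koszul2 := (@koszul2 _ _ _ R _ p).

Lemma aug_right_bal :
  balanced (fun (x : gconc 1 M) (b : B_SB) => ract (x : M) (gaug B (b : B))).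
Proof.
split=> [x x' b|x b b'|x s b].
- exact: ractDl.
- by rewrite gaugD ractDr.
- by rewrite gaugM gaugK; exact: ractA.
Qed.
Definition aug_right : coefM -> M :=
  tlift (fun (x : gconc 1 M) (b : B_SB) => ract (x : M) (gaug B (b : B))).
Lemma aug_rightP (x : M) (b : B) :
  aug_right (tpure (x : gconc 1 M) (b : B_SB)) = ract x (gaug B b).
Proof. exact/tliftE/aug_right_bal. Qed.
Lemma aug_rightD u v : aug_right (u + v) = aug_right u + aug_right v.
Proof. exact/tliftD/aug_right_bal. Qed.
Lemma aug_right0 : aug_right 0 = 0.
Proof. exact/tlift0/aug_right_bal. Qed.
Lemma aug_right_lact s u : aug_right (lact s u) = lact s (aug_right u).
Proof.
elim/tens_ind: u => [|x b|u v IH IH'].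
- by rewrite lact0 aug_right0 lact0.
- rewrite aug_rightP -lractA -aug_rightP; congr aug_right.
  exact: (@lact_pure k S S B (gconc 1 M) B_SB).
- by rewrite lactDr !aug_rightD IH IH' lactDr.
Qed.
Lemma aug_right_ract u b : aug_right (ract u b) = ract (aug_right u) (gaug B b).
Proof.
elim/tens_ind: u => [|x b'|u v IH IH'].
- by rewrite ract0 aug_right0 ract0.
- rewrite aug_rightP ractA -gaugM -aug_rightP; congr aug_right.
  exact: (@ract_pure k S S B (gconc 1 M) B_SB).
- by rewrite ractDl !aug_rightD IH IH' ractDl.
Qed.
Lemma aug_right_koszul2_in t b : aug_right (koszul2_in p t b) = 0.
Proof.
elim/tens_ind: t => [|x y|t u IH IH'].
- by rewrite (koszul2_in0 hp) aug_right0.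
- by rewrite (koszul2_inP hp) aug_rightP gaugM (gaug_letter hp) mul0r ract0r.
- by rewrite (koszul2_inDl hp) aug_rightD IH IH' addr0.
Qed.
Lemma aug_right_koszul2 v : aug_right (koszul2 v) = 0.
Proof.
elim/tens_ind: v => [|r b|u v IH IH'].
- by rewrite (koszul20 hp) aug_right0.
- by rewrite (koszul2P hp) aug_right_koszul2_in.
- by rewrite (koszul2D hp) aug_rightD IH IH' addr0.
Qed.

(** This is the projection of [B] onto [B_1] followed by the inverse of [M -> B_1].
    The choice of a preimage under [p] is harmless: [unshift] sends the kernel of
    [p] to the image of [koszul2], which [aug_right] kills. *)
Definition lin_part (b : B) : M := aug_right (unshift p (sval (cid (qp_surj hp b)))).
Lemma lin_partP t : lin_part (p t) = aug_right (unshift p t).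
Proof.
rewrite /lin_part; case: cid => t' /= pt'.
have [v vE] : exists v, koszul2 v = unshift p (t' - t).
  by apply: (unshift_ker hp); rewrite pD linearN pt' subrr.
apply/eqP; rewrite -subr_eq0; apply/eqP.
have -> : aug_right (unshift p t') =
    aug_right (unshift p (t' - t)) + aug_right (unshift p t).
  by rewrite -aug_rightD -(unshiftD hp) subrK.
by rewrite addrK -vE aug_right_koszul2.
Qed.
Lemma lin_part_lin (c : k) b b' : lin_part (c *: b + b') = c *: lin_part b + lin_part b'.
Proof.
have [t <-] := qp_surj hp b; have [t' <-] := qp_surj hp b'.
rewrite -[c *: p t]linearZ -pD !lin_partP (unshiftD hp) aug_rightD; congr (_ + _).
have -> : c *: t = tscalar M (c *: 1) * t.
  by rewrite tin_mult; apply: talg_eq => n; rewrite tcoefZ /= lactZl lact1.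
by rewrite (unshift_scale hp) aug_right_lact lactZl lact1.
Qed.
Lemma lin_partl s b : lin_part (gincl B s * b) = lact s (lin_part b).
Proof.
have [t <-] := qp_surj hp b.
by rewrite -(qp_scalar hp) -pM !lin_partP (unshift_scale hp) aug_right_lact.
Qed.
Lemma lin_partr b s : lin_part (b * gincl B s) = ract (lin_part b) s.
Proof.
have [t <-] := qp_surj hp b.
rewrite -(qp_scalar hp) -pM !lin_partP (unshiftM hp) (unshift_scalar hp) lact0 addr0.
by rewrite aug_right_ract (qp_scalar hp) gaugK.
Qed.
Lemma lin_part_letter x b : lin_part (letter x * b) = ract x (gaug B b).
Proof.
have [t <-] := qp_surj hp b.
by rewrite -p_shift lin_partP (unshift_shift hp) aug_rightP.
Qed.

Lemma lin_right_bal : balanced (fun (x : gconc 1 M) (b : B_SB) =>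
  tpure (x : M) (lin_part (b : B)) : tens M M).
Proof.
split=> [x x' b|x b b'|x s b].
- exact: tpureDl.
- by rewrite (linD lin_part_lin) tpureDr.
- by rewrite lin_partl; exact: tpureA.
Qed.
Definition lin_right : coefM -> tens M M :=
  tlift (fun (x : gconc 1 M) (b : B_SB) => tpure (x : M) (lin_part (b : B)) : tens M M).
Lemma lin_rightP (x : M) (b : B) :
  lin_right (tpure (x : gconc 1 M) (b : B_SB)) = tpure x (lin_part b).
Proof. exact/tliftE/lin_right_bal. Qed.
Lemma lin_rightD u v : lin_right (u + v) = lin_right u + lin_right v.
Proof. exact/tliftD/lin_right_bal. Qed.
Lemma lin_right0 : lin_right 0 = 0.
Proof. exact/tlift0/lin_right_bal. Qed.
Lemma lin_right_koszul2_in t b : lin_right (koszul2_in p t b) = ract t (gaug B b).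
Proof.
elim/tens_ind: t => [|x y|t u IH IH'].
- by rewrite (koszul2_in0 hp) lin_right0 ract0.
- by rewrite (koszul2_inP hp) lin_rightP lin_part_letter ract_pure.
- by rewrite (koszul2_inDl hp) lin_rightD IH IH' ractDl.
Qed.
Lemma lin_right_koszul2 v : R (lin_right (koszul2 v)).
Proof.
elim/tens_ind: v => [|r b|u v IH IH'].
- by rewrite (koszul20 hp) lin_right0; exact: sbset0.
- by rewrite (koszul2P hp) lin_right_koszul2_in; apply: sbsetr; exact: sub_inclP.
- rewrite (koszul2D hp) lin_rightD -[lin_right (koszul2 u)]scale1r; exact: sbsetP.
Qed.

(** In degree 2 the ideal generated by [R] is [R]: exactness at [M (x)_S B] yields
    an element of [R (x)_S B], whose linear part in [M (x)_S M] is the given one. *)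
Lemma relation_p t : p (tgen2 t) = 0 -> R t.
Proof.
move=> pt; have [v vE] : exists v, koszul2 v = koszul2_in p t 1.
  by apply: (koszul1_exact hp); rewrite (koszul1_koszul2_in hp) pt mul0r.
have := lin_right_koszul2 v.
by rewrite vE lin_right_koszul2_in rmorph1 ract1.
Qed.

(** [letter] identifies [M] with the projective bimodule [B_1], and [lin_part] is the
    inverse. *)
Lemma M_dualizable : koszul B -> right_dualizable M.
Proof.
move=> B_koszul.
apply: (@dualizable_retract k S S S (gpart B 1) M
  (fun x => in_gpart (letter_deg hp x)) (fun b => lin_part (sub_incl b))
  (gpart_dualizable B_koszul (i := 1) isT)).
- by move=> c x y; apply: val_inj; rewrite /= letterD letterZ.
- by move=> x s; apply: val_inj; exact: (letterr hp).
- by move=> c x y; rewrite sub_incl_lin lin_part_lin.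
- by move=> b s; exact: lin_partr.
- by move=> x; rewrite /= -[letter x]mulr1 lin_part_letter rmorph1 ract1.
Qed.

Lemma p_tgen2D t u : p (tgen2 (t + u)) = p (tgen2 t) + p (tgen2 u).
Proof. by rewrite -pD; congr (p _); exact/tliftD/tgen2_bal. Qed.
Lemma p_tgen2P x y : p (tgen2 (tpure x y)) = letter x * letter y.
Proof. by rewrite tgen2E pM. Qed.
Lemma p_tgen20 : p (tgen2 (0 : tens M M)) = 0.
Proof. by apply: (addIr (p (tgen2 0))); rewrite -p_tgen2D !add0r. Qed.
Lemma p_tgen2_lin (c : k) t u : p (tgen2 (c *: t + u)) = c *: p (tgen2 t) + p (tgen2 u).
Proof.
rewrite p_tgen2D; congr (_ + _); elim/tens_ind: t => [|x y|t t' IH IH'].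
- by rewrite scaler0 p_tgen20 scaler0.
- by rewrite -tpureZl !p_tgen2P letterZ scalerAl.
- by rewrite scalerDr !p_tgen2D IH IH' scalerDr.
Qed.
Lemma p_tgen2_ract t s : p (tgen2 (ract t s)) = p (tgen2 t) * gincl B s.
Proof.
elim/tens_ind: t => [|x y|t t' IH IH'].
- by rewrite ract0 p_tgen20 mul0r.
- by rewrite ract_pure !p_tgen2P (letterr hp) mulrA.
- by rewrite ractDl !p_tgen2D IH IH' mulrDl.
Qed.
Lemma p_tgen2_deg t : ggr B 2 (p (tgen2 t)).
Proof.
elim/tens_ind: t => [|x y|t t' IH IH'].
- by rewrite p_tgen20; exact: deg0.
- by rewrite p_tgen2P; exact: ggrM (letter_deg hp x) (letter_deg hp y).
- by rewrite p_tgen2D; exact: degD.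
Qed.
Lemma p_tgen2_surj b : ggr B 2 b -> exists t, p (tgen2 t) = b.
Proof.
move=> /(qp_deg hp 2)[t t2 <-].
have -> : t = tin (t 2%N).
  apply: talg_eq => n; have [->|n2] := eqVneq n 2%N; first by rewrite tin_eq.
  by rewrite t2 // tin_neq.
elim/tpow_ind: (t 2%N) => [|x v|u v [u' uE] [v' vE]].
- by exists 0; rewrite p_tgen20 /tin tact0l linear0.
- rewrite /tin tact_pure p_shift.
  elim/tpow_ind: v => [|y s|u v [u' uE] [v' vE]].
  + by exists 0; rewrite p_tgen20 tact0l linear0 mulr0.
  + exists (ract (tpure x y : tens M M) (s : S)); rewrite p_tgen2_ract p_tgen2P.
    by rewrite tact_pure p_shift mulrA -(qp_scalar hp).
  + by exists (u' + v'); rewrite p_tgen2D uE vE tactDl pD mulrDr.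
- by exists (u' + v'); rewrite p_tgen2D uE vE /tin tactDl pD.
Qed.

(** [R] is the kernel of the surjection [M (x)_S M -> B_2], which splits on the right
    because [B_2] is projective; hence [R] is a retract of [M (x)_S M]. *)
Lemma R_dualizable : koszul B -> right_dualizable (sub_bimod R).
Proof.
move=> B_koszul; have Md := M_dualizable B_koszul.
pose pi (t : as_right (tens M M)) : as_right (gpart B 2) := in_gpart (p_tgen2_deg t).
have hpi : bimor pi.
  apply: bimor_base_left => [c t u|t s]; apply: val_inj; first exact: p_tgen2_lin.
  exact: p_tgen2_ract.
have [b||sg [sl _ sr] sE] := @koszul_projr k S B B_koszul 2 isT _ _ pi (fun b => b) hpi.
- have [t tE] := p_tgen2_surj (gpart_deg b); exists t; exact: val_inj.
- by [].
have inR (t : tens M M) : t - sg (pi t) \in sbpred R.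
  apply/asboolP/relation_p; have /(congr1 (@sub_incl _ _ _ _ _)) := sE (pi t).
  rewrite /sub_incl /= => piE.
  by rewrite -scaleN1r addrC p_tgen2_lin piE scaleN1r addNr.
apply: (@dualizable_retract k S S S (tens M M) (sub_bimod R) (@sub_incl _ _ _ _ R)
  (fun t => Subcar (inR t)) (dualizable_tens Md Md)).
- exact: sub_incl_lin.
- by [].
- move=> c x x'; apply: val_inj; rewrite [RHS](@sub_incl_lin _ _ _ _ R) /=.
  have -> : pi (c *: x + x') = c *: pi x + pi x' by case: hpi.
  by rewrite sl scalerBr opprD addrACA.
- move=> x s; apply: val_inj => /=.
  have -> : pi (ract x s) = ract (pi x) s by case: hpi => _ _ ->.
  rewrite [sg _]sr ractDl -!scaleN1r; congr (_ + _).
  exact/esym/(@ractZl k S S (tens M M)).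
- move=> r; apply: val_inj => /=.
  have -> : pi (sub_incl r) = 0.
    by apply: val_inj; rewrite [RHS](raddf0 val); apply: (p_relation hp); exact: sub_inclP.
  by rewrite (lin0 sl) subr0.
Qed.

(** A degree 2 element of [R (x)_S B] is [r (x) 1], and [lin_right] recovers [r]. *)
Lemma koszul2_inj_deg2 u : gdeg coefR 2 u -> koszul2 u = 0 -> u = 0.
Proof.
have /[apply] [[r ->]] : gdeg coefR 2 u -> exists r : sub_bimod R,
    u = tpure (r : gconc 2 (sub_bimod R)) (1 : B_SB).
  elim/tdeg_ind => [|i j r b ij hr hb|_ _ [r ->] [r' ->]].
  - by exists 0; rewrite [RHS](@tpure0l _ _ _ _ (gconc 2 (sub_bimod R))).
  - case: hr => [i2|->]; last first.
      by exists 0; rewrite [RHS](@tpure0l _ _ _ _ (gconc 2 (sub_bimod R))) [LHS]tpure0l.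
    have j0 : j = 0 by apply: (addrI i); rewrite addr0 ij i2.
    have /gincl_im[s sE] : ggr B 0 b by rewrite -j0.
    exists (ract r s); etransitivity; last first.
      exact/esym/(@tpureA k S S B (gconc 2 (sub_bimod R)) B_SB r s 1).
    by congr (tpure _ _); rewrite sE; exact: (esym (mulr1 _)).
  - exists (r + r'); exact/esym/(@tpureDl _ _ _ _ (gconc 2 (sub_bimod R))).
rewrite (koszul2P hp) => /(congr1 lin_right).
rewrite lin_right_koszul2_in lin_right0 rmorph1 ract1 => r0.
have -> : r = 0 by apply: val_inj; rewrite [RHS](raddf0 val).
exact: (@tpure0l _ _ _ _ (gconc 2 (sub_bimod R))).
Qed.

(** The dimension bound makes the kernel of [koszul2] a graded direct summand of
    [R (x)_S B].  It is thus generated in degree 2, where it vanishes. *)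
Lemma koszul2_injective : koszul B -> gpd_le (gaug_mod B) 2 ->
  forall u, koszul2 u = 0 -> u = 0.
Proof.
move=> B_koszul B_pd.
have Md := M_dualizable B_koszul; have Rd := R_dualizable B_koszul.
have gaug_gmor : gmor (X := right_mod B_SB) (Y := gaug_mod B) (gaug B : B -> S).
  split; last by move=> i b hb; exact: (@gmorA_aug k S B).
  apply: bimor_base_left => [c x y|x b]; first exact: linearP.
  exact: gaugM.
have hgaug s : exists b, gaug B b = s by exists (gincl B s); exact: gaugK.
have [r [rD rr rd r0 rid]] := gpd2_retraction B_pd gaug_gmor (gmor_koszul1 hp)
  (gmor_koszul2 hp) (@gproj_reg k S B) (@gproj_coef k S B 1 M Md)
  (@gproj_coef k S B 2 (sub_bimod R) Rd) hgaug (gaug_koszul1 hp) (koszul0_exact hp)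
  (koszul1_koszul2 hp) (koszul1_exact hp).
have r00 : r 0 = 0 by apply: (addIr (r 0)); rewrite -rD !add0r.
move=> u /rid <-; elim/tens_ind: u => [|x b|u v IH IH'].
- exact: r00.
- have xb : tpure x b = @ract k S B coefR
      (tpure (x : gconc 2 (sub_bimod R)) (1 : B_SB)) (b : B).
    rewrite [RHS]ract_pure; congr (tpure _ _); exact: (esym (mul1r _)).
  rewrite [tpure x b]xb rr (@koszul2_inj_deg2 (r _)) ?ract0 //.
  apply: rd.
  have one0 : gdeg B_SB 0 (1 : B) by apply/gincl_im; exists 1; rewrite rmorph1.
  have := tdeg_pure (or_introl erefl : gdeg (gconc 2 (sub_bimod R)) 2 x) one0.
  by rewrite addr0.
- by rewrite rD IH IH' addr0.
Qed.
End KoszulInjective.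
(** * The Koszul bimodule resolution *)

Section Truncation.
Context (k : fieldType) (S S1 S2 : algType k) (A : gralg S1) (C : gralg S2).
Context (X : gbimod A (triv S)).

Lemma hcomp_left_mor (Y : gbimod (triv S) C) q : left_mor (hcomp (gdeg Y) q).
Proof.
split=> [x y|s y]; first exact: hcompD.
apply: (hcomp_nat (f := fun y => lact s y)) => [x x'|i x hx].
  exact: lactDr.
by rewrite -[i]add0r; apply: gdegl => //; left.
Qed.

Definition right_comp (Y : gbimod (triv S) C) (q : int) : tens X Y -> tens X Y :=
  tens_map (hcomp (gdeg Y) q).
Lemma right_comp_pure Y q x y :
  @right_comp Y q (tpure x y) = tpure x (hcomp (gdeg Y) q y).
Proof. exact/tens_map_pure/hcomp_left_mor. Qed.
Lemma right_compD Y q : {morph @right_comp Y q : u v / u + v}.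
Proof. exact/tens_mapD/hcomp_left_mor. Qed.
Lemma right_comp0 Y q : @right_comp Y q 0 = 0.
Proof. exact/tens_map0/hcomp_left_mor. Qed.
Lemma right_compN Y q u : @right_comp Y q (- u) = - right_comp q u.
Proof. by apply/eqP; rewrite -addr_eq0 -right_compD addNr right_comp0. Qed.

Lemma right_comp_idem Y q q' u :
  @right_comp Y q (right_comp q' u) = if q == q' then right_comp q' u else 0.
Proof.
elim/tens_ind: u => [|x y|u v IH IH'].
- by rewrite !right_comp0 if_same.
- rewrite !right_comp_pure (hcomp_homog _ (hcomp_deg _ _ _)).
  by case: eqP => // _; rewrite tpure0r.
- by rewrite !right_compD IH IH'; case: eqP => // _; rewrite addr0.
Qed.

Lemma right_comp_map (Y Y' : gbimod (triv S) C) (g : Y -> Y') q u : gmor g ->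
  right_comp q (tens_map g u) = tens_map g (right_comp q u).
Proof.
move=> hg; have gl := bimor_left (proj1 hg); elim/tens_ind: u => [|x y|u v IH IH'].
- by rewrite right_comp0 tens_map0 // right_comp0.
- by rewrite right_comp_pure !tens_map_pure // right_comp_pure hcomp_gmor.
- by rewrite right_compD !tens_mapD // right_compD IH IH'.
Qed.

Section NonNegative.
Context (Y : gbimod (triv S) C).
Context (Y_pos : forall i y, i < 0 -> gdeg Y i y -> y = 0).

Lemma hcomp_sum_nat y : exists N, forall n, (N <= n)%N ->
  y = \sum_(q < n) hcomp (gdeg Y) q%:Z y.
Proof.
exists (\max_(i <- hsupp (gdeg Y) y) `|i|%N.+1) => n hn.
have h_in i : i \in hsupp (gdeg Y) y -> (`|i| < n)%N.
  move=> iy; apply: leq_trans hn.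
  by apply: (@leq_bigmax_seq _ _ xpredT (fun i : int => `|i|%N.+1)).
pose r := [seq q%:Z | q <- iota 0 n].
rewrite -(big_mkord xpredT (fun q => hcomp (gdeg Y) q%:Z y)) /index_iota subn0.
rewrite -(big_map Posz xpredT (fun q => hcomp (gdeg Y) q y)) -/r.
rewrite {1}(hcomp_sum (gdeg Y) y) (bigID (fun i : int => 0 <= i)) /=.
rewrite [X in _ + X]big1 ?addr0 => [|i]; last first.
  by rewrite -ltNge => /Y_pos; apply; exact: hcomp_deg.
rewrite -big_filter; apply: sum_widen.
- exact/filter_uniq/hsupp_uniq.
- by rewrite map_inj_uniq ?iota_uniq // => a b [].
- move=> i; rewrite mem_filter => /andP[i0 /h_in]; case: i i0 => // i _ ni.
  by apply/mapP; exists i; rewrite // mem_iota.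
- move=> i; rewrite mem_filter negb_and -ltNge => /orP[/Y_pos|/hcomp_out //].
  by apply; exact: hcomp_deg.
Qed.

Lemma right_comp_sum (u : tens X Y) : exists N, forall n, (N <= n)%N ->
  u = \sum_(q < n) right_comp q%:Z u.
Proof.
elim/tens_ind: u => [|x y|u v [N hN] [N' hN']].
- by exists 0%N => n _; rewrite big1 // => q _; exact: right_comp0.
- have [N hN] := hcomp_sum_nat y; exists N => n /hN yE.
  rewrite {1}yE tpure_sumr; apply: eq_bigr => q _; exact/esym/right_comp_pure.
- exists (maxn N N') => n; rewrite geq_max => /andP[/hN uE /hN' vE].
  by rewrite {1}uE {1}vE -big_split; apply: eq_bigr => q _; exact/esym/right_compD.
Qed.

Definition rbelow (N : nat) (u : tens X Y) : Prop :=
  forall q : int, N%:Z <= q -> right_comp q u = 0.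
Lemma rbelow0 u : rbelow 0 u -> u = 0.
Proof.
have [N /(_ N (leqnn _)) uE] := right_comp_sum u => u0.
by rewrite uE big1 // => q _; exact: u0.
Qed.
Lemma rbelow_ex u : exists N, rbelow N u.
Proof.
have [N /(_ N (leqnn _)) uE] := right_comp_sum u; exists N => q Nq.
rewrite uE; elim/big_ind: _ => [|v w hv hw|i _]; first exact: right_comp0.
  by rewrite right_compD hv hw addr0.
rewrite right_comp_idem; case: eqP => // qi.
by move: Nq; rewrite qi lez_nat leqNgt ltn_ord.
Qed.
End NonNegative.
End Truncation.

(** The Koszul bimodule differentials have the form [l + 1 (x) f], where [1 (x) f]
    keeps the degree of the right-hand factor and [l] lowers it.  On the component
    of highest right degree only the part [1 (x) f], which is exact by flatness, is
    seen; removing that component is the step of a descending induction. *)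
Section Perturbation.
Context (k : fieldType) (S S1 S2 : algType k) (A : gralg S1) (C : gralg S2).
Context (X : gbimod A (triv S)) (Y1 Y2 Y3 : gbimod (triv S) C).
Context (Xd : locally_dualizable X).
Context (Y1_pos : forall i y, i < 0 -> gdeg Y1 i y -> y = 0).
Context (Y2_pos : forall i y, i < 0 -> gdeg Y2 i y -> y = 0).
Context (f : Y1 -> Y2) (g : Y2 -> Y3) (hf : gmor f) (hg : gmor g).
Context (l : tens X Y1 -> tens X Y2) (m : tens X Y2 -> tens X Y3).
Context (l_lower : forall q u, right_comp q (l u) = l (right_comp (q + 1) u)).
Context (m_lower : forall q u, right_comp q (m u) = m (right_comp (q + 1) u)).
Context (lD : {morph l : u v / u + v}) (mD : {morph m : u v / u + v}).

Let l0 : l 0 = 0. Proof. by apply: (addIr (l 0)); rewrite -lD !add0r. Qed.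
Let m0 : m 0 = 0. Proof. by apply: (addIr (m 0)); rewrite -mD !add0r. Qed.
Let mN u : m (- u) = - m u.
Proof. by apply/eqP; rewrite -addr_eq0 -mD addNr m0. Qed.
Let fl := bimor_left (proj1 hf).
Let gl := bimor_left (proj1 hg).
Let gN u : tens_map g (- u) = - tens_map g u :> tens X Y3.
Proof. by apply/eqP; rewrite -addr_eq0 -tens_mapD // addNr tens_map0. Qed.

Lemma perturbed_injective : (forall y, f y = 0 -> y = 0) ->
  forall u, l u + tens_map f u = 0 -> u = 0.
Proof.
move=> inj u; have [N] := rbelow_ex Y1_pos u.
elim: N u => [|N IHN] u uN du; first exact: rbelow0 uN.
apply: IHN => // q; rewrite le_eqVlt => /orP[/eqP <-|Nq]; last first.
  by apply: uN; rewrite -addn1 PoszD lezD1.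
apply: (tens_map_inj Xd (bimor_left (proj1 hf)) inj).
have := congr1 (right_comp N%:Z) du.
rewrite right_compD right_comp0 l_lower right_comp_map //.
by rewrite uN ?l0 ?add0r // -PoszD addn1.
Qed.

Lemma perturbed_exact : (forall y, g y = 0 -> exists z, f z = y) ->
  (forall u, m (l u + tens_map f u) + tens_map g (l u + tens_map f u) = 0) ->
  forall u, m u + tens_map g u = 0 -> exists v, l v + tens_map f v = u.
Proof.
move=> ex dd u; have [N] := rbelow_ex Y2_pos u.
elim: N u => [|N IHN] u uN du.
  by exists 0; rewrite l0 tens_map0 // addr0 (rbelow0 Y2_pos uN).
have [v vE] : exists v, tens_map f v = right_comp N%:Z u.
  apply: (tens_map_exact Xd fl gl ex).
  have := congr1 (right_comp N%:Z) du.
  rewrite right_compD right_comp0 m_lower right_comp_map //.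
  by rewrite uN ?m0 ?add0r // -PoszD addn1.
pose v' := right_comp N%:Z v; pose w := l v' + tens_map f v'.
have [||v2 v2E] := IHN (u - w).
- move=> q Nq; rewrite right_compD right_compN right_compD l_lower.
  rewrite right_comp_map // !right_comp_idem.
  have -> : (q + 1 == N%:Z) = false.
    by apply/negbTE; rewrite gt_eqF // ltzD1.
  rewrite l0 add0r; have [->|qN] := eqVneq q N%:Z.
    by rewrite -right_comp_map // vE right_comp_idem eqxx subrr.
  rewrite tens_map0 // subr0; apply: uN.
  by rewrite -addn1 PoszD lezD1 lt_neqAle eq_sym qN.
- rewrite mD tens_mapD // mN gN addrACA du add0r -opprD.
  by rewrite dd oppr0.
exists (v2 + v'); rewrite lD tens_mapD // addrACA v2E.
by rewrite -/w subrK.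
Qed.
End Perturbation.

Section TensLift.
Context (k : fieldType) (A S C : algType k) (X : bimod A S) (Y : bimod S C).

Lemma tlift_split (Z : zmodType) (f g h : X -> Y -> Z) u :
  (forall x y, h x y = f x y + g x y) -> tlift h u = tlift f u + tlift g u.
Proof. by move=> hE; rewrite /tlift -big_split; apply: eq_bigr => q _. Qed.
Lemma tlift_comp (Z Z' : zmodType) (phi : Z -> Z') (f : X -> Y -> Z) u :
  {morph phi : a b / a + b} -> phi (tlift f u) = tlift (fun x y => phi (f x y)) u.
Proof.
move=> phiD; have phi0 : phi 0 = 0 by apply: (addIr (phi 0)); rewrite -phiD !add0r.
by rewrite /tlift; elim/big_rec2: _ => [|q a b _ <-].
Qed.
Lemma tpureNr (x : X) (y : Y) : tpure x (- y) = - tpure x y.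
Proof. by rewrite -scaleN1r tpureZr scaleN1r. Qed.
End TensLift.

Section BimoduleKoszul.
Context (k : fieldType) (S : algType k) (M : bimod S S).
Context (R : subbimod (tens M M)) (B : gralg S) (p : {lrmorphism talg M -> B}).
Context (hp : quad_presentation R p).
Local Notation T := (talg M).
Local Notation coefM := (Defs.coefM B M).
Local Notation coefR := (coefR B R).
Local Notation B_SB := (B_SB B).
Local Notation B_BS := (B_BS B).
Local Notation letter := (letter p).
Local Notation koszul1 := (koszul1 p).
Local Notation koszul2 := (@koszul2 _ _ _ R _ p).
Local Notation C2 := (tens B_BS coefR).
Local Notation C1 := (tens B_BS coefM).
Local Notation C0 := (tens B_BS B_SB).

Lemma tlift3_bal (N : gbimod (triv S) (triv S)) (Z : zmodType) (f : B -> N -> B -> Z) :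
  (forall a b x c, f (a + b) x c = f a x c + f b x c) ->
  (forall a x y c, f a (x + y) c = f a x c + f a y c) ->
  (forall a x b c, f a x (b + c) = f a x b + f a x c) ->
  (forall a s x c, f (a * gincl B s) x c = f a (lact s x) c) ->
  (forall a x s c, f a (ract x s) c = f a x (gincl B s * c)) ->
  balanced (fun (b1 : B_BS) (q : gtens N B_SB) =>
      tlift (fun (x : N) (b2 : B_SB) => f b1 x b2) q).
Proof.
move=> f1 f2 f3 fl fr.
have bal b : balanced (fun (x : N) (b2 : B_SB) => f b x b2).
  by split=> [y y' d|y d d'|y s d]; [exact: f2|exact: f3|exact: fr].
split=> [b b' q|b q q'|b s q].
- elim/tens_ind: q => [|y d|u v IH IH'].
  + by rewrite !tlift0 // addr0.
  + by rewrite !tliftE // f1.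
  + by rewrite !tliftD // IH IH' addrACA.
- by rewrite tliftD.
- elim/tens_ind: q => [|y d|u v IH IH'].
  + by rewrite lact0 !tlift0.
  + by rewrite lact_pure !tliftE //; exact: fl.
  + by rewrite lactDr !tliftD // IH IH'.
Qed.

(** [pushM] and [pushR] multiply a letter into the left-hand factor [B]; they are
    the part of the Koszul differentials that lowers the right degree. *)
Definition pushM_in (b : B) (x : M) (c : B) : C0 := tpure (b * letter x : B_BS) (c : B_SB).
Definition pushM : C1 -> C0 :=
  tlift (fun (b : B_BS) (q : coefM) =>
    tlift (fun (x : gconc 1 M) (c : B_SB) => pushM_in b x c) q).
Lemma pushM_in1 a b x c : pushM_in (a + b) x c = pushM_in a x c + pushM_in b x c.
Proof. by rewrite /pushM_in mulrDl tpureDl. Qed.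
Lemma pushM_in2 a x y c : pushM_in a (x + y) c = pushM_in a x c + pushM_in a y c.
Proof. by rewrite /pushM_in letterD mulrDr tpureDl. Qed.
Lemma pushM_in3 a x b c : pushM_in a x (b + c) = pushM_in a x b + pushM_in a x c.
Proof. by rewrite /pushM_in tpureDr. Qed.
Lemma pushM_inl a s x c : pushM_in (a * gincl B s) x c = pushM_in a (lact s x) c.
Proof. by rewrite /pushM_in (letterl hp) mulrA. Qed.
Lemma pushM_inr a x s c : pushM_in a (ract x s) c = pushM_in a x (gincl B s * c).
Proof.
rewrite /pushM_in (letterr hp) mulrA.
exact: (@tpureA k B S B B_BS B_SB (a * letter x) s c).
Qed.
Lemma pushMP (a : B) (x : M) (c : B) :
  pushM (tpure (a : B_BS) (tpure (x : gconc 1 M) (c : B_SB) : coefM)) = pushM_in a x c.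
Proof.
apply: (@tlift3E k S B (gconc 1 M) _ pushM_in).
- exact: pushM_in1.
- exact: pushM_in2.
- exact: pushM_in3.
- exact: pushM_inl.
- exact: pushM_inr.
Qed.
Lemma pushMD : {morph pushM : u v / u + v}.
Proof.
move=> u v; apply/tliftD/(@tlift3_bal (gconc 1 M) _ pushM_in).
- exact: pushM_in1.
- exact: pushM_in2.
- exact: pushM_in3.
- exact: pushM_inl.
- exact: pushM_inr.
Qed.

Definition pushR_in (b : B) (t : tens M M) (c : B) : C1 :=
  tlift (fun x y =>
    tpure (b * letter x : B_BS) (tpure (y : gconc 1 M) (c : B_SB) : coefM) : C1) t.
Lemma pushR_in_bal b c : balanced (fun x y : M =>
  tpure (b * letter x : B_BS) (tpure (y : gconc 1 M) (c : B_SB) : coefM) : C1).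
Proof.
split=> [x x' y|x y y'|x s y].
- by rewrite letterD mulrDr tpureDl.
- by rewrite (@tpureDl _ _ _ _ (gconc 1 M)) tpureDr.
- rewrite (letterr hp) mulrA.
  etransitivity; first exact: (@tpureA k B S B B_BS coefM (b * letter x) s
    (tpure (y : gconc 1 M) (c : B_SB))).
  by congr (tpure _ _); exact: (@lact_pure k S S B (gconc 1 M) B_SB).
Qed.
Lemma pushR_inP b x y c :
  pushR_in b (tpure x y) c =
    tpure (b * letter x : B_BS) (tpure (y : gconc 1 M) (c : B_SB) : coefM).
Proof. exact/tliftE/pushR_in_bal. Qed.
Lemma pushR_in2 a t u c : pushR_in a (t + u) c = pushR_in a t c + pushR_in a u c.
Proof. exact/tliftD/pushR_in_bal. Qed.
Lemma pushR_in0 a c : pushR_in a 0 c = 0.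
Proof. exact/tlift0/pushR_in_bal. Qed.
Lemma pushR_in1 a b t c : pushR_in (a + b) t c = pushR_in a t c + pushR_in b t c.
Proof.
elim/tens_ind: t => [|x y|t u IH IH'].
- by rewrite !pushR_in0 addr0.
- by rewrite !pushR_inP mulrDl tpureDl.
- by rewrite !pushR_in2 IH IH' addrACA.
Qed.
Lemma pushR_in3 a t b c : pushR_in a t (b + c) = pushR_in a t b + pushR_in a t c.
Proof.
elim/tens_ind: t => [|x y|t u IH IH'].
- by rewrite !pushR_in0 addr0.
- by rewrite !pushR_inP !tpureDr.
- by rewrite !pushR_in2 IH IH' addrACA.
Qed.
Lemma pushR_inl a s t c : pushR_in (a * gincl B s) t c = pushR_in a (lact s t) c.
Proof.
elim/tens_ind: t => [|x y|t u IH IH'].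
- by rewrite lact0 !pushR_in0.
- by rewrite lact_pure !pushR_inP (letterl hp) mulrA.
- by rewrite lactDr !pushR_in2 IH IH'.
Qed.
Lemma pushR_inr a t s c : pushR_in a (ract t s) c = pushR_in a t (gincl B s * c).
Proof.
elim/tens_ind: t => [|x y|t u IH IH'].
- by rewrite ract0 !pushR_in0.
- rewrite ract_pure !pushR_inP; congr (tpure _ _).
  exact: (@tpureA k S S B (gconc 1 M) B_SB y s c).
- by rewrite ractDl !pushR_in2 IH IH'.
Qed.

Definition pushR : C2 -> C1 :=
  tlift (fun (b : B_BS) (q : coefR) =>
    tlift (fun (r : gconc 2 (sub_bimod R)) (c : B_SB) => pushR_in b (sub_incl r) c) q).
Lemma pushRP (a : B) (r : sub_bimod R) (c : B) :
  pushR (tpure (a : B_BS) (tpure (r : gconc 2 (sub_bimod R)) (c : B_SB) : coefR)) =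
    pushR_in a (sub_incl r) c.
Proof.
apply: (@tlift3E k S B (gconc 2 (sub_bimod R)) _ (fun a r c => pushR_in a (sub_incl r) c)).
- by move=> *; exact: pushR_in1.
- by move=> b x y d; rewrite -pushR_in2.
- by move=> *; exact: pushR_in3.
- by move=> *; exact: pushR_inl.
- by move=> *; exact: pushR_inr.
Qed.
Lemma pushRD : {morph pushR : u v / u + v}.
Proof.
move=> u v; apply/tliftD.
apply: (@tlift3_bal (gconc 2 (sub_bimod R)) _ (fun a r c => pushR_in a (sub_incl r) c)).
- by move=> *; exact: pushR_in1.
- by move=> b x y d; rewrite -pushR_in2.
- by move=> *; exact: pushR_in3.
- by move=> *; exact: pushR_inl.
- by move=> *; exact: pushR_inr.
Qed.

Lemma pushM0 : pushM 0 = 0.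
Proof. by apply: (addIr (pushM 0)); rewrite -pushMD !add0r. Qed.
Lemma pushR0 : pushR 0 = 0.
Proof. by apply: (addIr (pushR 0)); rewrite -pushRD !add0r. Qed.

Definition opp_koszul1 (q : coefM) : B_SB := - koszul1 q.
Lemma gmor_opp_koszul1 : gmor opp_koszul1.
Proof. exact: (gmor_opp (gmor_koszul1 hp)). Qed.

Lemma dM_decomp u : dM p u = pushM u + tens_map (X := B_BS) opp_koszul1 u.
Proof.
apply: tlift_split => b q; rewrite /opp_koszul1 tpureNr.
have phiD : {morph (fun c : B_SB => - tpure (b : B_BS) c) : c c' / c + c'}.
  by move=> c c'; rewrite tpureDr opprD.
have -> : - tpure (b : B_BS) (koszul1 q : B_SB) =
    tlift (fun (x : gconc 1 M) (c : B_SB) => - tpure (b : B_BS) (letter x * c : B_SB)) q.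
  exact: (tlift_comp _ _ phiD).
exact: tlift_split.
Qed.
Lemma dR_decomp u : dR p u = pushR u + tens_map (X := B_BS) koszul2 u.
Proof.
apply: tlift_split => b q.
have phiD : {morph (fun c : coefM => tpure (b : B_BS) c) : c c' / c + c'}.
  by move=> c c'; rewrite tpureDr.
have -> : tpure (b : B_BS) (koszul2 q : coefM) =
    tlift (fun (r : gconc 2 (sub_bimod R)) (c : B_SB) =>
      tpure (b : B_BS) (koszul2_in p (sub_incl r) c : coefM)) q.
  exact: (tlift_comp _ _ phiD).
apply: tlift_split => r c.
have -> : tpure (b : B_BS) (koszul2_in p (sub_incl r) c : coefM) =
    tlift (fun x y : M => tpure (b : B_BS)
      (tpure (x : gconc 1 M) (letter y * c : B_SB) : coefM)) (sub_incl r).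
  exact: (tlift_comp _ _ phiD).
exact: tlift_split.
Qed.

(* side conditions of the lemmas on [tens_map] *)
Let kl1 := bimor_left (proj1 gmor_opp_koszul1).
Let kl2 := bimor_left (proj1 (gmor_koszul2 hp)).

Lemma dMD : {morph dM p : u v / u + v}.
Proof. by move=> u v; rewrite !dM_decomp pushMD tens_mapD // addrACA. Qed.
Lemma dMN u : dM p (- u) = - dM p u.
Proof.
have dM0 : dM p 0 = 0 by apply: (addIr (dM p 0)); rewrite -dMD !add0r.
by apply/eqP; rewrite -addr_eq0 -dMD addNr dM0.
Qed.
Lemma dRD : {morph dR (R := R) p : u v / u + v}.
Proof. by move=> u v; rewrite !dR_decomp pushRD tens_mapD // addrACA. Qed.

Lemma pushM_pushR_in a t c :
  pushM (pushR_in a t c) = tpure (a * p (tgen2 t) : B_BS) (c : B_SB).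
Proof.
elim/tens_ind: t => [|x y|t u IH IH'].
- by rewrite pushR_in0 pushM0 p_tgen20 mulr0 tpure0l.
- by rewrite pushR_inP pushMP p_tgen2P mulrA.
- by rewrite pushR_in2 pushMD IH IH' p_tgen2D mulrDr tpureDl.
Qed.
Lemma mixed_in a t c :
  pushM (tpure (a : B_BS) (koszul2_in p t c : coefM)) +
    tens_map (X := B_BS) opp_koszul1 (pushR_in a t c) = 0.
Proof.
elim/tens_ind: t => [|x y|t u IH IH'].
- by rewrite (koszul2_in0 hp) pushR_in0 tpure0r pushM0 tens_map0 // addr0.
- rewrite (koszul2_inP hp) pushR_inP pushMP tens_map_pure // /opp_koszul1 (koszul1P hp).
  by rewrite tpureNr subrr.
- by rewrite (koszul2_inDl hp) pushR_in2 tpureDr pushMD tens_mapD // addrACA IH IH' addr0.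
Qed.
(** Of the four products, [pushM pushR] and [koszul1 koszul2] vanish by the
    relations; the mixed ones cancel because a letter taken to the left and a letter
    taken to the right do not interfere. *)
Lemma dM_dR u : dM p (dR (R := R) p u) = 0.
Proof.
elim/tens_ind: u => [|b q|u v IH IH'].
- by rewrite dR_decomp pushR0 tens_map0 // addr0 dM_decomp pushM0 tens_map0 // addr0.
- elim/tens_ind: q => [|r c|u v IH IH'].
  + rewrite tpure0r dR_decomp pushR0 tens_map0 // addr0 dM_decomp pushM0.
    by rewrite tens_map0 // addr0.
  + rewrite dR_decomp pushRP tens_map_pure // (koszul2P hp) dM_decomp pushMD tens_mapD //.
    rewrite pushM_pushR_in (p_relation hp (sub_inclP r)) mulr0 tpure0l add0r addrA.
    rewrite mixed_in add0r tens_map_pure // /opp_koszul1 (koszul1_koszul2_in hp).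
    by rewrite (p_relation hp (sub_inclP r)) mul0r oppr0 tpure0r.
  + by rewrite tpureDr dRD dMD IH IH' addr0.
- by rewrite dRD dMD IH IH' addr0.
Qed.

Lemma hcomp_coef (N : bimod S S) d q (x : N) (c : B) :
  hcomp (gdeg (gtens (gconc d N) B_SB)) q (tpure (x : gconc d N) (c : B_SB)) =
    tpure (x : gconc d N) (hcomp (ggr B) (q - d) c : B_SB).
Proof.
apply: (@hcomp_unique _ _ _ _ [seq d + i | i <- hsupp (ggr B) c]
  (fun q => tpure (x : gconc d N) (hcomp (ggr B) (q - d) c : B_SB))).
- by rewrite map_inj_uniq ?hsupp_uniq //; exact: addrI.
- move=> i; have := @tdeg_pure k S S S (triv S) B (gconc d N) B_SB d (i - d) x
    (hcomp (ggr B) (i - d) c) (or_introl erefl) (hcomp_deg _ _ _).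
  by rewrite addrC subrK.
- move=> i ni; rewrite hcomp_out ?tpure0r //.
  by apply: contra ni => ic; apply/mapP; exists (i - d); rewrite // addrC subrK.
- rewrite big_map {1}(hcomp_sum (ggr B) c) tpure_sumr; apply: eq_bigr => i _.
  by rewrite [d + i]addrC addrK.
Qed.

Lemma pushM_lower q u : right_comp q (pushM u) = pushM (right_comp (q + 1) u).
Proof.
elim/tens_ind: u => [|b w|u v IH IH'].
- by rewrite !(right_comp0, pushM0).
- elim/tens_ind: w => [|x c|u v IH IH'].
  + by rewrite tpure0r !(right_comp0, pushM0).
  + by rewrite pushMP !right_comp_pure hcomp_coef pushMP addrK.
  + by rewrite tpureDr !(right_compD, pushMD) IH IH'.
- by rewrite !(right_compD, pushMD) IH IH'.
Qed.
Lemma pushR_in_lower q a t c :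
  right_comp q (pushR_in a t c) = pushR_in a t (hcomp (ggr B) (q - 1) c).
Proof.
elim/tens_ind: t => [|x y|t u IH IH'].
- by rewrite !pushR_in0 right_comp0.
- by rewrite !pushR_inP right_comp_pure hcomp_coef.
- by rewrite !pushR_in2 right_compD IH IH'.
Qed.
Lemma pushR_lower q u : right_comp q (pushR u) = pushR (right_comp (q + 1) u).
Proof.
elim/tens_ind: u => [|b w|u v IH IH'].
- by rewrite !(right_comp0, pushR0).
- elim/tens_ind: w => [|x c|u v IH IH'].
  + by rewrite tpure0r !(right_comp0, pushR0).
  + rewrite pushRP !right_comp_pure hcomp_coef pushRP pushR_in_lower.
    by congr (pushR_in _ _ (hcomp _ _ _)); rewrite -addrA; congr (_ + _).
  + by rewrite tpureDr !(right_compD, pushRD) IH IH'.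
- by rewrite !(right_compD, pushRD) IH IH'.
Qed.

Lemma coef_pos (N : bimod S S) (d : int) : 0 <= d -> forall i y, i < 0 ->
  gdeg (gtens (gconc d N) B_SB) i y -> y = 0.
Proof.
move=> d0 i y i0; elim/tdeg_ind => [//|j l x c jl hx hc|u v -> ->]; last by rewrite addr0.
case: hx => [jd|->]; last by rewrite tpure0l.
have -> : c = 0; last exact: tpure0r.
apply: (@ggr_pos k S B l) => //.
by apply: le_lt_trans i0; rewrite -jl jd lerDr.
Qed.

Definition mulS : C0 -> B := tlift (fun (a : B_BS) (c : B_SB) => (a : B) * (c : B)).
Lemma mulS_bal : balanced (fun (a : B_BS) (c : B_SB) => (a : B) * (c : B)).
Proof.
split=> [x x' y|x y y'|x s y]; first exact: mulrDl.
  exact: mulrDr.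
exact/esym/mulrA.
Qed.
Lemma mulSP (a c : B) : mulS (tpure (a : B_BS) (c : B_SB)) = a * c.
Proof. exact/tliftE/mulS_bal. Qed.
Lemma mulSD : {morph mulS : u v / u + v}.
Proof. by move=> u v; exact/tliftD/mulS_bal. Qed.
Lemma mulS0 : mulS 0 = 0.
Proof. exact/tlift0/mulS_bal. Qed.

Lemma bar_mul_aug (u : barS B 0) : bar_mul u = mulS (bar_aug u).
Proof.
have bal : balanced (fun (b : B_Bk B) (b' : barW B_SB 0) => (b : B) * (b' : B)).
  apply: bilin_balanced => [c x x' y|c x y y'].
    by rewrite mulrDl scalerAl.
  by rewrite mulrDr scalerAr.
elim/tens_ind: u => [|b c|u v IH IH'].
- by rewrite bar_aug0 mulS0; exact: (tlift0 bal).
- by rewrite bar_mulE bar_augE mulSP.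
- by rewrite bar_augD mulSD -IH -IH'; exact: (tliftD u v bal).
Qed.

Lemma mulS_dM u : mulS (dM p u) = 0.
Proof.
elim/tens_ind: u => [|b w|u v IH IH'].
- by rewrite dM_decomp pushM0 tens_map0 // addr0 mulS0.
- elim/tens_ind: w => [|x c|u v IH IH'].
  + by rewrite tpure0r dM_decomp pushM0 tens_map0 // addr0 mulS0.
  + rewrite dM_decomp pushMP tens_map_pure // /opp_koszul1 (koszul1P hp) mulSD.
    rewrite [mulS (pushM_in _ _ _)]mulSP mulSP; apply/eqP; rewrite addr_eq0 -mulrA.
    by rewrite [X in - X](mulrN b (letter x * c)) opprK.
  + by rewrite tpureDr dMD mulSD IH IH' addr0.
- by rewrite dMD mulSD IH IH' addr0.
Qed.

(** Modulo the image of [dM] letters move freely from the right factor to the left,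
    and [B] is generated by letters over [S]. *)
Lemma dM_normal u : exists v, u = dM p v + tpure (mulS u : B_BS) (1 : B_SB).
Proof.
have pureP (t : T) : forall b : B, exists v,
    tpure (b : B_BS) (p t : B_SB) = dM p v + tpure (b * p t : B_BS) (1 : B_SB).
  elim/talg_ind: t => [s|x t IH|t t' IH IH'] b.
  - exists 0; rewrite dM_decomp pushM0 tens_map0 // !add0r (qp_scalar hp).
    rewrite -[X in tpure _ X]mulr1; exact/esym/(@tpureA k B S B B_BS B_SB b s 1).
  - have [v vE] := IH (b * letter x).
    exists (v - tpure (b : B_BS) (tpure (x : gconc 1 M) (p t : B_SB) : coefM)).
    rewrite dMD dMN (dME hp) -/(letter x) p_shift mulrA vE opprB addrCA opprD.
    by rewrite addNKr subrK.
  - have [v vE] := IH b; have [v' vE'] := IH' b; exists (v + v').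
    by rewrite pD tpureDr vE vE' dMD mulrDr tpureDl addrACA.
elim/tens_ind: u => [|b c|u v [u' uE] [v' vE]].
- by exists 0; rewrite mulS0 dM_decomp pushM0 tens_map0 // tpure0l !addr0.
- by have [t <-] := qp_surj hp c; have [v vE] := pureP t b; exists v; rewrite mulSP.
- by exists (u' + v'); rewrite {1}uE {1}vE dMD mulSD tpureDl addrACA.
Qed.

Context (B_koszul : koszul B) (B_pd : gpd_le (gaug_mod B) 2).

Lemma dM_coexact u : mulS u = 0 -> exists v, dM p v = u.
Proof.
have [v vE] := dM_normal u => u0; exists v.
by rewrite vE u0 tpure0l addr0.
Qed.

Lemma dR_inj u : dR (R := R) p u = 0 -> u = 0.
Proof.
rewrite dR_decomp; apply: (@perturbed_injective k S S S B B B_BS coefR coefM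
  (B_locally_dualizable B_koszul) (@coef_pos _ 2 isT) koszul2 (gmor_koszul2 hp)
  pushR pushR_lower pushRD).
exact: (koszul2_injective hp).
Qed.

Lemma dR_exact u : dM p u = 0 -> exists v, dR (R := R) p v = u.
Proof.
rewrite dM_decomp => du.
have [|w|v vE] := @perturbed_exact k S S S B B B_BS coefR coefM B_SB
  (B_locally_dualizable B_koszul) (@coef_pos _ 1 isT) koszul2 opp_koszul1
  (gmor_koszul2 hp) gmor_opp_koszul1 pushR pushM pushR_lower pushM_lower pushRD pushMD
  _ _ u du.
- move=> y /eqP; rewrite oppr_eq0 => /eqP; exact: (koszul1_exact hp).
- by rewrite -dR_decomp -dM_decomp dM_dR.
- by exists v; rewrite dR_decomp.
Qed.
End BimoduleKoszul.
(** * The total complex *)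

Section SumMorphisms.
Context (k : fieldType) (S1 S2 : algType k) (A : gralg S1) (C : gralg S2).

Lemma gmor_pair (X Y Z : gbimod A C) (f : X -> Y) (g : X -> Z) :
  gmor f -> gmor g -> gmor (Y := gsum Y Z) (fun x => (f x, g x)).
Proof.
move=> [[fl fa fr] fd] [[gl ga gr] gd]; split; last first.
  by move=> i x hx; split; [exact: fd|exact: gd].
split=> [c x y|a x|x a].
- by rewrite fl gl.
- by rewrite fa ga.
- by rewrite fr gr.
Qed.
Lemma gmor_fst (X Y : gbimod A C) : gmor (X := gsum X Y) (fun u => u.1).
Proof. by split=> // i u []. Qed.
Lemma gmor_snd (X Y : gbimod A C) : gmor (X := gsum X Y) (fun u => u.2).
Proof. by split=> // i u []. Qed.
End SumMorphisms.

Lemma morphN (U V : zmodType) (f : U -> V) : {morph f : u v / u + v} ->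
  {morph f : u / - u >-> - u}.
Proof.
move=> fD u; have f0 : f 0 = 0 by apply: (addIr (f 0)); rewrite -fD !add0r.
by apply/eqP; rewrite -addr_eq0 -fD addNr f0.
Qed.

(** The iterated mapping cone, for columns [Rs], [Ms], [Ss] resolving [R0], [M0],
    [S0], an exact sequence [0 -> R0 -> M0 -> S0 -> X -> 0], lifts [t2], [t1] of its
    first two maps, and a null-homotopy [h] of [t1 t2]. *)
Section Chase.
Context (k : fieldType) (S1 S2 : algType k) (A : gralg S1) (C : gralg S2).
Context (Rs Ms Ss : nat -> gbimod A C) (X : gbimod A C) (R0 M0 S0 : zmodType).
Context (rd : forall n, Rs n.+1 -> Rs n) (md : forall n, Ms n.+1 -> Ms n).
Context (sd : forall n, Ss n.+1 -> Ss n).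
Context (ra : Rs 0%N -> R0) (ma : Ms 0%N -> M0) (sa : Ss 0%N -> S0).
Context (dr : R0 -> M0) (dm : M0 -> S0) (mu : S0 -> X) (e : Ss 0%N -> X).
Context (t2 : forall n, Rs n -> Ms n) (t1 : forall n, Ms n -> Ss n).
Context (h : forall n, Rs n -> Ss n.+1).
Arguments rd {n}. Arguments md {n}. Arguments sd {n}.
Arguments t2 {n}. Arguments t1 {n}. Arguments h {n}.

Context (rd_mor : forall n, gmor (@rd n)) (md_mor : forall n, gmor (@md n))
  (sd_mor : forall n, gmor (@sd n)) (t2_mor : forall n, gmor (@t2 n))
  (t1_mor : forall n, gmor (@t1 n)) (h_mor : forall n, gmor (@h n)) (e_mor : gmor e).
Context (Rs_proj : forall n, gprojective (Rs n)) (Ms_proj : forall n, gprojective (Ms n))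
  (Ss_proj : forall n, gprojective (Ss n)).
Context (maD : {morph ma : u v / u + v}) (saD : {morph sa : u v / u + v}).
Context (eE : forall u, e u = mu (sa u)) (e_surj : forall x, exists u, e u = x).
Context (r_dd : forall n (u : Rs n.+2), rd (rd u) = 0)
  (m_dd : forall n (u : Ms n.+2), md (md u) = 0)
  (s_dd : forall n (u : Ss n.+2), sd (sd u) = 0).
Context (r_ad : forall u : Rs 1%N, ra (rd u) = 0) (m_ad : forall u : Ms 1%N, ma (md u) = 0)
  (s_ad : forall u : Ss 1%N, sa (sd u) = 0).
Context (r_ex : forall n (u : Rs n.+1), rd u = 0 -> exists v, rd v = u)
  (m_ex : forall n (u : Ms n.+1), md u = 0 -> exists v, md v = u)
  (s_ex : forall n (u : Ss n.+1), sd u = 0 -> exists v, sd v = u).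
Context (r_ax : forall u, ra u = 0 -> exists v, rd v = u)
  (m_ax : forall u, ma u = 0 -> exists v, md v = u)
  (s_ax : forall u, sa u = 0 -> exists v, sd v = u).
Context (ra_surj : forall t, exists u, ra u = t) (ma_surj : forall t, exists u, ma u = t).
Context (dr_inj : forall u, dr u = 0 -> u = 0)
  (dr_ex : forall u, dm u = 0 -> exists v, dr v = u)
  (dm_ex : forall u, mu u = 0 -> exists v, dm v = u)
  (mu_dm : forall u, mu (dm u) = 0).
Context (t2_d : forall n (u : Rs n.+1), md (t2 u) = t2 (rd u))
  (t2_a : forall u : Rs 0%N, ma (t2 u) = dr (ra u))
  (t1_d : forall n (u : Ms n.+1), sd (t1 u) = t1 (md u))
  (t1_a : forall u : Ms 0%N, sa (t1 u) = dm (ma u))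
  (h_0 : forall u : Rs 0%N, t1 (t2 u) = sd (h u))
  (h_S : forall n (u : Rs n.+1), t1 (t2 u) = sd (h u) + h (rd u)).

Let mdB n := gmorB (@md_mor n). Let sdB n := gmorB (@sd_mor n).
Let sdD n := gmorD (@sd_mor n). Let t1B n := gmorB (@t1_mor n).
Let sdN n u : @sd n (- u) = - sd u := linN (gmor_lin (@sd_mor n)) u.
Let maN u : ma (- u) = - ma u := morphN maD u.
Let saN u : sa (- u) = - sa u := morphN saD u.

(* Once the first components of a cycle are matched, what is left of the last one
   is a cycle of the column [Ss]. *)
Let fill n (a z : Ss n.+1) : sd a = sd z -> exists z', a + sd z' = z.
Proof.
move=> az; have [z' zE] : exists z', sd z' = z - a.
  by apply: s_ex; rewrite sdB az subrr.
by exists z'; rewrite zE addrC subrK.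
Qed.

Lemma chase_exact0 (z : Ss 0%N) : mu (sa z) = 0 ->
  exists (y : Ms 0%N) (z' : Ss 1%N), t1 y + sd z' = z.
Proof.
move=> /dm_ex[m mE]; have [y yE] := ma_surj m.
have [z' zE] : exists z', sd z' = z - t1 y.
  by apply: s_ax; rewrite saD saN t1_a yE mE subrr.
by exists y, z'; rewrite zE addrC subrK.
Qed.

Lemma chase_exact1 (y : Ms 0%N) (z : Ss 1%N) : t1 y + sd z = 0 ->
  exists (x' : Rs 0%N) (y' : Ms 1%N) (z' : Ss 2%N),
    t2 x' - md y' = y /\ - h x' + t1 y' + sd z' = z.
Proof.
move=> yz; have [r rE] : exists r, dr r = ma y.
  apply: dr_ex; rewrite -t1_a; have -> : t1 y = - sd z.
    by apply/eqP; rewrite -addr_eq0 yz.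
  by rewrite saN s_ad oppr0.
have [x xE] := ra_surj r.
have [y' yE] : exists y', md y' = t2 x - y.
  by apply: m_ax; rewrite maD maN t2_a xE rE subrr.
have [|z' zE] := @fill 0%N (- h x + t1 y') z.
  rewrite sdD sdN -h_0 t1_d yE t1B addKr.
  by apply/esym/eqP; rewrite -addr_eq0 addrC yz.
by exists x, y', z'; rewrite yE subKr.
Qed.

Lemma chase_exact2 n (x' : Rs n.+1) (y : Ms n.+1) (z : Ss n.+2) :
  t2 (rd x') - md y = 0 -> - h (rd x') + t1 y + sd z = 0 ->
  exists (y' : Ms n.+2) (z' : Ss n.+3),
    t2 x' - md y' = y /\ - h x' + t1 y' + sd z' = z.
Proof.
move=> xy xyz; have [y' yE] : exists y', md y' = t2 x' - y.
  by apply: m_ex; rewrite mdB t2_d xy.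
have [|z' zE] := @fill n.+1 (- h x' + t1 y') z.
  rewrite sdD sdN t1_d yE t1B h_S -addrA addKr.
  by apply/esym/eqP; rewrite -subr_eq0 opprB addrC [t1 y - _]addrC xyz.
by exists y', z'; rewrite yE subKr.
Qed.

(** At the end of the first column injectivity of [dr] takes the place of exactness:
    [dr (ra x) = ma (t2 x) = ma (md y) = 0]. *)
Lemma chase_rd0 (x : Rs 0%N) (y : Ms 1%N) : t2 x - md y = 0 -> exists x', rd x' = x.
Proof.
move=> /eqP; rewrite subr_eq0 => /eqP xy.
by apply/r_ax/dr_inj; rewrite -t2_a xy m_ad.
Qed.

Lemma chase_dd0 (y : Ms 0%N) (z : Ss 1%N) : mu (sa (t1 y + sd z)) = 0.
Proof. by rewrite saD s_ad addr0 t1_a mu_dm. Qed.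

Lemma chase_dd1 (x : Rs 0%N) (y : Ms 1%N) (z : Ss 2%N) :
  t1 (t2 x - md y) + sd (- h x + t1 y + sd z) = 0.
Proof.
rewrite t1B !sdD s_dd addr0 sdN -h_0 t1_d.
by rewrite addrACA subrr addNr addr0.
Qed.

Lemma chase_dd2 n (x : Rs n.+1) (y : Ms n.+2) :
  t2 (rd x) - md (t2 x - md y) = 0.
Proof. by rewrite mdB m_dd subr0 t2_d subrr. Qed.
Lemma chase_dd3 n (x : Rs n.+1) (y : Ms n.+2) (z : Ss n.+3) :
  - h (rd x) + t1 (t2 x - md y) + sd (- h x + t1 y + sd z) = 0.
Proof.
rewrite t1B !sdD s_dd addr0 sdN h_S t1_d.
by rewrite [sd _ + h _]addrC -[h _ + _ - _]addrA addKr addrACA subrr addNr addr0.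
Qed.

Definition cone (n : nat) : gbimod A C :=
  match n with
  | 0 => Ss 0
  | 1 => gsum (Ms 0) (Ss 1)
  | m.+2 => gsum (Rs m) (gsum (Ms m.+1) (Ss m.+2))
  end.
Definition cone_d (n : nat) : cone n.+1 -> cone n :=
  match n return cone n.+1 -> cone n with
  | 0 => fun u => t1 u.1 + sd u.2
  | 1 => fun u => (t2 u.1 - md u.2.1, - h u.1 + t1 u.2.1 + sd u.2.2)
  | m.+2 => fun u => (rd u.1, (t2 u.1 - md u.2.1, - h u.1 + t1 u.2.1 + sd u.2.2))
  end.

Let lower_mor n (u1 : gsum (Rs n) (gsum (Ms n.+1) (Ss n.+2)) -> _) :
  u1 = (fun u => (t2 u.1 - md u.2.1, - h u.1 + t1 u.2.1 + sd u.2.2)) ->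
  gmor (Y := gsum (Ms n) (Ss n.+1)) u1.
Proof.
move=> ->; have f1 := @gmor_fst _ _ _ A C (Rs n) (gsum (Ms n.+1) (Ss n.+2)).
have f2 := @gmor_snd _ _ _ A C (Rs n) (gsum (Ms n.+1) (Ss n.+2)).
have f21 := gmor_comp (@gmor_fst _ _ _ A C (Ms n.+1) (Ss n.+2)) f2.
have f22 := gmor_comp (@gmor_snd _ _ _ A C (Ms n.+1) (Ss n.+2)) f2.
apply: gmor_pair.
  exact: gmor_sub (gmor_comp (@t2_mor n) f1) (gmor_comp (@md_mor n) f21).
apply: gmor_add (gmor_comp (@sd_mor n.+1) f22).
exact: gmor_add (gmor_opp (gmor_comp (@h_mor n) f1)) (gmor_comp (@t1_mor n.+1) f21).
Qed.

Lemma cone_resolution : gresolution (P := cone) cone_d e.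
Proof.
split=> //.
- by case=> [|[|n]] //=; do ?apply: gproj_sum.
- case=> [|[|n]].
  + exact: (gmor_add (gmor_comp (@t1_mor 0%N) (@gmor_fst _ _ _ A C (Ms 0%N) (Ss 1%N)))
      (gmor_comp (@sd_mor 0%N) (@gmor_snd _ _ _ A C (Ms 0%N) (Ss 1%N)))).
  + exact: lower_mor.
  + apply: gmor_pair; last exact: lower_mor.
    exact: (gmor_comp (@rd_mor n)
      (@gmor_fst _ _ _ A C (Rs n.+1) (gsum (Ms n.+2) (Ss n.+3)))).
- move=> u; rewrite eE; split=> [/chase_exact0[y [z yz]]|[[y z] <-]].
    by exists (y, z).
  exact: chase_dd0.
- case=> [|[|n]] /=.
  + move=> [y z]; split=> [/chase_exact1[x [y' [z' [xE zE]]]]|[[x [y' z']] [<- <-]]].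
      by exists (x, (y', z')); rewrite /= xE zE.
    exact: chase_dd1.
  + move=> [x [y z]]; split=> [[xy xyz]|[[x' [y' z']] [<- <- <-]]] /=.
      have [x' x'E] := chase_rd0 xy; rewrite -x'E in xy xyz *.
      have [y' [z' [<- <-]]] := chase_exact2 xy xyz.
      by exists (x', (y', z')).
    by rewrite /= chase_dd2 chase_dd3.
  + move=> [x [y z]]; split=> [[dx xy xyz]|[[x' [y' z']] [<- <- <-]]] /=.
      have [x' x'E] := r_ex dx; rewrite -x'E in xy xyz *.
      have [y' [z' [<- <-]]] := chase_exact2 xy xyz.
      by exists (x', (y', z')).
    by rewrite /= r_dd chase_dd2 chase_dd3.
Qed.
End Chase.


Lemma gmor_bar_mul (k : fieldType) (S : algType k) (B : gralg S) :
  gmor (@bar_mul k S B).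
Proof.
have bal : balanced (fun (b : B_Bk B) (b' : barW (B_SB B) 0) => (b : B) * (b' : B)).
  apply: bilin_balanced => [c x x' y|c x y y'].
    by rewrite mulrDl scalerAl.
  by rewrite mulrDr scalerAr.
have D u v : bar_mul (u + v : barS B 0) = bar_mul u + bar_mul v.
  exact: (tliftD u v bal).
have m0 : bar_mul (0 : barS B 0) = 0 by apply: (addIr (bar_mul 0)); rewrite -D !add0r.
split; first split.
- by apply: (tlift_lin bal) => c b b'; rewrite scalerAl.
- move=> a; elim/tens_ind => [|b b'|u v IH IH'].
  + by rewrite lact0 m0 lact0.
  + by rewrite lact_pure !bar_mulE; exact/esym/mulrA.
  + by rewrite lactDr !D IH IH' lactDr.
- move=> u a; elim/tens_ind: u => [|b b'|u v IH IH'].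
  + by rewrite ract0 m0 ract0.
  + by rewrite ract_pure !bar_mulE; exact: mulrA.
  + by rewrite ractDl !D IH IH' ractDl.
- move=> i u; elim/tdeg_ind => [|j l b c <- hb hc|v w hv hw].
  + by rewrite m0; exact: deg0.
  + by rewrite bar_mulE; exact: ggrM.
  + by rewrite D; exact: degD.
Qed.

Theorem proposition2p2p1 (k : fieldType) (S : algType k) (M : bimod S S)
    (R : subbimod (tens M M)) (B : gralg S) (p : {lrmorphism talg M -> B})
    (B_quadratic : quad_presentation R p)
    (B_koszul : koszul B)
    (B_pd2 : gpd_eq (gaug_mod B) 2)
    (th2 : forall i, barR B R i -> barM B M i)
    (th1 : forall i, barM B M i -> barS B i)
    (h : forall i, barR B R i -> barS B i.+1)
    (th2_mor : forall i, gmor (th2 i))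
    (th1_mor : forall i, gmor (th1 i))
    (h_mor : forall i, gmor (h i))
    (th2_d : forall i (u : barR B R i.+1), bar_d (th2 i.+1 u) = th2 i (bar_d u))
    (th2_aug : forall u : barR B R 0, bar_aug (th2 0%N u) = dR p (bar_aug u))
    (th1_d : forall i (u : barM B M i.+1), bar_d (th1 i.+1 u) = th1 i (bar_d u))
    (th1_aug : forall u : barM B M 0, bar_aug (th1 0%N u) = dM p (bar_aug u))
    (h0 : forall u : barR B R 0, th1 0%N (th2 0%N u) = bar_d (h 0%N u))
    (hS : forall i (u : barR B R i.+1),
      th1 i.+1 (th2 i.+1 u) = bar_d (h i.+1 u) + h i (bar_d u)) :
  gresolution (X := greg B) (P := totP B R) (totd th2 th1 h) (@bar_mul k S B).
Proof.
have Sd := S_dualizable B_koszul; have Bd := B_locally_dualizable B_koszul.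
have Md := M_dualizable B_quadratic B_koszul.
have Rd := R_dualizable B_quadratic B_koszul.
have Rp i : gprojective (barR B R i) by apply: gproj_bar => //; exact: gproj_coef.
have Mp i : gprojective (barM B M i) by apply: gproj_bar => //; exact: gproj_coef.
have Sp i : gprojective (barS B i) by apply: gproj_bar => //; exact: gproj_reg.
have e_surj (x : B) : exists u : barS B 0, bar_mul u = x.
  by exists (tpure (1 : B_Bk B) (x : barW (B_SB B) 0)); rewrite bar_mulE mul1r.
exact: (@cone_resolution k S S B B (barR B R) (barM B M) (barS B) (greg B)
  (gtens (B_BS B) (coefR B R)) (gtens (B_BS B) (Defs.coefM B M)) (gtens (B_BS B) (B_SB B))
  (@bar_d k S B _) (@bar_d k S B _) (@bar_d k S B _)
  (@bar_aug k S B _) (@bar_aug k S B _) (@bar_aug k S B _) (dR p) (dM p) (@mulS k S B)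
  (@bar_mul k S B) th2 th1 h
  (@gmor_bar_d k S B _) (@gmor_bar_d k S B _) (@gmor_bar_d k S B _)
  th2_mor th1_mor h_mor (@gmor_bar_mul k S B) Rp Mp Sp
  (@bar_augD k S B _) (@bar_augD k S B _) (@bar_mul_aug k S B) e_surj
  (@bar_dd k S B _) (@bar_dd k S B _) (@bar_dd k S B _)
  (@bar_aug_d k S B _) (@bar_aug_d k S B _)
  (@bar_exact k S B _ Bd) (@bar_exact k S B _ Bd) (@bar_exact k S B _ Bd)
  (@bar_aug_exact k S B _ Bd) (@bar_aug_exact k S B _ Bd) (@bar_aug_exact k S B _ Bd)
  (@bar_aug_surj k S B _) (@bar_aug_surj k S B _)
  (dR_inj B_quadratic B_koszul (proj1 B_pd2)) (dR_exact B_quadratic B_koszul)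
  (dM_coexact B_quadratic) (mulS_dM B_quadratic)
  th2_d th2_aug th1_d th1_aug h0 hS).
Qed.
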